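(* Let $\mathcal F=(F_1,F_2)$ be a pair of finite sets of positive integers and $\alpha,\beta$ real numbers satisfying (A1) and (A2), and assume that $\alpha,\beta,\mathcal F$ are Jacobi admissible. Then: (1) $\alpha+k>-1$ and $\beta+k_1-k_2>-1$; (2) if moreover $\alpha+\beta+s_{\mathcal F}+1>0$, then $\Omega^{\alpha,\beta}_{\mathcal F}(x)\neq0$ for all $x\in[-1,1]$.
   Context: $(a)_0=1$, $(a)_j=a(a+1)\cdots(a+j-1)$. Jacobi polynomials: $P^{a,b}_n(x)=2^{-n}\sum_{j=0}^n\binom{n+a}{j}\binom{n+b}{n-j}(x-1)^{n-j}(x+1)^j$. A pair $\mathcal F=(F_1,F_2)$ consists of finite sets of positive integers, not both empty, $F_i=\{f^{(i)}_1<\dots<f^{(i)}_{k_i}\}$, $k=k_1+k_2$. (A1): $\alpha,\beta,\alpha+\beta\notin\{-1,-2,\dots\}$. (A2): if $F_2\ne\emptyset$, then $\alpha-\beta\notin\{-1,-2,\dots\}$ and $\beta-f^{(2)}_{k_2}-1\notin\{-1,-2,\dots\}$. $\Omega^{\alpha,\beta}_{\mathcal F}(x)=\det W(x)/(1+x)^{k_2(k_2-1)}$, with $W(x)$ the $k\times k$ matrix (columns $j=1..k$) with rows $((-1)^{j-1}(P^{\alpha,\beta}_f)^{(j-1)}(x))_j$ for $f\in F_1$ increasing, then $((\beta-f)_{j-1}(1+x)^{k-j}P^{\alpha+j-1,-\beta-j+1}_f(x))_j$ for $f\in F_2$ increasing. Jacobi admissibility: with $\mathcal H^{\alpha,\beta}_{\mathcal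 F}(x)=\prod_{f\in F_1}(x-f)(x+f+\alpha+\beta+1)\prod_{f\in F_2}(x+\beta-f)(x+f+\alpha+1)\cdot\frac{\Gamma(x+\alpha+1)\Gamma(x+\beta+1)}{(2x+\alpha+\beta+1)\Gamma(x+\alpha+\beta+1)}$, $\alpha,\beta,\mathcal F$ are Jacobi admissible if $\mathcal H^{\alpha,\beta}_{\mathcal F}(x)\ge0$ for all $x\in\mathbb N=\{0,1,2,\dots\}$. For a finite set $F=\{f_1<\dots<f_m\}$ of positive integers: $s_F=1$ if $F=\emptyset$; $s_F=m+1$ if $F=\{1,\dots,m\}$; otherwise $s_F=\min\{s\ge1:s<f_s\}$. $s_{\mathcal F}=s_{F_1}$. *)

(* Defs.v *)
(* Scalars live in an archimedean real field R
   (every archimedean ordered field embeds into the reals, so this is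
   equivalent to the statement over the real numbers). *)
From HB Require Import structures.
From mathcomp Require Import all_boot all_order all_algebra.
Set Implicit Arguments. Unset Strict Implicit. Unset Printing Implicit Defensive.
Import Order.TTheory GRing.Theory Num.Theory.
Local Open Scope ring_scope.

Section Jacobi.
Variable R : archiRealFieldType.

Definition not_negint (a : R) : Prop := forall n : nat, a <> - (n.+1)%:R.

Definition poch (a : R) (j : nat) : R := \prod_(i < j) (a + i%:R).

Definition gbinom (c : R) (j : nat) : R :=
  (\prod_(i < j) (c - i%:R)) / (j`!)%:R.

Definition jacobiP (a b : R) (n : nat) : {poly R} :=
  (2%:R ^- n) *: \sum_(j < n.+1)
     ((gbinom (n%:R + a) j * gbinom (n%:R + b) (n - j)) *:
        (('X - 1) ^+ (n - j) * ('X + 1) ^+ j)).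

(* The matrix W (as a polynomial matrix), rows/columns 0-indexed:
   F1 rows: ((-1)^j (P_f)^{(j)})_j ; F2 rows:
   ((beta-f)_j (1+X)^{k-1-j} P^{alpha+j,-beta-j}_f)_j.
   F1, F2 are given as strictly increasing sequences. *)
Definition Wmat (a b : R) (F1 F2 : seq nat) :
  'M[{poly R}]_(size F1 + size F2) :=
  let k := (size F1 + size F2)%N in
  \matrix_(i < k, j < k)
    if (i < size F1)%N then
      ((-1) ^+ j) *: (jacobiP a b (nth 0%N F1 i))^`(j)
    else
      let f := nth 0%N F2 (i - size F1) in
      (poch (b - f%:R) j)%:P * ('X + 1) ^+ (k - 1 - j)
        * jacobiP (a + j%:R) (- b - j%:R) f.

Definition Omega (a b : R) (F1 F2 : seq nat) : {poly R} :=
  (\det (Wmat a b F1 F2)) %/ ('X + 1) ^+ (size F2 * (size F2).-1).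

Definition Hfun (Gamma : R -> R) (a b : R) (F1 F2 : seq nat) (x : nat) : R :=
  let X := x%:R in
  (\prod_(f <- F1) ((X - f%:R) * (X + f%:R + a + b + 1)))
  * (\prod_(f <- F2) ((X + b - f%:R) * (X + f%:R + a + 1)))
  * (Gamma (X + a + 1) * Gamma (X + b + 1)
      / ((2%:R * X + a + b + 1) * Gamma (X + a + b + 1))).

Definition jacobi_admissible (Gamma : R -> R) (a b : R) (F1 F2 : seq nat) : Prop :=
  forall x : nat, 0 <= Hfun Gamma a b F1 F2 x.

End Jacobi.

(* s_F for a finite set F = {f_1 < ... < f_m} of positive integers
   (given as a strictly increasing sequence):
   1 if F is empty; m+1 if F = {1,...,m}; otherwise min{s >= 1 : s < f_s}. *)
Definition sF (F : seq nat) : nat :=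
  if F == [::] then 1%N
  else if F == iota 1 (size F) then (size F).+1
  else (find (fun s => (s < nth 0%N F s.-1)%N) (iota 1 (size F))).+1.

Definition posset (F : seq nat) : bool := sorted ltn F && all (fun f => 0 < f)%N F.

(* Main.v *)
(* Put [t = 1 + x] and [theta = t d/dt]. Each row of the matrix consists, up to
   elementary operations, of the [theta]-jets of a function [t^(-g) phi] that is
   an eigenfunction of the Jacobi operator, so that [Omega] is, up to a power of
   [t], the Wronskian [W] of these eigenfunctions, with eigenvalues [lambda_f].
   Let [Lam] be the (analytically continued) beta integral and [phi_n] the Jacobi
   polynomials. Admissibility says that
     [tau_n * Lam (phi_n ^ 2)], [tau_n = \prod_f (lambda_n - lambda_f)],
   has constant sign, i.e. that [B(p, r) = Lam (p * tau(L) r)] is semidefinite.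
   For every polynomial [q] there is a polynomial [p] such that, up to signs and
   powers of [t] and [2 - t],
     [B(p, r) = Lam (q * W(r))] for all [r], and [W(p) = q * W ^ 2],
   where [W(r)] is the Wronskian bordered by [r]. By Cauchy-Schwarz,
     [Lam (q * W(r)) ^ 2 <= C * Lam (q ^ 2 * W ^ 2)].
   If [W] vanished at some [t0] in (0, 2), then some [W(t^i)] would vanish there
   to a lower order than [W], and a family of [q] concentrating at [t0] would
   contradict this inequality. At the endpoints [W] reduces to Vandermonde
   determinants.
   The bound on [alpha] holds because otherwise the sum over [n] of suitable
   positive multiples of [Hfun n] telescopes to [0]; the bound on [beta] is the same
   statement for the family in which [F2] is replaced by its complement. *)

(* The obstacle is that alpha and beta may lie below -1, where the beta integral diverges and [Lam]
   is not positive. The freedom in q repairs this: a factor t^m (2 - t)^M in q moves both sides of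
   the Cauchy-Schwarz inequality to a functional with nonnegative parameters. The polynomial p is
   found by variation of constants: it combines the eigenfunctions with coefficients that are
   theta-antiderivatives of q times cofactors, and these exist because a shifted theta is diagonal
   on monomials. As the functional is given by its moments only, positivity comes from the norms of
   the Jacobi polynomials, and concentration from recurrences between central moments. The
   contradiction gains only a factor n^(1/2): for peaks of width n^(-1/2) at t0 and mass B, whose
   squares have mass B2, the left side has order B^2 n^(-2j) and the right side B2 n^(-2j-1), with
   B2 of order at most n^(1/2) B^2. Hence B2 / B^2 must be bounded with its exact power of n, which
   is the purpose of the central binomial coefficients. *)
Require Import Defs.
From HB Require Import structures.
From mathcomp Require Import all_boot all_order all_algebra all_fingroup.
From mathcomp Require Import ring lra zify.
Set Implicit Arguments. Unset Strict Implicit. Unset Printing Implicit Defensive.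
Import Order.TTheory GRing.Theory Num.Theory.
Local Open Scope ring_scope.

(** * Jacobi polynomials *)

Section JacobiPolynomials.
Variable R : archiRealFieldType.
Implicit Types (a b c : R) (n j : nat).

Lemma gbinom0 c : gbinom c 0 = 1.
Proof. by rewrite /gbinom big_ord0 fact0 divr1. Qed.

Lemma gbinomS c j : j.+1%:R * gbinom c j.+1 = (c - j%:R) * gbinom c j.
Proof.
rewrite /gbinom big_ord_recr /= factS natrM.
have h1 : (j`!)%:R != 0 :> R by rewrite pnatr_eq0 -lt0n fact_gt0.
have h2 : (j.+1)%:R != 0 :> R by rewrite pnatr_eq0.
by field; rewrite h1 addrC natr1 h2.
Qed.

Lemma gbinom_shift c j : (c + 1 - j%:R) * gbinom (c + 1) j = (c + 1) * gbinom c j.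
Proof.
rewrite /gbinom mulrA [RHS]mulrA; congr (_ / _).
transitivity (\prod_(i < j.+1) (c + 1 - i%:R)); first by rewrite big_ord_recr mulrC.
rewrite big_ord_recl subr0; congr (_ * _); apply: eq_bigr => i _.
by rewrite lift0 -natr1; ring.
Qed.

Lemma gbinom_pascal c j : gbinom (c + 1) j.+1 = gbinom c j.+1 + gbinom c j.
Proof.
have h2 : (j.+1)%:R != 0 :> R by rewrite pnatr_eq0.
apply: (mulfI h2); rewrite mulrDr !gbinomS gbinom_shift -mulrDl; congr (_ * _).
by rewrite -natr1; ring.
Qed.

(** Homogeneous form in t - 2 and t, that is in x - 1 and x + 1. Both t d/dt and (t - 2) d/dt
    preserve the degree n, so they act on the coefficients by two-term rules. *)
Definition homog n (c : nat -> R) : {poly R} :=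
  \sum_(j < n.+1) c j *: (('X - 2%:P) ^+ (n - j) * 'X^j).

Lemma eq_homog n (c d : nat -> R) :
  (forall j, (j <= n)%N -> c j = d j) -> homog n c = homog n d.
Proof. by move=> h; apply: eq_bigr => j _; rewrite h // -ltnS. Qed.

Lemma homogZ n k (c : nat -> R) : k *: homog n c = homog n (fun j => k * c j).
Proof. by rewrite scaler_sumr; apply: eq_bigr => j _; rewrite scalerA. Qed.

Lemma homogD n (c d : nat -> R) :
  homog n c + homog n d = homog n (fun j => c j + d j).
Proof. by rewrite -big_split /=; apply: eq_bigr => j _; rewrite scalerDl. Qed.

Lemma deriv_homog_term (l j : nat) :
  (('X - 2%:P) ^+ l * 'X^j : {poly R})^`() =
  l%:R *: (('X - 2%:P) ^+ l.-1 * 'X^j) + j%:R *: (('X - 2%:P) ^+ l * 'X^(j.-1)).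
Proof.
rewrite derivM deriv_exp derivB derivX derivC subr0 mul1r derivXn.
by rewrite mulrnAl mulrnAr -!scaler_nat.
Qed.

Lemma X_deriv_homog n (c : nat -> R) :
  'X * (homog n c)^`() =
  homog n (fun j => j%:R * c j + (n - j).+1%:R * (if j is i.+1 then c i else 0)).
Proof.
rewrite -homogD; transitivity
  (\sum_(j < n.+1) ((n - j)%:R * c j) *: (('X - 2%:P) ^+ (n - j).-1 * 'X^(j.+1))
   + homog n (fun j => j%:R * c j)).
  rewrite /homog raddf_sum mulr_sumr -big_split /=; apply: eq_bigr => j _.
  rewrite derivZ deriv_homog_term -scalerAr mulrDr scalerDr -!scalerAr !scalerA.
  congr (_ + _); first by rewrite mulrC mulrCA -exprS.
  rewrite mulrC mulrCA; case: (val j) => [|i]; first by rewrite !mul0r !scale0r.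
  by rewrite -exprS.
rewrite addrC; congr (_ + _).
rewrite big_ord_recr /= subnn mul0r scale0r addr0.
rewrite /homog [RHS]big_ord_recl mulr0 scale0r add0r; apply: eq_bigr => j _.
by rewrite /= /bump /= add1n -subn1 -subnDA addn1 subnSK.
Qed.

Lemma X2_deriv_homog n (c : nat -> R) :
  ('X - 2%:P) * (homog n c)^`() =
  homog n (fun j => (n - j)%:R * c j + j.+1%:R * (if (j < n)%N then c j.+1 else 0)).
Proof.
rewrite -homogD; transitivity
  (homog n (fun j => (n - j)%:R * c j) +
   \sum_(j < n.+1) (j%:R * c j) *: (('X - 2%:P) ^+ (n - j).+1 * 'X^(j.-1))).
  rewrite /homog raddf_sum mulr_sumr -big_split /=; apply: eq_bigr => j _.
  rewrite derivZ deriv_homog_term -scalerAr mulrDr scalerDr -!scalerAr !scalerA !mulrA -!exprS.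
  rewrite [c j * j%:R]mulrC [c j * _]mulrC; congr (_ + _).
  by case: (n - j)%N => [|i] //=; rewrite !mul0r !scale0r.
congr (_ + _).
rewrite big_ord_recl mul0r scale0r add0r /homog [RHS]big_ord_recr /= ltnn mulr0 scale0r addr0.
by apply: eq_bigr => j _; rewrite /= /bump /= add1n ltn_ord subnSK.
Qed.

Lemma deriv_homog n (c : nat -> R) :
  (homog n.+1 c)^`() =
  homog n (fun j => (n.+1 - j)%:R * c j + j.+1%:R * c j.+1).
Proof.
rewrite -homogD /homog raddf_sum /=.
under eq_bigr do rewrite derivZ deriv_homog_term scalerDr !scalerA.
rewrite big_split /=; congr (_ + _).
  rewrite big_ord_recr /= subnn mulr0 scale0r addr0; apply: eq_bigr => j _.
  by rewrite mulrC subSn ?(leq_ord j).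
rewrite big_ord_recl mulr0 scale0r add0r; apply: eq_bigr => j _.
by rewrite /= /bump /= add1n mulrC subSS.
Qed.

Definition jac a b n : {poly R} := jacobiP a b n \Po ('X - 1).

Lemma jacE a b n : jac a b n =
  (2 ^- n) *: homog n (fun j => gbinom (n%:R + a) j * gbinom (n%:R + b) (n - j)).
Proof.
rewrite /jac /jacobiP comp_polyZ raddf_sum; congr (_ *: _); apply: eq_bigr => j _.
rewrite /= comp_polyZ rmorphM /= !rmorphXn /= raddfB raddfD /= comp_polyX.
rewrite !rmorph1 subrK; congr (_ *: (_ ^+ _ * _)).
by rewrite -addrA -opprD -polyCD.
Qed.

(** A contiguity relation for theta. Composed with [jac_lower] it gives the differential equation;
    iterated, it produces the entries of the rows of F2. *)
Lemma jac_raise a b n :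
  'X * (jac a b n)^`() + b *: jac a b n = (n%:R + b) *: jac (a + 1) (b - 1) n.
Proof.
rewrite !jacE derivZ -scalerAr X_deriv_homog !homogZ homogD; apply: eq_homog => j jn.
rewrite !addrA.
have hb : (n%:R + b) * gbinom (n%:R + b - 1) (n - j) = (b + j%:R) * gbinom (n%:R + b) (n - j).
  rewrite -{1}[n%:R + b](subrK 1) -gbinom_shift subrK natrB //; congr (_ * _); ring.
have hS : (n - j).+1%:R * gbinom (n%:R + b) (n - j).+1 = (b + j%:R) * gbinom (n%:R + b) (n - j).
  by rewrite gbinomS natrB //; congr (_ * _); ring.
transitivity (2 ^- n * ((b + j%:R) * gbinom (n%:R + b) (n - j) * gbinom (n%:R + a + 1) j)); last first.
  by rewrite -hb; ring.
case: j jn hb hS => [|j] jn hb hS; first by rewrite !gbinom0 mulr0 addr0; ring.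
rewrite gbinom_pascal.
transitivity (2 ^- n * (j.+1%:R * (gbinom (n%:R + a) j.+1 * gbinom (n%:R + b) (n - j.+1))
  + gbinom (n%:R + a) j * ((n - j.+1).+1%:R * gbinom (n%:R + b) (n - j.+1).+1)
  + b * (gbinom (n%:R + a) j.+1 * gbinom (n%:R + b) (n - j.+1)))).
  by rewrite subnSK //; ring.
by rewrite hS; ring.
Qed.

Lemma jac_lower a b n :
  ('X - 2%:P) * (jac a b n)^`() + a *: jac a b n = (n%:R + a) *: jac (a - 1) (b + 1) n.
Proof.
rewrite !jacE derivZ -scalerAr X2_deriv_homog !homogZ homogD; apply: eq_homog => j jn.
rewrite !addrA.
have ha : (n%:R + a) * gbinom (n%:R + a - 1) j = (n%:R + a - j%:R) * gbinom (n%:R + a) j.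
  by rewrite -{1}[n%:R + a](subrK 1) -gbinom_shift subrK.
have hS : j.+1%:R * gbinom (n%:R + a) j.+1 = (n%:R + a - j%:R) * gbinom (n%:R + a) j.
  by rewrite gbinomS.
transitivity (2 ^- n * ((n%:R + a - j%:R) * gbinom (n%:R + a) j * gbinom (n%:R + b + 1) (n - j))); last first.
  by rewrite -ha; ring.
case: ltnP => jn'.
  have -> : (n - j = (n - j.+1).+1)%N by rewrite subnSK.
  rewrite gbinom_pascal.
  transitivity (2 ^- n * ((n - j.+1).+1%:R * (gbinom (n%:R + a) j * gbinom (n%:R + b) (n - j.+1).+1)
    + gbinom (n%:R + b) (n - j.+1) * (j.+1%:R * gbinom (n%:R + a) j.+1)
    + a * (gbinom (n%:R + a) j * gbinom (n%:R + b) (n - j.+1).+1))); first by ring.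
  rewrite hS subnSK // natrB //; ring.
have -> : j = n by apply/eqP; rewrite eqn_leq jn jn'.
by rewrite subnn !gbinom0 mulr0 addr0; ring.
Qed.

Lemma deriv_jac a b n :
  (jac a b n.+1)^`() = ((n%:R + a + b + 2) / 2) *: jac (a + 1) (b + 1) n.
Proof.
rewrite !jacE derivZ deriv_homog !homogZ; apply: eq_homog => j jn.
have e1 c : n%:R + (c + 1) = n.+1%:R + c by rewrite -natr1; ring.
rewrite !e1 subSS subSn //.
rewrite exprS invfM.
have hB : (n - j).+1%:R * gbinom (n.+1%:R + b) (n - j).+1
   = (b + j%:R + 1) * gbinom (n.+1%:R + b) (n - j).
  by rewrite gbinomS natrB // -natr1; congr (_ * _); ring.
have hA : j.+1%:R * gbinom (n.+1%:R + a) j.+1 = (n.+1%:R + a - j%:R) * gbinom (n.+1%:R + a) j.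
  by rewrite gbinomS.
transitivity (2^-1 * 2 ^- n * (gbinom (n.+1%:R + a) j * ((n - j).+1%:R * gbinom (n.+1%:R + b) (n - j).+1)
  + (j.+1%:R * gbinom (n.+1%:R + a) j.+1) * gbinom (n.+1%:R + b) (n - j))); first by ring.
rewrite hA hB -natr1; ring.
Qed.

Lemma jac0 a b : jac a b 0 = 1.
Proof.
by rewrite jacE expr0 invr1 scale1r /homog big_ord1 !gbinom0 mulr1 scale1r mulr1 expr0.
Qed.

Lemma jac_at0 a b n : (jac a b n).[0] = (-1) ^+ n * gbinom (n%:R + b) n.
Proof.
rewrite jacE hornerZ horner_sum big_ord_recl big1 ?addr0 => [|i _].
  rewrite subn0 gbinom0 mul1r hornerZ hornerM horner_exp hornerXsubC hornerXn expr0 mulr1.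
  have h2 : (2 : R) ^+ n != 0 by rewrite expf_neq0 // pnatr_eq0.
  by rewrite sub0r -[- 2%R]mulN1r exprMn; move: h2; set x := 2 ^+ n => h2; field.
by rewrite hornerZ hornerM hornerXn expr0n /= mulr0 mulr0.
Qed.

Lemma jac_at2 a b n : (jac a b n).[2] = gbinom (n%:R + a) n.
Proof.
rewrite jacE hornerZ horner_sum big_ord_recr /= big1 ?add0r => [|i _].
  rewrite subnn gbinom0 mulr1 hornerZ hornerM horner_exp hornerXsubC hornerXn expr0.
  by rewrite mul1r mulrCA mulVf ?mulr1 // expf_neq0 // pnatr_eq0.
rewrite hornerZ hornerM horner_exp hornerXsubC subrr expr0n.
by rewrite subn_eq0 leqNgt ltn_ord /= mul0r mulr0.
Qed.

(** The operator factors: [jac_raise] followed by [jac_lower] returns to the parameters (a, b). The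
    derivative of the first relation supplies the second-order term. *)
Lemma jac_ode a b n :
  'X * (2%:P - 'X) * (jac a b n)^`()^`()
  + ((2 * (b + 1))%:P - (a + b + 2) *: 'X) * (jac a b n)^`()
  + (n%:R * (n%:R + a + b + 1)) *: jac a b n = 0.
Proof.
have h1 := jac_raise a b n.
have h2 := jac_lower (a + 1) (b - 1) n.
rewrite addrK subrK in h2.
have h3 := congr1 (@deriv R) h1.
rewrite derivD derivM derivX !derivZ in h3.
rewrite -!mul_polyC in h1 h2 h3 *.
move: h1 h2 h3; set p := jac a b n; set q := jac _ _ n.
set p1 := p^`(); set p2 := p1^`(); set q1 := q^`() => h1 h2 h3.
transitivity (- (('X - 2%:P) * (1 * p1 + 'X * p2 + b%:P * p1)
  + (a + 1)%:P * ('X * p1 + b%:P * p) - (n%:R + b)%:P * ((n%:R + (a + 1))%:P * p))).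
  by rewrite !(polyCD, polyCM, polyC1, polyCN); ring.
rewrite h1 h3 -h2; ring.
Qed.

End JacobiPolynomials.

(** * The beta functional *)

Section BetaFunctional.
Variable R : archiRealFieldType.
Implicit Types (a b c : R) (n i : nat) (p q : {poly R}).

Lemma poch0 c : poch c 0 = 1. Proof. by rewrite /poch big_ord0. Qed.

Lemma pochS c n : poch c n.+1 = poch c n * (c + n%:R).
Proof. by rewrite /poch big_ord_recr. Qed.

Lemma pochSl c n : poch c n.+1 = c * poch (c + 1) n.
Proof.
rewrite /poch big_ord_recl addr0; congr (_ * _); apply: eq_bigr => i _.
by rewrite lift0 -natr1; ring.
Qed.

Lemma poch_add c m n : poch c (m + n) = poch c m * poch (c + m%:R) n.
Proof.
elim: n => [|n IH]; first by rewrite addn0 poch0 mulr1.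
by rewrite addnS !pochS IH natrD; ring.
Qed.

Definition nonpole c := forall n : nat, c + n%:R != 0.

Lemma nonpoleS c : nonpole c -> nonpole (c + 1).
Proof. by move=> h n; rewrite -addrA nat1r. Qed.

Lemma nonpole_addn c (m : nat) : nonpole c -> nonpole (c + m%:R).
Proof. by move=> h n; rewrite -addrA -natrD. Qed.

Lemma poch_neq0 c n : nonpole c -> poch c n != 0.
Proof. by move=> h; apply/prodf_neq0 => i _. Qed.

Lemma poch_gt0 c n : 0 < c -> 0 < poch c n.
Proof. by move=> h; apply: prodr_gt0 => i _; rewrite ltr_wpDr. Qed.

Lemma gt0_nonpole c : 0 < c -> nonpole c.
Proof. by move=> h n; rewrite gt_eqF // ltr_wpDr. Qed.

Lemma poly_lin_ind (P : {poly R} -> Prop) :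
  P 0 -> (forall k p q, P p -> P q -> P (k *: p + q)) -> (forall i, P 'X^i) ->
  forall p, P p.
Proof.
move=> h0 hD hX p; rewrite -[p]coefK poly_def.
by elim/big_ind: _ => // [q r hq hr|i _]; [rewrite -[q]scale1r|rewrite -[_ *: _]addr0];
  apply: hD.
Qed.

(** The quotient of the beta integrals of t^i and of 1; it is rational in a and b, which gives the
    continuation. *)
Definition beta_moment a b i := 2 ^+ i * poch (b + 1) i / poch (a + b + 2) i.

(* The functional [p |-> \int_0^2 p(t) (2-t)^a t^b dt], normalised to take
   the value 1 at 1 and continued analytically in [a] and [b]. *)
Definition Lam a b p := \sum_(i < size p) p`_i * beta_moment a b i.

Lemma Lam_wide a b n p : (size p <= n)%N ->
  Lam a b p = \sum_(i < n) p`_i * beta_moment a b i.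
Proof.
move=> le; rewrite /Lam (big_ord_widen n (fun i => p`_i * beta_moment a b i)) //.
rewrite big_mkcond; apply: eq_bigr => i _; case: ltnP => // h.
by rewrite nth_default // mul0r.
Qed.

Fact Lam_is_linear a b : scalar (Lam a b).
Proof.
move=> k p q; pose n := maxn (size (k *: p + q)) (maxn (size p) (size q)).
rewrite !(@Lam_wide a b n) ?leq_max ?leqnn ?orbT // mulr_sumr -big_split /=.
by apply: eq_bigr => i _; rewrite coefD coefZ; ring.
Qed.

HB.instance Definition _ a b :=
  GRing.isLinear.Build R {poly R} R *%R (Lam a b) (@Lam_is_linear a b).

Lemma LamZ a b k p : Lam a b (k *: p) = k * Lam a b p.
Proof. exact: linearZ. Qed.

Lemma LamD a b p q : Lam a b (p + q) = Lam a b p + Lam a b q.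
Proof. exact: linearD. Qed.

Lemma LamB a b p q : Lam a b (p - q) = Lam a b p - Lam a b q.
Proof. exact: linearB. Qed.

Lemma Lam_sum a b (I : Type) (r : seq I) (P : pred I) (F : I -> {poly R}) :
  Lam a b (\sum_(i <- r | P i) F i) = \sum_(i <- r | P i) Lam a b (F i).
Proof. exact: linear_sum. Qed.

Lemma Lam_Xn a b i : Lam a b 'X^i = beta_moment a b i.
Proof.
rewrite /Lam size_polyXn big_ord_recr big1 /= ?coefXn ?eqxx ?mul1r ?add0r // => j _.
by rewrite coefXn ltn_eqF ?mul0r.
Qed.

Lemma Lam1 a b : Lam a b 1 = 1.
Proof. by rewrite -(expr0 'X) Lam_Xn /beta_moment !poch0 expr0 mulr1 divr1. Qed.

Lemma beta_momentS a b i : nonpole (a + b + 2) ->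
  beta_moment a b i.+1 = 2 * (b + 1 + i%:R) / (a + b + 2 + i%:R) * beta_moment a b i.
Proof.
move=> h; rewrite /beta_moment !pochS exprS.
by have h1 := h i; have h2 := poch_neq0 i h; field; rewrite h1 h2.
Qed.

(** Integration by parts: the argument, times the weight, is the derivative of (2 - t)^(a+1) t^(b+1)
    g. On monomials it is the recurrence of the moments. *)
Lemma Lam_pearson a b : nonpole (a + b + 2) -> forall g,
  Lam a b ((2%:P - 'X) * ('X * g^`()) + ((2 * (b + 1))%:P - (a + b + 2) *: 'X) * g) = 0.
Proof.
move=> h; apply: poly_lin_ind => [|k p q hp hq|i].
- by rewrite derivC !mulr0 addr0 linear0.
- transitivity (Lam a b (k *: ((2%:P - 'X) * ('X * p^`())
     + ((2 * (b + 1))%:P - (a + b + 2) *: 'X) * p)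
     + ((2%:P - 'X) * ('X * q^`()) + ((2 * (b + 1))%:P - (a + b + 2) *: 'X) * q))).
    congr Lam; rewrite derivD derivZ -!mul_polyC; ring.
  by rewrite linearD linearZ /= hp hq mulr0 addr0.
transitivity (Lam a b ((2 * (b + 1 + i%:R)) *: 'X^i - (a + b + 2 + i%:R) *: 'X^(i.+1))).
  congr Lam; rewrite derivXn -scaler_nat -scalerAr.
  have -> : i%:R *: ('X * 'X^(i.-1)) = i%:R *: 'X^i :> {poly R}.
    by case: i => [|i]; rewrite ?scale0r // -exprS.
  by rewrite exprS -!mul_polyC !(polyCD, polyCM); ring.
rewrite linearB !linearZ /= !Lam_Xn beta_momentS //.
by have hi := h i; field; rewrite hi.
Qed.

Lemma Lam_mulX a b p : nonpole (a + b + 2) ->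
  Lam a b ('X * p) = 2 * (b + 1) / (a + b + 2) * Lam a (b + 1) p.
Proof.
move=> h; elim/poly_lin_ind: p => [|k p q hp hq|i].
- by rewrite mulr0 !linear0 mulr0.
- by rewrite mulrDr -scalerAr !linearD !linearZ /= hp hq; ring.
rewrite -exprS !Lam_Xn /beta_moment pochSl [poch (a + b + 2) _]pochSl exprS.
have -> : a + (b + 1) + 2 = a + b + 2 + 1 by ring.
have h0 := h 0%N; have h1 := poch_neq0 i (nonpoleS h); rewrite addr0 in h0.
by field; rewrite h0 h1.
Qed.

Lemma Lam_mul2X a b p : nonpole (a + b + 2) ->
  Lam a b ((2%:P - 'X) * p) = 2 * (a + 1) / (a + b + 2) * Lam (a + 1) b p.
Proof.
move=> h; elim/poly_lin_ind: p => [|k p q hp hq|i].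
- by rewrite mulr0 !linear0 mulr0.
- by rewrite mulrDr -scalerAr !linearD !linearZ /= hp hq; ring.
rewrite mulrBl -exprS mul_polyC linearB linearZ /= !Lam_Xn beta_momentS // /beta_moment.
have -> : a + 1 + b + 2 = a + b + 2 + 1 by ring.
have h0 := h 0%N; have h1 := poch_neq0 i (nonpoleS h); rewrite addr0 in h0.
have h2 := poch_neq0 i h; have h3 := h i.
have e : poch (a + b + 2) i * (a + b + 2 + i%:R) = (a + b + 2) * poch (a + b + 2 + 1) i.
  by rewrite -pochS pochSl.
have {e} -> : poch (a + b + 2) i = (a + b + 2) * poch (a + b + 2 + 1) i / (a + b + 2 + i%:R).
  by rewrite -e mulfK.
by field; rewrite h0 h1 h3.
Qed.

Definition jac_eig a b n := n%:R * (n%:R + a + b + 1).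

Lemma jac_eig_inj a b m n : nonpole (a + b + 1) -> m != n ->
  jac_eig a b m != jac_eig a b n.
Proof.
move=> h mn; rewrite -subr_eq0.
have -> : jac_eig a b m - jac_eig a b n = (m%:R - n%:R) * (a + b + 1 + (m + n)%:R).
  by rewrite /jac_eig natrD; ring.
by rewrite mulf_neq0 // subr_eq0 eqr_nat.
Qed.

(** The Pearson identity for the Wronskian of the two polynomials yields the difference of the
    eigenvalues times the pairing. *)
Lemma jac_orthogonal a b m n : nonpole (a + b + 1) -> m != n ->
  Lam a b (jac a b m * jac a b n) = 0.
Proof.
move=> h mn; have h2 : nonpole (a + b + 2).
  by have := nonpoleS h; rewrite -addrA.
have := Lam_pearson h2 (jac a b m * (jac a b n)^`() - jac a b n * (jac a b m)^`()).
have om := jac_ode a b m; have on := jac_ode a b n.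
set p := jac a b m in om *; set q := jac a b n in on *.
rewrite -!/(jac_eig a b _) in om on.
move=> hL; apply: (mulfI (x := jac_eig a b m - jac_eig a b n)).
  by rewrite subr_eq0 jac_eig_inj.
rewrite mulr0 -[RHS]hL -[LHS]linearZ /=; congr Lam.
apply/eqP; rewrite -subr_eq0; apply/eqP.
rewrite derivB !derivM.
move: om on; set OM := (X in X = 0); set ON := (X in _ -> X = 0 -> _) => om on.
transitivity (q * OM - p * ON); last by rewrite om on !mulr0 subr0.
by rewrite /OM /ON -!mul_polyC !(polyCD, polyCM, polyC1, polyCN); ring.
Qed.

(** The Pearson identity for p p' turns the norm of p into that of p', a Jacobi polynomial with both
    parameters raised; the extra factor t (2 - t) is absorbed by the weight. *)
Lemma jac_sqnormS a b n : nonpole (a + b + 1) ->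
  Lam a b (jac a b n.+1 ^+ 2) = (n%:R + a + b + 2) * (a + 1) * (b + 1)
    / (n.+1%:R * (a + b + 2) * (a + b + 3)) * Lam (a + 1) (b + 1) (jac (a + 1) (b + 1) n ^+ 2).
Proof.
move=> h; have h2 : nonpole (a + b + 2) by have := nonpoleS h; rewrite -addrA.
have h3 : nonpole (a + (b + 1) + 2).
  have -> : a + (b + 1) + 2 = a + b + 2 + 1 by ring.
  exact: nonpoleS.
have := Lam_pearson h2 (jac a b n.+1 * (jac a b n.+1)^`()).
have om := jac_ode a b n.+1; set p := jac a b n.+1 in om *.
rewrite -!/(jac_eig a b _) in om.
move=> hL; have {}hL : jac_eig a b n.+1 * Lam a b (p ^+ 2) =
    Lam a b ('X * ((2%:P - 'X) * (p^`() ^+ 2))).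
  apply/eqP; rewrite -subr_eq0 -linearZ /= -linearB -[0]oppr0 -{}hL; apply/eqP.
  rewrite -linearN; congr Lam; apply/eqP; rewrite -subr_eq0; apply/eqP.
  move: om; set OM := (X in X = 0) => om.
  transitivity (p * OM); last by rewrite om mulr0.
  by rewrite /OM derivM -!mul_polyC !(polyCD, polyCM, polyC1, polyCN); ring.
rewrite Lam_mulX // Lam_mul2X // deriv_jac exprZn linearZ /= in hL.
have e : jac_eig a b n.+1 = n.+1%:R * (n%:R + a + b + 2) by rewrite /jac_eig -natr1; ring.
have f0 : n%:R + a + b + 2 != 0 by have := h2 n; rewrite addrC !addrA.
have f1 : n.+1%:R != 0 :> R by rewrite pnatr_eq0.
have f2 : a + b + 2 != 0 by have := h2 0%N; rewrite addr0.
have f3 : a + b + 3 != 0.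
  by have -> : a + b + 3 = a + b + 2 + 1%:R by ring.
rewrite e in hL; apply: (mulfI (mulf_neq0 f1 f0)); rewrite hL.
have -> : a + (b + 1) + 2 = a + b + 3 by ring.
by rewrite -natr1 in f1 *; field; rewrite f1 f2 f3.
Qed.

Lemma jac_sqnorm a b n : nonpole (a + b + 1) ->
  Lam a b (jac a b n ^+ 2) = (a + b + 1) * poch (a + 1) n * poch (b + 1) n
    / (n`!%:R * (n%:R *+ 2 + a + b + 1) * poch (a + b + 1) n).
Proof.
elim: n a b => [|n IH] a b h.
  have h0 := h 0%N; rewrite addr0 in h0.
  by rewrite jac0 expr1n Lam1 !poch0 fact0 mul0rn add0r !mulr1 mul1r divff.
have e1 : a + 1 + (b + 1) + 1 = a + b + 1 + 1 + 1 by ring.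
have h' : nonpole (a + 1 + (b + 1) + 1) by rewrite e1; do 2!apply: nonpoleS.
rewrite jac_sqnormS // IH // !(pochSl (_ + 1)) e1.
have g0 := h 0%N; have g1 := h 1%N; have g2 := h 2; rewrite addr0 in g0.
have e2 : poch (a + b + 1 + 1) n * (a + b + 1 + 1 + n%:R)
     = (a + b + 1 + 1) * poch (a + b + 1 + 1 + 1) n by rewrite -pochS pochSl.
have gn : a + b + 1 + 1 + n%:R != 0 by apply: nonpoleS.
have {e2} -> : poch (a + b + 1 + 1) n
    = (a + b + 1 + 1) * poch (a + b + 1 + 1 + 1) n / (a + b + 1 + 1 + n%:R).
  by rewrite -e2 mulfK.
have k1 := poch_neq0 n (nonpoleS (nonpoleS h)).
have k2 : n`!%:R != 0 :> R by rewrite pnatr_eq0 -lt0n fact_gt0.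
have k3 : n.+1%:R != 0 :> R by rewrite pnatr_eq0.
have k4 := h (n.+1 + n.+1)%N; rewrite natrD in k4.
rewrite factS natrM; move: g0 g1 g2 gn k1 k2 k3 k4.
have -> : n%:R + a + b + 2 = a + b + 1 + 1 + n%:R by ring.
have -> : a + b + 2 = a + b + 1 + 1%:R by ring.
have -> : a + b + 3 = a + b + 1 + 2%:R by ring.
have -> : n%:R *+ 2 + (a + 1) + (b + 1) + 1 = a + b + 1 + (n.+1%:R + n.+1%:R).
  by rewrite -!natr1; ring.
have -> : n.+1%:R *+ 2 + a + b + 1 = a + b + 1 + (n.+1%:R + n.+1%:R) by ring.
rewrite -[a + b + 1 + 1 + 1]/(a + b + 1 + 1 + 1).
have -> : a + b + 1 + 1 + 1 = a + b + 1 + 2%:R by ring.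
set s := a + b + 1; set A := poch (a + 1 + 1) n; set B := poch (b + 1 + 1) n.
set S := poch (s + 2%:R) n; set F := n`!%:R; set y := n.+1%:R + n.+1%:R.
set x := n%:R; set z := n.+1%:R; rewrite -[1%:R]/(1 : R).
clearbody s A B S F y x z => {h IH e1 h'}.
move=> g0 g1 g2 gn k1 k2 k3 k4; field.
by rewrite g0 g1 g2 gn k1 k2 k3 k4.
Qed.

Lemma size_jac a b n : nonpole (a + b + 1) -> size (jac a b n) = n.+1.
Proof.
elim: n a b => [|n IH] a b h; first by rewrite jac0 size_poly1.
have h' : nonpole (a + 1 + (b + 1) + 1).
  have -> : a + 1 + (b + 1) + 1 = a + b + 1 + 1 + 1 by ring.
  by do 2!apply: nonpoleS.
have c0 : (n%:R + a + b + 2) / 2 != 0.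
  rewrite mulf_neq0 ?invr_eq0 ?pnatr_eq0 //.
  have -> : n%:R + a + b + 2 = a + b + 1 + n.+1%:R by rewrite -natr1; ring.
  exact: h.
have /(congr1 (fun p : {poly R} => size p)) := deriv_jac a b n.
rewrite size_scale // IH //; set p := jac a b n.+1 => hs.
have sp : (1 < size p)%N.
  rewrite ltnNge; apply/negP => /size1_polyC e.
  by move: hs; rewrite e derivC size_poly0.
apply/eqP; rewrite eqn_leq; apply/andP; split; last first.
  by rewrite -hs lt_size_deriv // -size_poly_gt0 (ltn_trans _ sp).
case E : (size p) sp => [|[|m]] // _; rewrite ltnS ltnNge.
apply/negP => lt_m; have : p^`()`_m = 0 by rewrite nth_default // hs.
rewrite coef_deriv => /eqP; rewrite mulrn_eq0 /= => /eqP pm.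
have : lead_coef p = 0 by rewrite /lead_coef E /= pm.
by move/eqP; rewrite lead_coef_eq0 -size_poly_eq0 E.
Qed.

Lemma jac_basis a b : nonpole (a + b + 1) -> forall N p, (size p <= N)%N ->
  exists c : nat -> R, p = \sum_(n < N) c n *: jac a b n.
Proof.
move=> h; elim=> [|N IH] p sp.
  by exists (fun=> 0); rewrite big_ord0; apply/eqP; rewrite -size_poly_leq0.
have sj := size_jac N h.
have l0 : lead_coef (jac a b N) != 0 by rewrite lead_coef_eq0 -size_poly_eq0 sj.
pose k := p`_N / lead_coef (jac a b N).
have /IH [c hc] : (size (p - k *: jac a b N)%R <= N)%N.
  apply/leq_sizeP => j; rewrite leq_eqVlt coefB coefZ => /predU1P[<-|lt_j].
    by rewrite /k /lead_coef sj /= divfK ?subrr //; move: l0; rewrite /lead_coef sj.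
  by rewrite !nth_default ?mulr0 ?subr0 // ?sj // (leq_trans sp).
exists (fun n => if n == N then k else c n); rewrite big_ord_recr /= eqxx.
rewrite -[p](subrK (k *: jac a b N)) {1}hc; congr (_ + _).
by apply: eq_bigr => i _; rewrite ltn_eqF.
Qed.

Lemma Lam_sum_jac a b : nonpole (a + b + 1) -> forall N (c : nat -> R) n, (n < N)%N ->
  Lam a b ((\sum_(m < N) c m *: jac a b m) * jac a b n) = c n * Lam a b (jac a b n ^+ 2).
Proof.
move=> h N c n lt; rewrite mulr_suml linear_sum (bigD1 (Ordinal lt)) //= big1 ?addr0.
  by rewrite -scalerAl linearZ.
by move=> i ne; rewrite -scalerAl linearZ /= jac_orthogonal ?mulr0.
Qed.

Lemma jac_sqnorm_gt0 a b n : 0 <= a -> 0 <= b -> 0 < Lam a b (jac a b n ^+ 2).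
Proof.
move=> a0 b0; have s0 : 0 < a + b + 1 by rewrite ltr_wpDl ?addr_ge0.
rewrite jac_sqnorm; last exact: gt0_nonpole.
rewrite divr_gt0 ?mulr_gt0 ?poch_gt0 ?ltr_wpDl ?addr_ge0 ?mulrn_wge0 //.
by rewrite ltr0n fact_gt0.
Qed.

(** In the orthogonal basis of Jacobi polynomials [Lam a b (p ^+ 2)] is a sum of squares with the
    positive weights of [jac_sqnorm_gt0]. *)
Lemma Lam_sqr_ge0 a b p : 0 <= a -> 0 <= b -> 0 <= Lam a b (p ^+ 2).
Proof.
move=> a0 b0; have h : nonpole (a + b + 1) by apply: gt0_nonpole; rewrite ltr_wpDl ?addr_ge0.
move: (leqnn (size p)); move: {2}(size p) => N /(jac_basis h) [c hc].
rewrite expr2 {2}hc mulr_sumr linear_sum sumr_ge0 // => i _.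
rewrite -scalerAr linearZ /= {1}hc Lam_sum_jac // mulrA -expr2.
by rewrite mulr_ge0 ?sqr_ge0 // ltW // jac_sqnorm_gt0.
Qed.

Lemma discr_le (x y z : R) :
  (forall k l : R, 0 <= k ^+ 2 * x + 2 * k * l * y + l ^+ 2 * z) -> y ^+ 2 <= x * z.
Proof.
move=> H; have x0 : 0 <= x.
  by have := H 1 0; rewrite expr1n mul1r mulr0 mul0r expr0n mul0r !addr0.
have [xz|xz] := eqVneq x 0.
  rewrite xz mul0r; have [->|y0] := eqVneq y 0; first by rewrite expr0n.
  (* With x = 0 the form is linear in k for l = 1; this k makes its value -1. *)
  have := H (- (z + 1) / (2 * y)) 1; rewrite xz mulr0 add0r mulr1 expr1n mul1r.
  have -> : 2 * (- (z + 1) / (2 * y)) * y = - (z + 1) by field.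
  by rewrite opprD addrAC addNr add0r oppr_ge0 ler10.
have x1 : 0 < x by rewrite lt_def xz.
have := H (- y) x; rewrite [X in _ <= X](_ : _ = x * (x * z - y ^+ 2)); last by ring.
by rewrite pmulr_rge0 // subr_ge0.
Qed.

Lemma Lam_cauchy a b p q : 0 <= a -> 0 <= b ->
  Lam a b (p * q) ^+ 2 <= Lam a b (p ^+ 2) * Lam a b (q ^+ 2).
Proof.
move=> a0 b0; apply: discr_le => k l.
have := Lam_sqr_ge0 (k *: p + l *: q) a0 b0; congr (_ <= _).
rewrite -!LamZ -!LamD; congr Lam; rewrite -!mul_polyC !rmorphM /=; ring.
Qed.

Lemma sum_cauchy n (w c d : 'I_n -> R) : (forall i : 'I_n, 0 <= w i) ->
  (\sum_i w i * c i * d i) ^+ 2 <= (\sum_i w i * c i ^+ 2) * (\sum_i w i * d i ^+ 2).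
Proof.
move=> w0; apply: discr_le => k l; rewrite !mulr_sumr -!big_split /=.
apply: sumr_ge0 => i _.
have -> : k ^+ 2 * (w i * c i ^+ 2) + 2 * k * l * (w i * c i * d i) + l ^+ 2 * (w i * d i ^+ 2)
  = w i * (k * c i + l * d i) ^+ 2 by ring.
by rewrite mulr_ge0 ?sqr_ge0.
Qed.
End BetaFunctional.

(** * Concentration of beta weights *)

Section CentralBinomials.
Variable R : archiRealFieldType.
Implicit Types (a b c : R) (n i l m : nat) (p q : {poly R}).

(** The coefficient of z^n in (1 - z)^(-c), of order n^(c-1). *)
Definition gpoch c n : R := poch c n / n`!%:R.

Lemma gpoch0 c : gpoch c 0 = 1.
Proof. by rewrite /gpoch poch0 fact0 divr1. Qed.

Lemma fact_neq0 n : n`!%:R != 0 :> R.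
Proof. by rewrite pnatr_eq0 -lt0n fact_gt0. Qed.

Lemma gpochS c n : n.+1%:R * gpoch c n.+1 = (c + n%:R) * gpoch c n.
Proof.
have h := fact_neq0 n; have h' : n.+1%:R != 0 :> R by rewrite pnatr_eq0.
by rewrite /gpoch pochS factS natrM; rewrite -natr1 in h' *; field; rewrite h h'.
Qed.

Lemma gpoch_gt0 c n : 0 < c -> 0 < gpoch c n.
Proof. by move=> c0; rewrite divr_gt0 ?poch_gt0 // ltr0n fact_gt0. Qed.

Lemma gpoch_le c m n : 1 <= c -> (m <= n)%N -> gpoch c m <= gpoch c n.
Proof.
move=> c1 /subnK <-; elim: (n - m)%N => // k; set u := (k + m)%N => IH.
apply: le_trans IH _; rewrite addSn.
have g0 : 0 < gpoch c u by rewrite gpoch_gt0 // (lt_le_trans ltr01).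
have u0 : 0 < u.+1%:R :> R by rewrite ltr0n.
rewrite -(ler_pM2l u0) gpochS -natr1 ler_wpM2r ?(ltW g0) //; lra.
Qed.

(** One step multiplies [gpoch c] by (c + u) / (u + 1) <= 1 + A / (u + 1), which by Bernoulli is at
    most ((u + 2) / (u + 1))^A. *)
Lemma gpoch_growth c (A : nat) m n : 1 <= c -> c <= A.+1%:R -> (m <= n)%N ->
  gpoch c n * m.+1%:R ^+ A <= gpoch c m * n.+1%:R ^+ A.
Proof.
move=> c1 cA /subnK <-; elim: (n - m)%N => // k; set u := (k + m)%N => IH.
rewrite addSn -/u.
have g0 : 0 < gpoch c u by rewrite gpoch_gt0 // (lt_le_trans ltr01).
have gm : 0 < gpoch c m by rewrite gpoch_gt0 // (lt_le_trans ltr01).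
have u0 : 0 < u.+1%:R :> R by rewrite ltr0n.
have step : (c + u%:R) * u.+1%:R ^+ A <= u.+1%:R * u.+2%:R ^+ A.
  have bern : 1 + A%:R / u.+1%:R <= (1 + u.+1%:R^-1) ^+ A :> R.
    elim: (A) => [|B IHB]; first by rewrite mul0r addr0.
    rewrite exprS -natr1 mulrDl mul1r.
    have z0 : 0 < u.+1%:R^-1 :> R by rewrite invr_gt0.
    have := ler_wpM2l (ltW (ltr_wpDr (ltW z0) (@ltr01 R))) IHB.
    apply: le_trans; have := ler0n R B; set z := u.+1%:R^-1 in z0 *; nra.
  have e : u.+2%:R = u.+1%:R * (1 + u.+1%:R^-1) :> R.
    by rewrite mulrDr mulr1 divff ?natr1 // gt_eqF.
  rewrite e exprMn mulrCA mulrC ler_wpM2l ?exprn_ge0 ?(ltW u0) //.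
  apply: le_trans (ler_wpM2l (ltW u0) bern).
  rewrite mulrDr mulr1 mulrCA divff ?gt_eqF // mulr1 -natr1; move: cA; rewrite -natr1; lra.
rewrite -(ler_pM2l u0) mulrA gpochS -(ler_pM2r (exprn_gt0 A u0)).
apply: le_trans (_ : (c + u%:R) * u.+1%:R ^+ A * (gpoch c m * u.+1%:R ^+ A) <= _).
  rewrite [leLHS](_ : _ = (c + u%:R) * u.+1%:R ^+ A * (gpoch c u * m.+1%:R ^+ A)); last by ring.
  by rewrite ler_wpM2l // mulr_ge0 ?exprn_ge0 // addr_ge0 // (le_trans ler01).
rewrite [leRHS](_ : _ = u.+1%:R * u.+2%:R ^+ A * (gpoch c m * u.+1%:R ^+ A)); last by ring.
by apply: (ler_wpM2r (mulr_ge0 (ltW gm) (exprn_ge0 A (ltW u0)))) step.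
Qed.

(** The left side has order n^(c+c'-1) and the product n^(c+c'-2), whence the factor n + 1. *)
Lemma gpoch_prod c c' n : 1 <= c -> 1 <= c' ->
  gpoch (c + c') n <= n.+1%:R * (gpoch c n * gpoch c' n).
Proof.
move=> c1 c1'; elim: n => [|n IH]; first by rewrite !gpoch0 !mulr1.
have n0 : 0 <= n%:R :> R by [].
have g0 : 0 < gpoch c n by rewrite gpoch_gt0 // (lt_le_trans ltr01).
have g0' : 0 < gpoch c' n by rewrite gpoch_gt0 // (lt_le_trans ltr01).
have u0 : 0 < n.+1%:R :> R by rewrite ltr0n.
rewrite -(ler_pM2l (mulr_gt0 u0 u0)).
rewrite -[leLHS]mulrA gpochS.
rewrite [leRHS](_ : _ = n.+2%:R * ((n.+1%:R * gpoch c n.+1) * (n.+1%:R * gpoch c' n.+1))); last by ring.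
rewrite !gpochS mulrCA.
have cc : 0 <= c + c' + n%:R by lra.
apply: le_trans (ler_wpM2l cc (ler_wpM2l (ltW u0) IH)) _.
rewrite [leLHS](_ : _ = ((c + c' + n%:R) * n.+1%:R ^+ 2) * (gpoch c n * gpoch c' n)); last by ring.
rewrite [leRHS](_ : _ = (n.+2%:R * ((c + n%:R) * (c' + n%:R))) * (gpoch c n * gpoch c' n)); last by ring.
rewrite (ler_wpM2r (ltW (mulr_gt0 g0 g0'))) // -[n.+2%:R]natr1 -!natr1.
have : 0 <= (c - 1) * (c' - 1) by rewrite mulr_ge0 ?subr_ge0.
set x := n%:R in n0 *; nra.
Qed.

Definition cbin n : R := n.*2`!%:R / n`!%:R ^+ 2.

Lemma cbin_gt0 n : 0 < cbin n.
Proof. by rewrite divr_gt0 ?exprn_gt0 ?ltr0n ?fact_gt0. Qed.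

Lemma cbinS n : n.+1%:R * cbin n.+1 = 2 * (2 * n%:R + 1) * cbin n.
Proof.
have h := fact_neq0 n; have h' : n.+1%:R != 0 :> R by rewrite pnatr_eq0.
rewrite /cbin doubleS !factS !natrM -[n.*2.+2%:R]natr1 -[n.*2.+1%:R]natr1.
rewrite -mul2n natrM.
by rewrite -natr1 in h' *; field; rewrite h h'.
Qed.

(** Together with [cbin_lower] this fixes the order 4^n n^(-1/2) of the central binomial
    coefficient; squaring avoids the square root. *)
Lemma cbin_upper n : cbin n ^+ 2 * (2 * n%:R + 1) <= 16 ^+ n.
Proof.
elim: n => [|n IH].
  by rewrite /cbin fact0 expr1n divr1 expr1n mulr0 add0r mulr1.
have u0 : 0 < n.+1%:R :> R by rewrite ltr0n.
rewrite -(ler_pM2l (exprn_gt0 2 u0)) mulrA -exprMn cbinS.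
rewrite [16 ^+ n.+1]exprS [leRHS]mulrA.
have c0 : 0 <= n.+1%:R ^+ 2 * 16 :> R by rewrite mulr_ge0 ?sqr_ge0.
apply: le_trans (ler_wpM2l c0 IH).
have n0 : 0 <= n%:R :> R by [].
have : 0 <= cbin n ^+ 2 by apply: sqr_ge0.
rewrite -natr1; set x := n%:R in n0 *; set y := cbin n ^+ 2 => y0.
rewrite [leLHS](_ : _ = (4 * (2 * x + 1) ^+ 2 * (2 * (x + 1) + 1)) * y); last by rewrite /y; ring.
rewrite [leRHS](_ : _ = (16 * (x + 1) ^+ 2 * (2 * x + 1)) * y); last by rewrite /y; ring.
by rewrite ler_wpM2r //; nra.
Qed.

Lemma cbin_lower n : (0 < n)%N -> 16 ^+ n <= 4 * n%:R * cbin n ^+ 2.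
Proof.
case: n => // n _; elim: n => [|n IH].
  have h : cbin 1 = 2 by rewrite /cbin /= !factS fact0; field.
  by rewrite h; lra.
have u0 : 0 < n.+2%:R :> R by rewrite ltr0n.
rewrite -(ler_pM2l u0) [16 ^+ n.+2]exprS [leLHS]mulrA.
have c0 : 0 <= n.+2%:R * 16 :> R by rewrite mulr_ge0 // ltW.
apply: le_trans (ler_wpM2l c0 IH) _.
rewrite [leRHS](_ : _ = 4 * (n.+2%:R * cbin n.+2) ^+ 2); last by ring.
rewrite cbinS -[n.+2%:R]natr1.
have n0 : 0 <= n.+1%:R :> R by [].
have : 0 <= cbin n.+1 ^+ 2 by apply: sqr_ge0.
set x := n.+1%:R in n0 *; set y := cbin _ => y0.
rewrite [leLHS](_ : _ = (64 * (x + 1) * x) * y ^+ 2); last by ring.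
rewrite [leRHS](_ : _ = (16 * (2 * x + 1) ^+ 2) * y ^+ 2); last by ring.
by rewrite ler_wpM2r //; nra.
Qed.
End CentralBinomials.

(** * Tilted beta weights and their central moments *)

Section Moments.
Variable R : archiRealFieldType.
Implicit Types (a b c : R) (n i l m : nat) (p q : {poly R}).

(** The value of [Lam a b] at t^l (2 - t)^i, hence the factor by which multiplication with this
    polynomial renormalises the functional in [Lam_tilt]. *)
Definition beta_weight a b l i : R :=
  2 ^+ (l + i) * poch (b + 1) l * poch (a + 1) i / poch (a + b + 2) (l + i).

Lemma Lam_tilt a b l i p : nonpole (a + b + 2) ->
  Lam a b ('X^l * (2%:P - 'X) ^+ i * p)
    = beta_weight a b l i * Lam (a + i%:R) (b + l%:R) p.
Proof.
elim: l b => [|l IH] b h.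
  elim: i a h => [|i IH] a h.
    by rewrite /beta_weight !addr0 !poch0 expr0 mul1r !expr0 !mulr1 divr1 !mul1r.
  have h' : nonpole (a + 1 + b + 2).
    have -> : a + 1 + b + 2 = a + b + 2 + 1 by ring.
    exact: nonpoleS.
  have := IH (a + 1) h'; rewrite !expr0 !mul1r => {}IH.
  rewrite exprS -mulrA Lam_mul2X // IH [LHS]mulrA.
  have -> : a + 1 + i%:R = a + i.+1%:R by rewrite -natr1; ring.
  congr (_ * _); rewrite /beta_weight !add0n !poch0 !pochSl exprS.
  have -> : a + 1 + b + 2 = a + b + 2 + 1 by ring.
  have h0 := h 0%N; rewrite addr0 in h0.
  have h1 := poch_neq0 i (nonpoleS h).
  by field; rewrite h0 h1.
have h' : nonpole (a + (b + 1) + 2).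
  have -> : a + (b + 1) + 2 = a + b + 2 + 1 by ring.
  exact: nonpoleS.
rewrite exprS -[X in Lam _ _ X]mulrA -[X in Lam _ _ X]mulrA Lam_mulX // [X in Lam _ _ X]mulrA IH // [LHS]mulrA.
have -> : b + 1 + l%:R = b + l.+1%:R by rewrite -natr1; ring.
congr (_ * _); rewrite /beta_weight !addSn !pochSl exprS.
have -> : a + (b + 1) + 2 = a + b + 2 + 1 by ring.
have h0 := h 0%N; rewrite addr0 in h0.
have h1 := poch_neq0 (l + i) (nonpoleS h).
by field; rewrite h0 h1.
Qed.

Lemma beta_weight_gt0 a b l i : 0 <= a -> 0 <= b -> 0 < beta_weight a b l i.
Proof.
move=> a0 b0; rewrite /beta_weight divr_gt0 ?mulr_gt0 ?exprn_gt0 ?poch_gt0 //.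
- by rewrite ltr_wpDl.
- by rewrite ltr_wpDl.
- by rewrite ltr_wpDl ?addr_ge0.
Qed.

Definition cmoment a b (t0 : R) r := Lam a b (('X - t0%:P) ^+ r.*2).

Lemma cmoment0 a b t0 : cmoment a b t0 0 = 1.
Proof. by rewrite /cmoment expr0 Lam1. Qed.

(** The second moment about t0 is the variance of the beta weight, here on the left, plus the
    squared distance of the mean from t0. *)
Lemma cmoment1_ge a b t0 : 0 <= a -> 0 <= b ->
  4 * (a + 1) * (b + 1) / ((a + b + 2) ^+ 2 * (a + b + 3)) <= cmoment a b t0 1.
Proof.
move=> a0 b0; have h : nonpole (a + b + 2) by apply: gt0_nonpole; lra.
have f2 : a + b + 2 != 0 by rewrite gt_eqF //; lra.
have f3 : a + b + 3 != 0 by rewrite gt_eqF //; lra.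
have -> : cmoment a b t0 1 = 4 * (a + 1) * (b + 1) / ((a + b + 2) ^+ 2 * (a + b + 3))
    + (2 * (b + 1) / (a + b + 2) - t0) ^+ 2.
  have -> : cmoment a b t0 1 =
      beta_moment a b 2 - (2 * t0) * beta_moment a b 1 + t0 ^+ 2 * beta_moment a b 0.
    rewrite -!Lam_Xn -!linearZ /= -linearB -linearD /=; congr Lam.
    rewrite expr0 expr1 -!mul_polyC !rmorphM /= /cmoment /= ; ring.
  rewrite /beta_moment !pochS !poch0.
  have -> : a + b + 2 + 1%:R = a + b + 3 by ring.
  by rewrite addr0; field; rewrite f2 f3.
by rewrite lerDl sqr_ge0.
Qed.

(** The Pearson identity for (t - t0)^(2r+1), where t (2 - t) = 1 - (t - 1)^2 bounds the derivative
    term. The odd moment it leaves is removed by positivity of the square of (t - t0)^r (t - t0 -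
    d), with d the distance from t0 to the mean. *)
Lemma cmoment_upper a b t0 r : 0 <= a -> 0 <= b ->
  cmoment a b t0 r.+1 <=
    ((2 * (b + 1) / (a + b + 2) - t0) ^+ 2 + 2 * (2 * r%:R + 1) / (a + b + 2)) * cmoment a b t0 r.
Proof.
move=> a0 b0; have s0 : 0 < a + b + 2 by lra.
set d := 2 * (b + 1) / (a + b + 2) - t0; set s := a + b + 2 in s0 d *.
set v : {poly R} := 'X - t0%:P.
have dE : 2 * (b + 1) = s * (d + t0) by rewrite /d subrK [RHS]mulrC divfK ?gt_eqF.
pose N := Lam a b (v ^+ r.*2.+1).
have e1 : s * (cmoment a b t0 r.+1 - d * N)
    = (2 * r%:R + 1) * (cmoment a b t0 r - Lam a b (('X - 1) ^+ 2 * v ^+ r.*2)).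
  have hP := Lam_pearson (gt0_nonpole s0) (v ^+ r.*2.+1).
  have hE : (2%:P - 'X) * ('X * (v ^+ r.*2.+1)^`())
      + ((2 * (b + 1))%:P - (a + b + 2) *: 'X) * v ^+ r.*2.+1
    = (2 * r%:R + 1) *: (v ^+ r.*2 - ('X - 1) ^+ 2 * v ^+ r.*2)
      - s *: (v ^+ r.+1.*2 - d *: v ^+ r.*2.+1).
    rewrite -/s dE deriv_exp /= /v derivB derivX derivC subr0 mul1r -[_ *+ r.*2.+1]mulr_natr.
    have -> : (r.*2.+1)%:R = (2 * r%:R + 1)%:P :> {poly R}.
      by rewrite -mul2n -natr1 natrM !(polyCD, polyCM, polyC_natr, polyC1).
    rewrite doubleS !exprS; set w := _ ^+ r.*2.
    by rewrite -!mul_polyC !(polyCD, polyCM, polyC1, polyCN); ring.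
  rewrite hE LamB !LamZ !LamB LamZ in hP.
  by apply/esym/eqP; rewrite -subr_eq0 hP.
have h1 : 0 <= Lam a b (('X - 1) ^+ 2 * v ^+ r.*2).
  by rewrite -muln2 exprM -exprMn Lam_sqr_ge0.
have h2 : 0 <= cmoment a b t0 r.+1 - 2 * d * N + d ^+ 2 * cmoment a b t0 r.
  have := Lam_sqr_ge0 (v ^+ r * (v - d%:P)) a0 b0; congr (_ <= _).
  rewrite /N /cmoment -!LamZ -LamB -LamD -/v; congr Lam.
  rewrite doubleS !exprS -muln2 exprM -!mul_polyC !rmorphM /=; set w := v ^+ r.
  by ring.
move: e1 h1 h2; rewrite -/v; set X := cmoment a b t0 r.+1; set Y := cmoment a b t0 r.
set Z := Lam a b _ => e1 h1 h2.
have e2 : X - d * N = (2 * r%:R + 1) * (Y - Z) / s.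
  by rewrite -e1 mulrAC divff ?mul1r ?gt_eqF.
have r0 : 0 <= (2 * r%:R + 1) * Z / s :> R.
  by rewrite divr_ge0 ?mulr_ge0 ?addr_ge0 ?mulr_ge0 // ltW.
have -> : (d ^+ 2 + 2 * (2 * r%:R + 1) / s) * Y = d ^+ 2 * Y + 2 * ((2 * r%:R + 1) * (Y - Z) / s)
    + 2 * ((2 * r%:R + 1) * Z / s) by ring.
rewrite -e2; lra.
Qed.

Lemma cmoment_ge0 a b t0 r : 0 <= a -> 0 <= b -> 0 <= cmoment a b t0 r.
Proof. by move=> a0 b0; rewrite /cmoment -muln2 exprM Lam_sqr_ge0. Qed.

(** By Cauchy-Schwarz the even moments are log-convex, so the ratio of consecutive ones is at least
    the first ratio, [cmoment a b t0 1]. *)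
Lemma cmoment_lower a b t0 r : 0 <= a -> 0 <= b ->
  cmoment a b t0 1 ^+ r <= cmoment a b t0 r.
Proof.
move=> a0 b0; have m1 : 0 < cmoment a b t0 1.
  apply: lt_le_trans (cmoment1_ge t0 a0 b0).
  by rewrite divr_gt0 ?mulr_gt0 ?exprn_gt0 //; lra.
have cs k : cmoment a b t0 k.+1 ^+ 2 <= cmoment a b t0 k * cmoment a b t0 k.+2.
  have := Lam_cauchy (('X - t0%:P) ^+ k) (('X - t0%:P) ^+ k.+2) a0 b0.
  rewrite /cmoment -exprD -!exprM !muln2; congr (Lam _ _ (_ ^+ _) ^+ _ <= _).
  by rewrite doubleS -addnn !addnS.
have [] : cmoment a b t0 1 * cmoment a b t0 r <= cmoment a b t0 r.+1
    /\ cmoment a b t0 1 ^+ r <= cmoment a b t0 r; last by [].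
elim: r => [|r [IH1 IH2]]; first by rewrite !cmoment0 mulr1 expr0 !lexx.
have p0 : 0 < cmoment a b t0 r by apply: lt_le_trans IH2; rewrite exprn_gt0.
split; last by rewrite exprS; apply: le_trans IH1; rewrite ler_pM2l.
have p1 : 0 < cmoment a b t0 r.+1 by apply: lt_le_trans IH1; rewrite mulr_gt0.
rewrite -(ler_pM2l p0); apply: le_trans (cs r).
by rewrite mulrA expr2 ler_pM2r // mulrC.
Qed.
End Moments.

(** * Doubling the exponents of a beta weight *)

Section Doubling.
Variable R : archiRealFieldType.
Implicit Types (a b c : R) (n i l m : nat) (p q : {poly R}).

Lemma nat_above (x : R) : exists n : nat, (0 < n)%N /\ x < n%:R.
Proof.
exists (Num.bound `|x|).+1; split=> //.
rewrite (le_lt_trans (ler_norm x)) // (lt_trans (archi_boundP (normr_ge0 x))) //.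
by rewrite ltr_nat.
Qed.

Lemma poch_gpoch c n : poch c n = gpoch c n * n`!%:R.
Proof. by rewrite /gpoch divfK // fact_neq0. Qed.

Lemma cbin_double n : n.*2`!%:R = cbin R n * n`!%:R ^+ 2.
Proof. by rewrite /cbin divfK // expf_neq0 // fact_neq0. Qed.

Opaque cbin gpoch.

(** A weight is 2^n l! i! / n!, with n = l + i, times a quotient of [gpoch] values. Doubling the
    exponents squares the first part up to central binomials; the second changes by bounded factors,
    as A bounds the parameters and K the ratios of n + 1 to l + 1 and i + 1. The factor n + 1 is
    that of [gpoch_prod]. *)
Lemma beta_weight_quotient a b l i (A : nat) (K : R) :
  0 <= a -> 0 <= b -> a <= A%:R -> b <= A%:R ->
  (l + i).+1%:R <= K * l.+1%:R -> (l + i).+1%:R <= K * i.+1%:R ->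
  beta_weight a b l.*2 i.*2 * cbin R (l + i) <=
  2 ^+ (A + A) * K ^+ (A + A) * (l + i).+1%:R * cbin R l * cbin R i * beta_weight a b l i ^+ 2.
Proof.
move=> a0 b0 aA bA Kl Ki; set n := (l + i)%N in Kl Ki *.
have l1 : 0 < l.+1%:R :> R by rewrite ltr0n.
have i1 : 0 < i.+1%:R :> R by rewrite ltr0n.
have n1 : 0 < n.+1%:R :> R by rewrite ltr0n.
have K0 : 0 < K by rewrite -(pmulr_lgt0 K l1) (lt_le_trans n1).
have grow c m : 1 <= c -> c <= A.+1%:R -> n.+1%:R <= K * m.+1%:R -> (m <= n)%N ->
    gpoch c m.*2 <= 2 ^+ A * gpoch c m /\ gpoch c n <= K ^+ A * gpoch c m.
  move=> c1 cA Km mn; have m1 : 0 < m.+1%:R :> R by rewrite ltr0n.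
  have g0 : 0 < gpoch c m by rewrite gpoch_gt0 // (lt_le_trans ltr01).
  split; rewrite -(ler_pM2r (exprn_gt0 A m1)).
    apply: le_trans (gpoch_growth c1 cA (_ : m <= m.*2)%N) _.
      by rewrite -addnn leq_addr.
    rewrite -[leRHS]mulrA [2 ^+ A * _]mulrCA -exprMn ler_pM2l // lerXn2r ?nnegrE ?mulr_ge0 //.
    by rewrite -natrM ler_nat mul2n doubleS ltnS leqnSn.
  apply: le_trans (gpoch_growth c1 cA mn) _.
  rewrite -[leRHS]mulrA [K ^+ A * _]mulrCA -exprMn ler_pM2l // lerXn2r ?nnegrE //.
  by rewrite mulr_ge0 // ltW.
have cA x : x <= A%:R -> x + 1 <= A.+1%:R :> R by rewrite -natr1 lerD2r.
have c1 x : 0 <= x -> 1 <= x + 1 :> R by rewrite lerDr.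
have [gl2 gln] := grow _ l (c1 b b0) (cA b bA) Kl (leq_addr i l).
have [gi2 gin] := grow _ i (c1 a a0) (cA a aA) Ki (leq_addl l i).
have gprod := gpoch_prod n (c1 b b0) (c1 a a0).
have e2 : b + 1 + (a + 1) = a + b + 2 by ring.
rewrite e2 in gprod.
have s1 : 1 <= a + b + 2 by lra.
have gmono : gpoch (a + b + 2) n <= gpoch (a + b + 2) n.*2.
  by rewrite gpoch_le // -addnn leq_addr.
have bw0 : beta_weight a b l i = 2 ^+ n * (gpoch (b + 1) l * l`!%:R) * (gpoch (a + 1) i * i`!%:R)
   / (gpoch (a + b + 2) n * n`!%:R) by rewrite /beta_weight !poch_gpoch.
have bw2 : beta_weight a b l.*2 i.*2 = 2 ^+ n ^+ 2 * (gpoch (b + 1) l.*2 * (cbin R l * l`!%:R ^+ 2))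
    * (gpoch (a + 1) i.*2 * (cbin R i * i`!%:R ^+ 2))
   / (gpoch (a + b + 2) n.*2 * (cbin R n * n`!%:R ^+ 2)).
  by rewrite /beta_weight !poch_gpoch -doubleD !cbin_double -exprM muln2.
rewrite bw0 bw2.
have gp (x : R) m : 1 <= x -> 0 < gpoch x m by move=> x1; rewrite gpoch_gt0 // (lt_le_trans ltr01).
move: (gp _ l (c1 b b0)) (gp _ l.*2 (c1 b b0)) (gp _ i (c1 a a0)) (gp _ i.*2 (c1 a a0))
  (gp _ n s1) (gp _ n.*2 s1) gl2 gln gi2 gin gprod gmono
  (gp _ n (c1 b b0)) (gp _ n (c1 a a0)).
set gl := gpoch (b + 1) l; set gl' := gpoch (b + 1) l.*2.
set gi := gpoch (a + 1) i; set gi' := gpoch (a + 1) i.*2.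
set gn := gpoch (a + b + 2) n; set gn' := gpoch (a + b + 2) n.*2.
set hl := gpoch (b + 1) n; set hi := gpoch (a + 1) n.
move=> gl0 gl'0 gi0 gi'0 gn0 gn'0 gl2 gln gi2 gin gprod gmono hl0 hi0.
have p2 : 0 < 2 ^+ n :> R by rewrite exprn_gt0.
have cl := cbin_gt0 R l; have ci := cbin_gt0 R i; have cn := cbin_gt0 R n.
have fl : 0 < l`!%:R :> R by rewrite ltr0n fact_gt0.
have fi : 0 < i`!%:R :> R by rewrite ltr0n fact_gt0.
have fn : 0 < n`!%:R :> R by rewrite ltr0n fact_gt0.
rewrite [leLHS](_ : _ = (2 ^+ n * l`!%:R * i`!%:R / n`!%:R) ^+ 2 * cbin R l * cbin R i * (gl' * gi' / gn')); last first.
  by field; rewrite !gt_eqF.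
rewrite [leRHS](_ : _ = (2 ^+ n * l`!%:R * i`!%:R / n`!%:R) ^+ 2 * cbin R l * cbin R i
   * ((2 ^+ A * gl) * (2 ^+ A * gi) * (n.+1%:R * ((K ^+ A * gl) * (K ^+ A * gi))) / gn ^+ 2)); last first.
  by rewrite !exprD; field; rewrite !gt_eqF.
rewrite ler_pM2l; last first.
  by repeat first [done | apply: mulr_gt0 | apply: exprn_gt0 | rewrite invr_gt0].
rewrite ler_pdivrMr // [leRHS]mulrAC ler_pdivlMr ?exprn_gt0 //.
rewrite [leRHS](_ : _ = ((2 ^+ A * gl) * (2 ^+ A * gi)) * ((n.+1%:R * ((K ^+ A * gl) * (K ^+ A * gi))) * gn')); last by ring.
have h1 : gn <= n.+1%:R * ((K ^+ A * gl) * (K ^+ A * gi)).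
  apply: le_trans gprod _; rewrite ler_pM2l //; apply: ler_pM => //; exact: ltW.
rewrite expr2; apply: ler_pM; try exact/ltW/mulr_gt0.
  by apply: ler_pM => //; exact: ltW.
by apply: ler_pM => //; exact: ltW.
Qed.

(** The central binomials contribute (n / (l i))^(1/2), of order n^(-1/2) for l and i proportional
    to n; against the factor n + 1 this leaves n^(1/2), stated here in squared form. *)
Lemma beta_weight_doubling a b l i (A : nat) (K : R) :
  0 <= a -> 0 <= b -> a <= A%:R -> b <= A%:R -> (0 < l + i)%N ->
  (l + i).+1%:R <= K * l.+1%:R -> (l + i).+1%:R <= K * i.+1%:R ->
  beta_weight a b l.*2 i.*2 ^+ 2 <=
  4 * (2 ^+ (A + A) * K ^+ (A + A)) ^+ 2 * K ^+ 2 * (l + i)%:R * beta_weight a b l i ^+ 4.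
Proof.
move=> a0 b0 aA bA n_gt0 Kl Ki.
have := beta_weight_quotient a0 b0 aA bA Kl Ki.
set n := (l + i)%N in n_gt0 Kl Ki *.
set B2 := beta_weight a b l.*2 i.*2; set B := beta_weight a b l i.
set K1 := 2 ^+ _ * _ => h.
have B20 : 0 < B2 by apply: beta_weight_gt0.
have B0 : 0 < B by apply: beta_weight_gt0.
have cl := cbin_gt0 R l; have ci := cbin_gt0 R i; have cn := cbin_gt0 R n.
have l1 : 0 < l.+1%:R :> R by rewrite ltr0n.
have i1 : 0 < i.+1%:R :> R by rewrite ltr0n.
have n1 : 0 < n.+1%:R :> R by rewrite ltr0n.
have K0 : 0 < K by rewrite -(pmulr_lgt0 K l1) (lt_le_trans n1).
have h2 : (B2 * cbin R n) ^+ 2 <= (K1 * n.+1%:R * cbin R l * cbin R i * B ^+ 2) ^+ 2.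
  have z0 := ltW (mulr_gt0 B20 cn).
  by rewrite lerXn2r ?nnegrE //; apply: le_trans h.
have u0 : 0 < (2 * l%:R + 1) * (2 * i%:R + 1) :> R.
  by rewrite mulr_gt0 // ltr_wpDl // mulr_ge0.
have hc : cbin R l ^+ 2 * cbin R i ^+ 2 * ((2 * l%:R + 1) * (2 * i%:R + 1)) <= 4 * n%:R * cbin R n ^+ 2.
  apply: le_trans (cbin_lower R n_gt0); rewrite exprD mulrACA.
  by apply: ler_pM; rewrite ?cbin_upper // mulr_ge0 ?sqr_ge0 // addr_ge0 ?mulr_ge0.
have hn : n.+1%:R ^+ 2 <= K ^+ 2 * ((2 * l%:R + 1) * (2 * i%:R + 1)).
  have hm m : n.+1%:R <= K * m.+1%:R -> n.+1%:R <= K * (2 * m%:R + 1) :> R.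
    move=> hm; apply: le_trans hm _; rewrite ler_pM2l // -natr1.
    by have := ler0n R m; lra.
  rewrite [leRHS](_ : _ = (K * (2 * l%:R + 1)) * (K * (2 * i%:R + 1))); last by ring.
  by rewrite expr2; apply: ler_pM; rewrite ?(ltW n1) ?hm.
have cc0 : 0 < cbin R l ^+ 2 * cbin R i ^+ 2 by rewrite mulr_gt0 ?exprn_gt0.
rewrite -(ler_pM2l (mulr_gt0 cc0 u0)).
apply: le_trans (_ : 4 * n%:R * cbin R n ^+ 2 * B2 ^+ 2 <= _).
  by rewrite ler_pM2r ?exprn_gt0.
apply: le_trans (_ : 4 * n%:R * (K1 * n.+1%:R * cbin R l * cbin R i * B ^+ 2) ^+ 2 <= _).
  rewrite -mulrA -exprMn [cbin R n * _]mulrC ler_wpM2l //.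
  by rewrite mulr_ge0.
set U := (2 * l%:R + 1) * (2 * i%:R + 1) in u0 hn *.
have w0 : 0 <= 4 * n%:R * K1 ^+ 2 * (cbin R l ^+ 2 * cbin R i ^+ 2) * B ^+ 4.
  have B4 : 0 <= B ^+ 4 by rewrite exprn_ge0 // ltW.
  by repeat first [done | exact: sqr_ge0 | exact: ltW cc0 | apply: mulr_ge0].
rewrite [leLHS](_ : _ = (4 * n%:R * K1 ^+ 2 * (cbin R l ^+ 2 * cbin R i ^+ 2) * B ^+ 4) * n.+1%:R ^+ 2); last by ring.
rewrite [leRHS](_ : _ = (4 * n%:R * K1 ^+ 2 * (cbin R l ^+ 2 * cbin R i ^+ 2) * B ^+ 4) * (K ^+ 2 * U)); last by ring.
exact: ler_wpM2l.
Qed.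
End Doubling.

(** * Failure of coercivity at an interior point *)

Section NotCoercive.
Variable R : archiRealFieldType.
Implicit Types (a b c : R) (n i l m : nat) (p q : {poly R}).

(** The variance is at least of order 1 / n: its numerator is about tau (1 - tau) n^2, and each of
    the three linear factors of its denominator is at most (a + b + 4) n, as n >= 1. *)
Lemma cmoment_concentrated_ge a b tau t0 l i : 0 <= a -> 0 <= b ->
  0 <= tau <= 1 -> (0 < l + i)%N ->
  tau * (l + i)%:R <= l.+1%:R -> (1 - tau) * (l + i)%:R <= i.+1%:R ->
  4 * (1 - tau) * tau / (a + b + 4) ^+ 3 / (l + i)%:R
    <= cmoment (a + i%:R) (b + l%:R) t0 1.
Proof.
move=> a0 b0 /andP[tau0 tau1] n0 hl hi; set n := (l + i)%N in n0 hl hi *.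
have n0' : 1 <= n%:R :> R by rewrite ler1n.
have np : 0 < n%:R :> R by rewrite ltr0n.
have ai : 0 <= a + i%:R by rewrite addr_ge0.
have bl : 0 <= b + l%:R by rewrite addr_ge0.
apply: le_trans (cmoment1_ge t0 ai bl).
have -> : a + i%:R + (b + l%:R) + 2 = a + b + n%:R + 2 by rewrite /n natrD; ring.
have -> : a + i%:R + (b + l%:R) + 3 = a + b + n%:R + 3 by rewrite /n natrD; ring.
set s := a + b; have s0 : 0 <= s by rewrite addr_ge0.
have e2 : s + n%:R + 2 <= (s + 4) * n%:R.
  have -> : (s + 4) * n%:R = s + n%:R + 2 + ((s + 2) * (n%:R - 1) + n%:R) by ring.
  by rewrite lerDl addr_ge0 // mulr_ge0 ?subr_ge0 ?addr_ge0.
have e3 : s + n%:R + 3 <= (s + 4) * n%:R.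
  have -> : (s + 4) * n%:R = s + n%:R + 3 + (s + 3) * (n%:R - 1) by ring.
  by rewrite lerDl mulr_ge0 ?subr_ge0 ?addr_ge0.
have p2 : 0 < s + n%:R + 2 by rewrite ltr_wpDl ?addr_ge0.
have p3 : 0 < s + n%:R + 3 by rewrite ltr_wpDl ?addr_ge0.
have p4 : 0 < s + 4 by rewrite ltr_wpDl.
rewrite -mulrA -invfM ler_pdivrMr; last by rewrite mulr_gt0 ?exprn_gt0.
rewrite [leRHS]mulrAC ler_pdivlMr; last by rewrite mulr_gt0 ?exprn_gt0.
have f1 : (1 - tau) * n%:R <= a + i%:R + 1.
  by apply: le_trans hi _; rewrite -natr1 lerD2r lerDr.
have f2 : tau * n%:R <= b + l%:R + 1.
  by apply: le_trans hl _; rewrite -natr1 lerD2r lerDr.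
have g1 : 0 <= (1 - tau) * n%:R by rewrite mulr_ge0 ?subr_ge0.
have g2 : 0 <= tau * n%:R by rewrite mulr_ge0.
have h1 : (s + n%:R + 2) ^+ 2 * (s + n%:R + 3) <= ((s + 4) * n%:R) ^+ 3.
  rewrite [leRHS]exprSr; apply: ler_pM => //; [exact/exprn_ge0/ltW|exact: ltW|].
  rewrite lerXn2r ?nnegrE ?(ltW p2) //; exact/ltW/mulr_gt0.
have h2 : (1 - tau) * n%:R * (tau * n%:R) <= (a + i%:R + 1) * (b + l%:R + 1).
  exact: ler_pM.
have h3 : 0 <= 4 * (1 - tau) * tau by rewrite !mulr_ge0 ?subr_ge0.
apply: le_trans (ler_wpM2l h3 h1) _.
rewrite [leLHS](_ : _ = (4 * ((s + 4) ^+ 3 * n%:R)) * ((1 - tau) * n%:R * (tau * n%:R))); last by ring.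
rewrite [leRHS](_ : _ = (4 * ((s + 4) ^+ 3 * n%:R)) * ((a + i%:R + 1) * (b + l%:R + 1))); last by ring.
by apply: ler_wpM2l h2; rewrite !mulr_ge0 ?exprn_ge0 ?(ltW p4).
Qed.

(** The condition on l puts the mean within O(1/n) of t0, so every step of [cmoment_upper] gains 1 /
    n. The exponents are doubled because the bound is meant for the square of the test function. *)
Lemma cmoment_concentrated_le a b t0 l i r : 0 <= a -> 0 <= b -> 0 <= t0 <= 2 ->
  (0 < l + i)%N -> `|4 * l%:R - 2 * t0 * (l + i)%:R| <= 4 ->
  cmoment (a + i.*2%:R) (b + l.*2%:R) t0 r <=
  (((2 * b + 6 + 2 * (a + b + 2)) ^+ 2 + (2 * r%:R + 1)) / (l + i)%:R) ^+ r.
Proof.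
move=> a0 b0 /andP[t00 t02] n0 hl; set n := (l + i)%N in n0 hl *.
have n0' : 1 <= n%:R :> R by rewrite ler1n.
have np : 0 < n%:R :> R by rewrite ltr0n.
set D := 2 * b + 6 + 2 * (a + b + 2).
have ai : 0 <= a + i.*2%:R by rewrite addr_ge0.
have bl : 0 <= b + l.*2%:R by rewrite addr_ge0.
have hd m : m.*2%:R = 2 * m%:R :> R by rewrite -mul2n natrM.
have step k : (k <= r)%N -> cmoment (a + i.*2%:R) (b + l.*2%:R) t0 k.+1 <=
    (D ^+ 2 + (2 * r%:R + 1)) / n%:R * cmoment (a + i.*2%:R) (b + l.*2%:R) t0 k.
  move=> kr; apply: le_trans (cmoment_upper t0 k ai bl) _.
  apply: ler_wpM2r; first exact: cmoment_ge0.
  have -> : a + i.*2%:R + (b + l.*2%:R) + 2 = a + b + 2 + 2 * n%:R.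
    by rewrite !hd /n natrD; ring.
  set S := a + b + 2 + 2 * n%:R.
  have Sn : 2 * n%:R <= S by rewrite lerDr !addr_ge0.
  have S0 : 0 < S by apply: lt_le_trans Sn; rewrite mulr_gt0.
  set d := _ - t0.
  have dE : d = (2 * b + 2 - t0 * (a + b + 2) + (4 * l%:R - 2 * t0 * n%:R)) / S.
    by rewrite /d /S hd; field; rewrite gt_eqF.
  have Dd : `|d| <= D / S.
    rewrite dE normrM (ger0_norm (_ : 0 <= S^-1)) ?invr_ge0 ?(ltW S0) //.
    rewrite ler_pM2r ?invr_gt0 //.
    have ab2 : 0 <= a + b + 2 by rewrite !addr_ge0.
    have tab : t0 * (a + b + 2) <= 2 * (a + b + 2) by rewrite ler_wpM2r.
    have tab0 : 0 <= t0 * (a + b + 2) by rewrite mulr_ge0.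
    by move: hl; rewrite /D !ler_norml => /andP[h1 h2]; apply/andP; split; lra.
  have D0 : 0 <= D by rewrite /D; lra.
  have d2 : d ^+ 2 <= D ^+ 2 / n%:R.
    rewrite -real_normK ?num_real //.
    apply: le_trans (_ : (D / S) ^+ 2 <= _).
      by rewrite lerXn2r ?nnegrE ?divr_ge0 ?(ltW S0).
    rewrite expr_div_n; apply: ler_wpM2l; first exact: sqr_ge0.
    rewrite lef_pV2 ?posrE ?exprn_gt0 //.
    apply: le_trans (_ : (2 * n%:R) ^+ 2 <= _); first by nra.
    by rewrite lerXn2r ?nnegrE ?mulr_ge0 ?(ltW S0).
  rewrite [leRHS]mulrDl; apply: lerD => //.
  apply: le_trans (_ : 2 * (2 * k%:R + 1) / (2 * n%:R) <= _).
    apply: ler_wpM2l; first by rewrite mulr_ge0 ?addr_ge0 ?mulr_ge0.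
    by rewrite lef_pV2 ?posrE ?mulr_gt0.
  rewrite invfM mulrACA divff ?mul1r ?pnatr_eq0 //.
  by rewrite ler_pM2r ?invr_gt0 // lerD2r ler_pM2l // ler_nat.
have Q0 : 0 <= (D ^+ 2 + (2 * r%:R + 1)) / n%:R.
  by rewrite divr_ge0 // addr_ge0 ?sqr_ge0 // addr_ge0 // mulr_ge0.
suff H k : (k <= r)%N -> cmoment (a + i.*2%:R) (b + l.*2%:R) t0 k <=
    ((D ^+ 2 + (2 * r%:R + 1)) / n%:R) ^+ k by apply: H.
elim: k => [|k IH] kr.
  by rewrite cmoment0 expr0.
rewrite exprS; apply: le_trans (step k (ltnW kr)) _.
by apply: ler_wpM2l => //; apply: IH; apply: ltnW.
Qed.

(** Tested on q = (t - t0)^j t^l (2 - t)^i with l / n near t0 / 2, so that the peak sits at t0. The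
    left side is at least of order B^2 n^(-2j), the right side at most B2 n^(-2j-1), and
    [beta_weight_doubling] compares B2 with B^2. *)
Lemma Lam_not_coercive a b t0 j (C : R) : 0 <= a -> 0 <= b -> 0 < t0 < 2 ->
  ~ (forall q, Lam a b (('X - t0%:P) ^+ j * q) ^+ 2
       <= C * Lam a b (('X - t0%:P) ^+ j.+1.*2 * q ^+ 2)).
Proof.
move=> a0 b0 /andP[t00 t02] H.
pose tau := t0 / 2; pose C0 := `|C|.
have tau0 : 0 < tau by rewrite divr_gt0.
have tau1 : 0 < 1 - tau by rewrite subr_gt0 ltr_pdivrMr // mul1r.
have [A [_ hA]] := nat_above (a + b).
have aA : a <= A%:R by apply: ltW; apply: le_lt_trans hA; rewrite lerDl.
have bA : b <= A%:R by apply: ltW; apply: le_lt_trans hA; rewrite lerDr.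
(* With l about tau n and i about (1 - tau) n, this bounds both ratios; each 2 comes from n + 1 <= 2
   n. *)
pose K := 2 / tau + 2 / (1 - tau).
pose ka := 4 * (1 - tau) * tau / (a + b + 4) ^+ 3.
have p4 : 0 < a + b + 4 by rewrite ltr_wpDl ?addr_ge0.
have ka0 : 0 < ka by apply: divr_gt0; [apply: mulr_gt0 => //; apply: mulr_gt0|apply: exprn_gt0].
pose K' := (2 * b + 6 + 2 * (a + b + 2)) ^+ 2 + (2 * (j.*2.+1)%:R + 1).
have K'0 : 0 < K' by rewrite /K' ltr_wpDl ?sqr_ge0 // ltr_wpDl // mulr_ge0.
pose L := 4 * (2 ^+ (A + A) * K ^+ (A + A)) ^+ 2 * K ^+ 2.
pose C1 := C0 * K' ^+ j.*2.+1 / ka ^+ j.*2.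
(* The chain of estimates ends with n <= C1^2 L, which this choice refutes. *)
have [n [n0 hn]] := nat_above (C1 ^+ 2 * L).
have np : 0 < n%:R :> R by rewrite ltr0n.
pose l := Num.truncn (tau * n%:R).
have /truncn_itv/andP[l1 l2] : 0 <= tau * n%:R by rewrite mulr_ge0 ?ltW.
have ln : (l <= n)%N.
  rewrite -(ler_nat R); apply: le_trans l1 _; rewrite -[leRHS]mul1r ler_pM2r //.
  by rewrite -subr_ge0 ltW.
pose i := (n - l)%N; have li : (l + i = n)%N by rewrite subnKC.
have iE : i%:R = n%:R - l%:R :> R by rewrite -natrB.
have hl : tau * (l + i)%:R <= l.+1%:R by rewrite li ltW.
have hi : (1 - tau) * (l + i)%:R <= i.+1%:R.
  by rewrite li -natr1 iE mulrBl mul1r; move: l1; rewrite -/l; lra.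
have h4 : `|4 * l%:R - 2 * t0 * (l + i)%:R| <= 4.
  rewrite li; have -> : 2 * t0 = 4 * tau by rewrite /tau; field.
  by move: l1 l2; rewrite -/l -natr1 ler_norml => l1 l2; apply/andP; split; lra.
have li0 : (0 < l + i)%N by rewrite li.
have n1 : n.+1%:R <= 2 * n%:R :> R by rewrite -natrM ler_nat mul2n -addnn -addn1 leq_add2l.
have Kl : (l + i).+1%:R <= K * l.+1%:R.
  rewrite li; apply: le_trans n1 _; rewrite -li.
  apply: le_trans (_ : 2 / tau * l.+1%:R <= _).
    by rewrite -mulrA ler_pM2l // mulrC ler_pdivlMr // mulrC.
  by rewrite ler_pM2r ?ltr0n // lerDl divr_ge0 ?(ltW tau1).
have Ki : (l + i).+1%:R <= K * i.+1%:R.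
  rewrite li; apply: le_trans n1 _; rewrite -li.
  apply: le_trans (_ : 2 / (1 - tau) * i.+1%:R <= _).
    by rewrite -mulrA ler_pM2l // mulrC ler_pdivlMr // mulrC.
  by rewrite ler_pM2r ?ltr0n // lerDr divr_ge0 ?(ltW tau0).
have tau01 : 0 <= tau <= 1 by rewrite (ltW tau0) -subr_ge0 (ltW tau1).
have t02' : 0 <= t0 <= 2 by rewrite !ltW.
have low := cmoment_concentrated_ge t0 a0 b0 tau01 li0 hl hi.
have upp := cmoment_concentrated_le j.*2.+1 a0 b0 t02' li0 h4.
have dbl := beta_weight_doubling a0 b0 aA bA li0 Kl Ki.
rewrite -/ka -/K' -/L li in low upp dbl.
have hB : nonpole (a + b + 2) by apply: gt0_nonpole; rewrite ltr_wpDl ?addr_ge0.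
pose q := ('X - t0%:P) ^+ j * ('X^l * (2%:P - 'X) ^+ i).
have := H q.
have -> : ('X - t0%:P) ^+ j * q = 'X^l * (2%:P - 'X) ^+ i * ('X - t0%:P) ^+ j.*2.
  by rewrite /q -addnn exprD; ring.
have -> : ('X - t0%:P) ^+ j.+1.*2 * q ^+ 2
   = 'X^(l.*2) * (2%:P - 'X) ^+ i.*2 * ('X - t0%:P) ^+ j.*2.+1.*2.
  rewrite /q -!muln2 !exprM; set v := _ - t0%:P.
  by rewrite [v ^+ (j * 2).+1]exprS [v ^+ j.+1]exprS exprM; ring.
rewrite !Lam_tilt // -/(cmoment _ _ t0 j) -/(cmoment _ _ t0 j.*2.+1).
have B0 := beta_weight_gt0 l i a0 b0; have B20 := beta_weight_gt0 l.*2 i.*2 a0 b0.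
move: dbl B0 B20; set B := beta_weight a b l i; set B2 := beta_weight _ _ _ _ => dbl B0 B20.
have ai : 0 <= a + i%:R by rewrite addr_ge0.
have bl : 0 <= b + l%:R by rewrite addr_ge0.
have kan : 0 <= ka / n%:R by rewrite divr_ge0 // ltW.
have low' : (ka / n%:R) ^+ j <= cmoment (a + i%:R) (b + l%:R) t0 j.
  apply: le_trans (cmoment_lower t0 j ai bl).
  by rewrite lerXn2r ?nnegrE // (le_trans kan).
move=> key; have {}key : B ^+ 2 * (ka / n%:R) ^+ j.*2 <= C0 * (B2 * (K' / n%:R) ^+ j.*2.+1).
  apply: le_trans (_ : (B * cmoment (a + i%:R) (b + l%:R) t0 j) ^+ 2 <= _).
    rewrite [leRHS]exprMn -muln2 exprM ler_pM2l ?exprn_gt0 //.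
    by rewrite lerXn2r ?nnegrE ?exprn_ge0 // (le_trans _ low') ?exprn_ge0.
  apply: le_trans key _.
  have M0 : 0 <= B2 * cmoment (a + i.*2%:R) (b + l.*2%:R) t0 j.*2.+1.
    by rewrite mulr_ge0 ?(ltW B20) // cmoment_ge0 ?addr_ge0.
  apply: le_trans (ler_wpM2r M0 (ler_norm C)) _.
  by apply: ler_wpM2l; rewrite ?normr_ge0 // ler_pM2l.
have {}key : B ^+ 2 * n%:R <= C1 * B2.
  have pp : 0 < ka ^+ j.*2 / n%:R ^+ j.*2.+1 by rewrite divr_gt0 ?exprn_gt0.
  rewrite -(ler_pM2l pp).
  rewrite [leLHS](_ : _ = B ^+ 2 * (ka / n%:R) ^+ j.*2); last first.
    have u0 : n%:R ^+ j.*2 != 0 :> R by rewrite gt_eqF ?exprn_gt0.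
    rewrite [(ka / _) ^+ _]expr_div_n [n%:R ^+ j.*2.+1]exprS; move: u0.
    by set u := n%:R ^+ j.*2; set w := ka ^+ j.*2 => u0; field; rewrite u0 gt_eqF.
  rewrite [leRHS](_ : _ = C0 * (B2 * (K' / n%:R) ^+ j.*2.+1)) //.
  have u0 : n%:R ^+ j.*2.+1 != 0 :> R by rewrite gt_eqF ?exprn_gt0.
  have w0 : ka ^+ j.*2 != 0 by rewrite gt_eqF ?exprn_gt0.
  rewrite /C1 [(K' / _) ^+ _]expr_div_n; move: u0 w0.
  set u := n%:R ^+ _; set w := ka ^+ _; set z := K' ^+ _ => u0 w0.
  by field; rewrite u0 w0.
have Bn0 : 0 <= B ^+ 2 * n%:R by rewrite mulr_ge0 ?sqr_ge0.
have C1B : 0 <= C1 * B2 by apply: le_trans key.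
have : (B ^+ 2 * n%:R) ^+ 2 <= (C1 * B2) ^+ 2 by rewrite lerXn2r ?nnegrE.
rewrite [leRHS]exprMn => key2.
have := le_trans key2 (ler_wpM2l (sqr_ge0 C1) dbl).
have B4 : 0 < B ^+ 4 * n%:R by rewrite mulr_gt0 ?exprn_gt0.
rewrite [leLHS](_ : _ = (B ^+ 4 * n%:R) * n%:R); last by ring.
rewrite [leRHS](_ : _ = (B ^+ 4 * n%:R) * (C1 ^+ 2 * L)); last by ring.
by rewrite ler_pM2l // leNgt hn.
Qed.
End NotCoercive.

(** * Euler jets and Wronskians *)

Section Jets.
Variable R : archiRealFieldType.
Implicit Types (g h lam : R) (n i j k m : nat) (p q : {poly R}).

(* [th g p] is [t^g * (t d/dt) (t^(-g) p)]: the Euler derivation acting on the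
   function [t^(-g) p] of [t = 1 + x]. *)
Definition th g p := 'X * p^`() - g *: p.
Definition jet g j p := iter j (th g) p.

Lemma thE g p : th g p = 'X * p^`() - g%:P * p.
Proof. by rewrite /th mul_polyC. Qed.

Lemma thZ g c p : th g (c *: p) = c *: th g p.
Proof. by rewrite !thE derivZ -!mul_polyC; ring. Qed.

Lemma thD g p q : th g (p + q) = th g p + th g q.
Proof. by rewrite !thE derivD; ring. Qed.

Lemma th0 g : th g 0 = 0.
Proof. by rewrite thE derivC !mulr0 subrr. Qed.

Lemma th_sum g (I : Type) (r : seq I) (P : pred I) (F : I -> {poly R}) :
  th g (\sum_(i <- r | P i) F i) = \sum_(i <- r | P i) th g (F i).
Proof. by apply: (big_morph (th g)) => [p q|]; [exact: thD | exact: th0]. Qed.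

Lemma th_mul g h p q : th (g + h) (p * q) = th g p * q + p * th h q.
Proof. by rewrite !thE derivM polyCD; ring. Qed.

(** Raising g by m and multiplying the polynomial by t^m leaves the function t^(-g) p unchanged. *)
Lemma thX g (m : nat) p : th (g + m%:R) ('X^m * p) = 'X^m * th g p.
Proof.
rewrite [g + _]addrC th_mul; suff -> : th m%:R 'X^m = 0 :> {poly R} by rewrite mul0r add0r.
rewrite thE derivXn; case: m => [|m]; first by rewrite mulr0n mulr0 mul0r subrr.
by rewrite mulrnAr -exprS polyC_natr mulr_natl subrr.
Qed.

Lemma jetS g j p : jet g j.+1 p = th g (jet g j p).
Proof. by []. Qed.

Lemma jetD g j p q : jet g j (p + q) = jet g j p + jet g j q.
Proof. by elim: j => // j IH; rewrite !jetS IH thD. Qed.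

Lemma jetZ g j c p : jet g j (c *: p) = c *: jet g j p.
Proof. by elim: j => // j IH; rewrite !jetS IH thZ. Qed.

Lemma jet_sum g j (I : Type) (r : seq I) (P : pred I) (F : I -> {poly R}) :
  jet g j (\sum_(i <- r | P i) F i) = \sum_(i <- r | P i) jet g j (F i).
Proof.
apply: (big_morph (jet g j)) => [p q|]; first exact: jetD.
by have := jetZ g j 0 0; rewrite !scale0r.
Qed.

Variables (s b : R).

(** The Jacobi equation with s = a + b for the function t^(-g) p, multiplied by t and written in
    theta: (2 - t) theta^2 + (2b - (s + 1) t) theta + lam t. *)
Definition eigen g lam p :=
  (2%:P - 'X) * th g (th g p) + ((2 * b)%:P - (s + 1) *: 'X) * th g p + lam *: ('X * p) = 0.

(** The entries run p, q, lam p, lam q, lam^2 p, ...: since lam acts as a second-order operator,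
    they replace the successive jets, and two columns further on differ by lam only. *)
Definition yrow lam p q j : {poly R} := lam ^+ j./2 *: (if odd j then q else p).

Lemma yrowSS lam p q j : yrow lam p q j.+2 = lam%:P * yrow lam p q j.
Proof. by rewrite /yrow /= negbK exprS mul_polyC scalerA. Qed.

(* Coefficients of [theta - m] composed with [\sum_i c i theta^i]. *)
Definition op_th (m : nat) (c : nat -> {poly R}) (i : nat) : {poly R} :=
  th m%:R (c i) + (if i is i'.+1 then c i' else 0).

(* [t^(j./2) (lam^(j./2) phi | lam^(j./2) theta phi)], [j] even or odd, written
   in the Euler jets of an eigenfunction; the coefficients do not depend on it. *)
Fixpoint chi (j : nat) : nat -> {poly R} :=
  if j is j'.+1 then
    if odd j' then fun i => ('X - 2%:P) * op_th j'./2 (chi j') i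
                            - ((2 * b)%:P - (s + 1) *: 'X) * chi j' i
    else op_th j'./2 (chi j')
  else fun i => if i is 0%N then 1 else 0.

Lemma chi_gt j i : (j < i)%N -> chi j i = 0.
Proof.
elim: j i => [|j IH] [|i] //= lt.
have e : op_th j./2 (chi j) i.+1 = 0.
  by rewrite /op_th !IH ?th0 ?addr0 // (leq_trans _ lt) // ltnW.
by case: ifP => _; rewrite ?e ?IH ?mulr0 ?subr0 // ltnW.
Qed.

(** Each passage from odd to even order applies the equation once and brings in one factor t - 2,
    its leading coefficient up to sign. *)
Lemma chi_diag j : chi j j = ('X - 2%:P) ^+ j./2.
Proof.
elim: j => [|j IH]; first by rewrite expr0.
have e : op_th j./2 (chi j) j.+1 = ('X - 2%:P) ^+ j./2.
  by rewrite /op_th chi_gt // th0 add0r IH.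
rewrite [chi j.+1 j.+1]/=; case: ifP => oj; rewrite ?e.
  by rewrite chi_gt // mulr0 subr0 -exprS -uphalfE uphalf_half oj.
by rewrite -uphalfE uphalf_half oj.
Qed.

Lemma op_thP (m : nat) (c : nat -> {poly R}) N g p :
  (forall i, (N < i)%N -> c i = 0) ->
  th (g + m%:R) (\sum_(i < N.+1) c i * jet g i p)
    = \sum_(i < N.+2) op_th m c i * jet g i p.
Proof.
move=> hc; rewrite th_sum.
transitivity (\sum_(i < N.+1) (th m%:R (c i) * jet g i p + c i * jet g i.+1 p)).
  by apply: eq_bigr => i _; rewrite [g + _]addrC th_mul.
rewrite big_split /=; rewrite [RHS](eq_bigr (fun i : 'I_N.+2 =>
   th m%:R (c i) * jet g i p + (if val i is i'.+1 then c i' else 0) * jet g i p)).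
  rewrite big_split /=; congr (_ + _).
    by rewrite [RHS]big_ord_recr /= hc // th0 mul0r addr0.
  by rewrite [RHS]big_ord_recl /= mul0r add0r; apply: eq_bigr.
by move=> i _; rewrite /op_th mulrDl.
Qed.

Lemma chiP g lam p : eigen g lam p -> forall j,
  'X^(j./2) * yrow lam p (th g p) j = \sum_(i < j.+1) chi j i * jet g i p.
Proof.
move=> he; elim=> [|j IH]; first by rewrite big_ord1 /yrow /= !mul1r expr0 scale1r.
have := op_thP j./2 g p (@chi_gt j).
rewrite -IH thX /yrow thZ => e.
rewrite [chi j.+1]/=; case: ifP e => oj e; rewrite [j.+1./2]/= uphalf_half oj /=.
  rewrite (eq_bigr (fun i : 'I_j.+2 => ('X - 2%:P) * (op_th j./2 (chi j) i * jet g i p)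
     - ((2 * b)%:P - (s + 1) *: 'X) * (chi j i * jet g i p))); last first.
    by move=> i _; ring.
  rewrite sumrB -!mulr_sumr -e [in X in _ - X]big_ord_recr /= chi_gt // mul0r addr0 -IH.
  rewrite /yrow oj.
  transitivity ('X^(j./2) * (lam ^+ j./2)%:P * (lam *: ('X * p))).
    by rewrite !add1n !exprS -!mul_polyC polyCM; ring.
  move/eqP: he; rewrite addrC addr_eq0 => /eqP ->.
  by rewrite -!mul_polyC; ring.
by rewrite oj !add0n -e.
Qed.

End Jets.

Section Determinants.
Variable R : archiRealFieldType.
Implicit Types (g h : R) (n i j k m : nat) (p q : {poly R}).

Definition wmx n (gam : nat -> R) (phi : nat -> {poly R}) : 'M[{poly R}]_n :=
  \matrix_(i < n, j < n) jet (gam i) j (phi i).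

Definition ymx n (lam : nat -> R) (phi psi : nat -> {poly R}) : 'M[{poly R}]_n :=
  \matrix_(i < n, j < n) yrow (lam i) (phi i) (psi i) j.

(** The total of the exponents in [chi_diag], and of the powers of t in [chiP], over the n
    columns. *)
Definition nu n := (\sum_(j < n) j./2)%N.

Definition ext (T : Type) k (f : nat -> T) (x : T) : nat -> T :=
  fun i => if (i < k)%N then f i else x.

Lemma ext_lt (T : Type) k (f : nat -> T) x i : (i < k)%N -> ext k f x i = f i.
Proof. by rewrite /ext => ->. Qed.

Lemma ext_last (T : Type) k (f : nat -> T) x : ext k f x k = x.
Proof. by rewrite /ext ltnn. Qed.

(** The change of columns given by [chi] is triangular and the same for every row, as [chi] involves
    neither g nor lam. *)
Lemma det_wmx s b n gam lam phi :
  (forall i, (i < n)%N -> eigen s b (gam i) (lam i) (phi i)) ->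
  \det (wmx n gam phi) * ('X - 2%:P) ^+ nu n =
  'X^(nu n) * \det (ymx n lam phi (fun i => th (gam i) (phi i))).
Proof.
move=> he.
pose C : 'M[{poly R}]_n := \matrix_(i < n, j < n) chi s b j i.
pose D : 'M[{poly R}]_n := diag_mx (\row_j 'X^(j./2)).
have e : wmx n gam phi *m C = ymx n lam phi (fun i => th (gam i) (phi i)) *m D.
  apply/matrixP => i j; rewrite mul_mx_diag !mxE mulrC (chiP (he i (ltn_ord i))).
  rewrite (big_ord_widen n (fun l => chi s b j l * jet (gam i) l (phi i))) // [RHS]big_mkcond /=.
  apply: eq_bigr => l _; rewrite !mxE ltnS mulrC; case: leqP => // lt.
  by rewrite chi_gt ?mul0r.
have := congr1 determinant e; rewrite !det_mulmx det_diag.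
have -> : \det C = ('X - 2%:P) ^+ nu n.
  rewrite -det_tr det_trig; last first.
    by apply/is_trig_mxP => i j lt; rewrite !mxE chi_gt.
  by rewrite /nu expr_sum; apply: eq_bigr => i _; rewrite !mxE chi_diag.
move=> ->; rewrite mulrC; congr (_ * _).
by rewrite /nu expr_sum; apply: eq_bigr => i _; rewrite mxE.
Qed.

Lemma det_scale_rows n (d : 'I_n -> {poly R}) (A : 'M[{poly R}]_n) :
  \det (\matrix_(i, j) (d i * A i j)) = (\prod_i d i) * \det A.
Proof.
have -> : \matrix_(i, j) (d i * A i j) = diag_mx (\row_i d i) *m A.
  by apply/matrixP => i j; rewrite mul_diag_mx !mxE.
by rewrite det_mulmx det_diag; congr (_ * _); apply: eq_bigr => i _; rewrite mxE.
Qed.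

(* Subtracting [ln] times column [j] from column [j+2] leaves the last row
   with two nonzero entries. *)
Lemma det_ymx_ext k lam phi psi ln p q :
  \det (ymx k.+2 (ext k.+1 lam ln) (ext k.+1 phi p) (ext k.+1 psi q)) =
  \sum_(f < k.+1) cofactor (ymx k.+1 lam phi psi) f ord_max
    * (phi f * q - psi f * p) * \prod_(i < k) (lam (lift f i) - ln)%:P.
Proof.
set M := ymx _ _ _ _; set Y := ymx _ _ _ _.
pose U : 'M[{poly R}]_k.+2 := \matrix_(i, j) ((i == j)%:R - ln%:P * (i.+2 == j :> nat)%:R).
have detU : \det U = 1.
  rewrite -det_tr det_trig; last first.
    apply/is_trig_mxP => i j lt; rewrite !mxE -val_eqE /= gtn_eqF //.
    by rewrite gtn_eqF ?mulr0 ?subrr // ltnW // ltnW.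
  apply: big1 => i _; rewrite !mxE eqxx gtn_eqF ?mulr0 ?subr0 //.
have NE (i j : 'I_k.+2) : (M *m U) i j = M i j -
    (if val j is j'.+2 then ln%:P * yrow (ext k.+1 lam ln i) (ext k.+1 phi p i) (ext k.+1 psi q i) j' else 0).
  rewrite mxE; under eq_bigr do rewrite [U _ _]mxE mulrBr.
  rewrite sumrB (bigD1 j) //= eqxx mulr1 big1 ?addr0; last first.
    by move=> l /negbTE ->; rewrite mulr0.
  congr (_ - _); case: j => [[|[|j']] lj] /=; try by apply: big1 => l _; rewrite !mulr0.
  have lj' : (j' < k.+2)%N by rewrite ltnW // ltnW.
  rewrite (bigD1 (Ordinal lj')) //= eqxx mulr1 big1 ?addr0; first by rewrite mxE mulrC.
  move=> l ne; case: eqP => [[e]|_]; last by rewrite !mulr0.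
  by case/eqP: ne; apply: val_inj.
transitivity (\det (M *m U)); first by rewrite det_mulmx detU mulr1.
set N := M *m U in NE *.
have N_row (i : 'I_k.+2) (j : nat) (lj : (j.+2 < k.+2)%N) :
   N i (Ordinal lj) = (ext k.+1 lam ln i - ln)%:P * yrow (ext k.+1 lam ln i) (ext k.+1 phi p i) (ext k.+1 psi q i) j.
  by rewrite NE mxE /= yrowSS polyCB mulrBl.
have N0 (i : 'I_k.+2) : N i ord0 = ext k.+1 phi p i.
  by rewrite NE mxE /= subr0 /yrow /= scale1r.
have N1 (i : 'I_k.+2) : N i (lift ord0 ord0) = ext k.+1 psi q i.
  by rewrite NE mxE /= subr0 /yrow /= scale1r.
clearbody N.
rewrite (expand_det_row _ ord_max) big_ord_recl big_ord_recl big1 ?addr0; last first.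
  move=> j _; have lj : (j.+2 < k.+2)%N by rewrite !ltnS.
  have -> : lift ord0 (lift ord0 j) = Ordinal lj by apply: val_inj.
  by rewrite N_row ext_last subrr mul0r mul0r.
rewrite N0 N1 !ext_last.
(* Only the first two entries of the last row survive. Deleting one of these columns leaves the
   other, next to columns whose entries are those of Y times lam - ln; expanding along the surviving
   one gives cofactors of the last column of Y. *)
have minor (c : 'I_k.+2) (u : nat -> {poly R}) : (c < 2)%N ->
    (forall i : 'I_k.+1, N (lift ord_max i) (lift c ord0) = u i) ->
    \det (row' ord_max (col' c N)) = \sum_(f < k.+1) u f * ((-1) ^+ f
      * ((\prod_(i < k) (lam (lift f i) - ln)%:P) * \det (row' f (col' ord_max Y)))).
  move=> c2 hu; rewrite (expand_det_col _ ord0); apply: eq_bigr => f _.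
  rewrite !mxE hu; congr (_ * _); rewrite /cofactor addn0; congr (_ * _).
  rewrite -det_scale_rows; congr (\det _); apply/matrixP => i j; rewrite !mxE.
  have lj : (j.+2 < k.+2)%N by rewrite !ltnS.
  have -> : lift c (lift ord0 j) = Ordinal lj.
    by apply: val_inj; rewrite /= /bump leq0n !add1n (leq_trans (_ : c <= 1)%N).
  by rewrite N_row !lift_max !ext_lt ?ltn_ord // lift_max.
rewrite /cofactor.
rewrite (minor ord0 psi) // => [|i]; last first.
  by rewrite N1 lift_max ext_lt.
rewrite (minor (lift ord0 ord0) phi) // => [|i]; last first.
  have -> : lift (lift ord0 ord0) ord0 = ord0 :> 'I_k.+2 by apply: val_inj.
  by rewrite N0 lift_max ext_lt.
rewrite !mulr_sumr -big_split /=; apply: eq_bigr => f _.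
rewrite addn0 addn1 !exprS exprD; set S := (-1) ^+ k.
set T := (-1) ^+ f; set P := \prod_(i < k) _; set Q := \det _.
ring.
Qed.
End Determinants.

(** * The polynomial p attached to q *)

Section Reproducing.
Variable R : archiRealFieldType.
Implicit Types (g h : R) (n i j k m : nat) (p q : {poly R}).

(** On t^i the operator [th (- c)] is multiplication by c + i. *)
Lemma th_surj (c : R) : nonpole c -> forall q, exists p, th (- c) p = q.
Proof.
move=> hc q; exists (\poly_(i < size q) (q`_i / (c + i%:R))).
apply/polyP => i; rewrite /th coefB coefZ coefXM coef_deriv !coef_poly.
have ci := hc i; case: i ci => [|i] /= ci.
  rewrite addr0 in ci; case: ltnP => lt; first by rewrite addr0; field.
  by rewrite mulr0 subr0 nth_default.
case: ltnP => lt; last by rewrite mul0rn mulr0 subr0 nth_default.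
by rewrite -[_ *+ i.+1]mulr_natr; field; rewrite nat1r.
Qed.

(** The Pearson identity for V C, with V the theta-Wronskian of the two eigenfunctions: the
    derivative of V produces the difference of the eigenvalues, that of C the right side. *)
Lemma Lam_green (a b g lam ln : R) (phi psi C : {poly R}) : nonpole (a + b + 2) ->
  eigen (a + b) b g lam phi -> eigen (a + b) b 0 ln psi ->
  (ln - lam) * Lam a b (phi * psi * ('X * C)) =
  Lam a b ((2%:P - 'X) * (phi * th 0 psi - th g phi * psi) * th (- (g + 1)) C).
Proof.
move=> h ef en; set V := phi * _ - _.
have hP := Lam_pearson h (V * C).
apply/eqP; rewrite -subr_eq0 -LamZ -LamB -[0]oppr0 -{}hP.
rewrite -[- Lam a b _]mulN1r -LamZ scaleN1r; apply/eqP; congr Lam.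
have e1 : 'X * (V * C)^`() = (phi * th 0 (th 0 psi) - psi * th g (th g phi)) * C
    + V * (th (- (g + 1)) C - C).
  by rewrite /V !thE !(derivB, derivM, derivX, derivC) !(polyCN, polyCD, polyC1, polyC0); ring.
rewrite {}e1; move: ef en; rewrite /eigen -/(th _ _).
set E := (2 * b)%:P - _; set F2 := th g (th g phi); set P2 := th 0 (th 0 psi).
move=> ef en; apply/eqP; rewrite -subr_eq0; apply/eqP.
have : phi * C * ((2%:P - 'X) * P2 + E * th 0 psi + ln *: ('X * psi))
     - psi * C * ((2%:P - 'X) * F2 + E * th g phi + lam *: ('X * phi)) = 0.
  by rewrite ef en !mulr0 subrr.
apply: etrans; rewrite /V /E -!mul_polyC !(polyCN, polyCD, polyCM, polyC1); ring.
Qed.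

Section Family.
Variables (a b : R) (k : nat) (gam lam : nat -> R) (phi : nat -> {poly R}).
Hypothesis hab : nonpole (a + b + 2).
Hypothesis hphi : forall i, (i < k.+1)%N -> eigen (a + b) b (gam i) (lam i) (phi i).

Let Y := ymx k.+1 lam phi (fun i => th (gam i) (phi i)).
Let W := \det (wmx k.+1 gam phi).

Definition bordered p := \det (wmx k.+2 (ext k.+1 gam 0) (ext k.+1 phi p)).

Lemma bordered_ymx (ln : R) psi : eigen (a + b) b 0 ln psi ->
  bordered psi * ('X - 2%:P) ^+ nu k.+2 = 'X^(nu k.+2) *
  \det (ymx k.+2 (ext k.+1 lam ln) (ext k.+1 phi psi)
    (ext k.+1 (fun i => th (gam i) (phi i)) (th 0 psi))).
Proof.
move=> en; rewrite /bordered (@det_wmx _ (a + b) b _ _ (ext k.+1 lam ln)); last first.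
  by move=> i _; rewrite /ext; case: ltnP => // /hphi.
congr (_ * \det _); apply/matrixP => i j; rewrite !mxE; congr yrow.
by rewrite /ext; case: ifP.
Qed.

Variables (q : {poly R}) (C : 'I_k.+1 -> {poly R}).
Hypothesis hC : forall f : 'I_k.+1, th (- (gam f + 1)) (C f) = q * 'X^(nu k.+2) * cofactor Y f ord_max.

(** Variation of constants: the theta-derivatives of the coefficients of the eigenfunctions are
    proportional to q times the last-column cofactors. *)
Let p := \sum_(f < k.+1) phi f * ('X * C f).

(** [det_ymx_ext] splits the bordered determinant into Wronskians of psi with single eigenfunctions.
    [Lam_green] turns the one of index f into the pairing with its term of p and supplies the factor
    ln - lam f absent from the product over the other indices. *)
Lemma pairing_eigen (ln : R) psi : eigen (a + b) b 0 ln psi ->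
  (\prod_(f < k.+1) (ln - lam f)) * Lam a b (p * psi) =
  (-1) ^+ k * Lam a b ((2%:P - 'X) * ('X - 2%:P) ^+ nu k.+2 * q * bordered psi).
Proof.
move=> en.
have -> : (2%:P - 'X) * ('X - 2%:P) ^+ nu k.+2 * q * bordered psi
   = (2%:P - 'X) * q * (bordered psi * ('X - 2%:P) ^+ nu k.+2) by ring.
rewrite (bordered_ymx en) det_ymx_ext -/Y.
rewrite [X in _ = _ * Lam a b (_ * X)]mulr_sumr [X in _ = _ * Lam a b X]mulr_sumr.
rewrite /p mulr_suml !Lam_sum !mulr_sumr; apply: eq_bigr => f _.
rewrite (bigD1_ord f) //= -[LHS]mulrA [LHS]mulrCA.
have -> : phi f * ('X * C f) * psi = phi f * psi * ('X * C f) by ring.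
rewrite (Lam_green _ hab (hphi (ltn_ord f)) en) hC.
rewrite -rmorph_prod /= -!LamZ; congr Lam; rewrite -!mul_polyC.
have -> : \prod_(i < k) (ln - lam (bump f i)) = (-1) ^+ k * \prod_(i < k) (lam (bump f i) - ln).
  by under eq_bigr do rewrite -opprB; rewrite prodrN card_ord.
by rewrite polyCM; ring.
Qed.

Lemma cof_jet_sum (j : 'I_k.+1) :
  \sum_(i < j.+1) chi (a + b) b j i *
    \sum_(f < k.+1) cofactor Y f ord_max * jet (gam f) i (phi f)
  = 'X^(j./2) * (\det Y *+ (ord_max == j)).
Proof.
have /matrixP/(_ ord_max j) := mul_adj_mx Y.
rewrite [RHS]mxE => <-; rewrite mxE mulr_sumr; under eq_bigr do rewrite mulr_sumr.
rewrite exchange_big /=; apply: eq_bigr => f _; rewrite !mxE.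
by rewrite [RHS]mulrCA (chiP (hphi (ltn_ord f))) mulr_sumr; apply: eq_bigr => i _; ring.
Qed.

(** The cofactors of the last column annihilate all other columns of Y, and the jets are recovered
    from these through the triangular [chi]. *)
Lemma cof_jet_lt (j : nat) : (j < k)%N ->
  \sum_(f < k.+1) cofactor Y f ord_max * jet (gam f) j (phi f) = 0.
Proof.
elim/ltn_ind: j => j IH jk.
have hj : (j < k.+1)%N by apply: ltnW.
have := cof_jet_sum (Ordinal hj).
rewrite -val_eqE /= gtn_eqF // mulr0n mulr0 big_ord_recr big1 /= ?add0r; last first.
  by move=> i _; rewrite IH ?mulr0 // (ltn_trans _ jk).
move/eqP; rewrite chi_diag mulf_eq0 expf_eq0 polyXsubC_eq0 andbF /=.
by move/eqP.
Qed.

Lemma cof_jet_last :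
  ('X - 2%:P) ^+ k./2 * \sum_(f < k.+1) cofactor Y f ord_max * jet (gam f) k (phi f)
  = 'X^(k./2) * \det Y.
Proof.
have := cof_jet_sum ord_max; rewrite eqxx mulr1n => <-.
rewrite [RHS]big_ord_recr [X in _ = X + _]big1 /= ?add0r ?chi_diag // => i _.
by rewrite cof_jet_lt ?mulr0.
Qed.

(** By [cof_jet_lt] the coefficients behave as constants under theta until order k + 1. The border
    row is thus a combination of the other rows, except for Q in its last entry; so the determinant
    is Q W, and [cof_jet_last] finds a second W in Q. *)
Lemma bordered_self : bordered p = q * 'X^(k.+1) * ('X - 2%:P) ^+ nu k * W ^+ 2.
Proof.
pose T (f : 'I_k.+1) := 'X * (q * 'X^(nu k.+2) * cofactor Y f ord_max).
have thC (f : 'I_k.+1) : th (- gam f) ('X * C f) = T f.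
  rewrite /T -hC !thE !(derivM, derivX) !(polyCN, polyCD, polyC1); ring.
have Tjet (j : nat) : (j < k)%N -> \sum_(f < k.+1) T f * jet (gam f) j (phi f) = 0.
  move=> /cof_jet_lt e; transitivity ('X * q * 'X^(nu k.+2) *
    \sum_(f < k.+1) cofactor Y f ord_max * jet (gam f) j (phi f)).
    by rewrite mulr_sumr; apply: eq_bigr => f _; rewrite /T; ring.
  by rewrite e mulr0.
pose Q := \sum_(f < k.+1) T f * jet (gam f) k (phi f).
have jp (j : nat) : (j < k.+1)%N -> jet 0 j p = \sum_(f < k.+1) jet (gam f) j (phi f) * ('X * C f).
  elim: j => [|j IH] jk //; rewrite jetS IH ?(ltnW jk) // th_sum.
  transitivity (\sum_(f < k.+1) jet (gam f) j.+1 (phi f) * ('X * C f)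
     + \sum_(f < k.+1) T f * jet (gam f) j (phi f)); last by rewrite Tjet ?addr0.
  rewrite -big_split /=; apply: eq_bigr => f _.
  by rewrite -{1}(subrr (gam f)) th_mul thC [X in _ + X]mulrC.
have jpk : jet 0 k.+1 p = \sum_(f < k.+1) jet (gam f) k.+1 (phi f) * ('X * C f) + Q.
  rewrite jetS jp // th_sum /Q -big_split /=; apply: eq_bigr => f _.
  by rewrite -{1}(subrr (gam f)) th_mul thC [X in _ + X]mulrC.
set M := wmx k.+2 (ext k.+1 gam 0) (ext k.+1 phi p).
have Mrow (j : 'I_k.+2) : M ord_max j = \sum_(f < k.+1) ('X * C f) * M (lift ord_max f) j
     + (if j == ord_max then Q else 0).
  rewrite mxE !ext_last; rewrite (eq_bigr (fun f : 'I_k.+1 => jet (gam f) j (phi f) * ('X * C f))).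
    rewrite -val_eqE /=; have := ltn_ord j; rewrite ltnS leq_eqVlt => /predU1P[->|lt].
      by rewrite eqxx jpk.
    by rewrite ltn_eqF // addr0 jp.
  by move=> f _; rewrite mxE lift_max !ext_lt // mulrC.
have detM : bordered p = Q * W.
  rewrite /bordered (expand_det_row _ ord_max) -/M.
  transitivity (\sum_(f < k.+1) ('X * C f) * (\sum_j M (lift ord_max f) j * cofactor M ord_max j)
    + Q * cofactor M ord_max ord_max).
    under eq_bigr do rewrite Mrow mulrDl.
    rewrite big_split /=; congr (_ + _).
      under [RHS]eq_bigr do rewrite mulr_sumr.
      rewrite exchange_big /=; apply: eq_bigr => j _; rewrite mulr_suml.
      by apply: eq_bigr => f _; rewrite mulrA.
    rewrite (bigD1 ord_max) //= eqxx big1 ?addr0 // => j /negbTE ->.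
    by rewrite mul0r.
  rewrite big1 ?add0r => [|f _]; last first.
    have /matrixP/(_ (lift ord_max f) ord_max) := mul_mx_adj M.
    rewrite !mxE eq_sym (negbTE (neq_lift _ _)) mulr0n => e.
    rewrite -[RHS](mulr0 ('X * C f)) -[X in _ = _ * X]e; congr (_ * _).
    by apply: eq_bigr => j _; rewrite [\adj M _ _]mxE.
  congr (_ * _); rewrite /cofactor -signr_odd oddD addbb mul1r; congr (\det _).
  by apply/matrixP => i j; rewrite !mxE !lift_max !ext_lt.
have X0 : 'X^(nu k.+1) != 0 :> {poly R} by rewrite expf_neq0 // polyX_eq0.
have X2 : ('X - 2%:P) ^+ k./2 != 0 :> {poly R} by rewrite expf_neq0 // polyXsubC_eq0.
have nuS m : nu m.+1 = (nu m + m./2)%N by rewrite /nu big_ord_recr.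
rewrite detM; apply: (mulfI X0); apply: (mulfI X2).
have -> : Q = 'X * q * 'X^(nu k.+2) *
    \sum_(f < k.+1) cofactor Y f ord_max * jet (gam f) k (phi f).
  by rewrite mulr_sumr; apply: eq_bigr => f _; rewrite /T; ring.
set S := \sum_(f < _) _.
transitivity ('X^(nu k.+1) * 'X * q * 'X^(nu k.+2) * W * (('X - 2%:P) ^+ k./2 * S)); first by ring.
rewrite /S cof_jet_last.
have wy := det_wmx hphi; rewrite -/W -/Y in wy.
transitivity ('X * q * 'X^(nu k.+2) * W * 'X^(k./2) * ('X^(nu k.+1) * \det Y)); first by ring.
rewrite -{}wy.
have -> : 'X^(k.+1) = 'X * 'X^(k./2) * 'X^(k.+1./2) :> {poly R}.
  by rewrite -exprS -exprD; congr ('X^_); have := odd_double_half k; rewrite /= uphalf_half; lia.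
by rewrite [nu k.+2]nuS [nu k.+1]nuS !exprD; ring.
Qed.
End Family.
End Reproducing.

(** * Interior points *)

Section Domination.
Variable R : archiRealFieldType.
Implicit Types (a b c : R) (n i l m : nat) (p q : {poly R}).

(** A substitute for 0 <= t <= 2: by [Lam_tilt], factors t and 2 - t next to a square keep the
    functional nonnegative. *)
Lemma Lam_Xn_sqr_bounds a b i p : 0 <= a -> 0 <= b ->
  0 <= Lam a b ('X^i * p ^+ 2) <= 2 ^+ i * Lam a b (p ^+ 2).
Proof.
move=> a0 b0; have h : nonpole (a + b + 2) by apply: gt0_nonpole; rewrite ltr_wpDl ?addr_ge0.
have pos l m : 0 <= Lam a b ('X^l * (2%:P - 'X) ^+ m * p ^+ 2).
  rewrite Lam_tilt // mulr_ge0 ?(ltW (beta_weight_gt0 _ _ a0 b0)) //.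
  by rewrite Lam_sqr_ge0 ?addr_ge0.
apply/andP; split; first by have := pos i 0%N; rewrite expr0 mulr1.
elim: i => [|i IH]; first by rewrite !expr0 !mul1r.
have := pos i 1%N; rewrite expr1.
have -> : 'X^i * (2%:P - 'X) * p ^+ 2 = 2 *: ('X^i * p ^+ 2) - 'X^(i.+1) * p ^+ 2.
  by rewrite -mul_polyC ['X^(i.+1)]exprS; ring.
by rewrite LamB LamZ [2 ^+ i.+1]exprS -mulrA; lra.
Qed.

Lemma Lam_mul_sqr_bounded a b h : 0 <= a -> 0 <= b -> exists2 C : R, 0 <= C &
  forall p, `|Lam a b (h * p ^+ 2)| <= C * Lam a b (p ^+ 2).
Proof.
move=> a0 b0; elim/poly_lin_ind: h => [|k h1 h2 [C1 C10 hC1] [C2 C20 hC2]|i].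
- by exists 0 => // p; rewrite mul0r linear0 normr0 mul0r.
- exists (`|k| * C1 + C2); first by rewrite addr_ge0 ?mulr_ge0.
  move=> p; rewrite mulrDl -scalerAl LamD LamZ.
  apply: le_trans (ler_normD _ _) _; rewrite normrM mulrDl -mulrA.
  by apply: lerD => //; apply: ler_wpM2l.
exists (2 ^+ i); first by rewrite exprn_ge0.
by move=> p; have /andP[h1 h2] := Lam_Xn_sqr_bounds i p a0 b0; rewrite ger0_norm.
Qed.

(** Reduction to [Lam_not_coercive]: write g1 as its value at t0 plus a multiple of t - t0.
    Cauchy-Schwarz moves the second term to the right side, where H1 costs only a constant. *)
Lemma Lam_not_dominated a b t0 j g1 H1 (C : R) : 0 <= a -> 0 <= b -> 0 < t0 < 2 ->
  g1.[t0] != 0 -> 0 <= C ->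
  ~ (forall q, Lam a b (g1 * ('X - t0%:P) ^+ j * q) ^+ 2
       <= C * `|Lam a b (H1 * (('X - t0%:P) ^+ j.+1 * q) ^+ 2)|).
Proof.
move=> a0 b0 t02 g10 C0 H; set v := 'X - t0%:P in H.
have [CH CH0 hH] := Lam_mul_sqr_bounded H1 a0 b0.
pose c := g1.[t0].
have /factor_theorem[B hB] : root (g1 - c%:P) t0.
  by rewrite /root hornerD hornerN hornerC subrr.
have gE : g1 = c%:P + B * v by rewrite -hB addrC subrK.
have c2 : 0 < c ^+ 2 by rewrite exprn_even_gt0.
apply: (@Lam_not_coercive R a b t0 j ((2 * (C * CH) + 2 * Lam a b (B ^+ 2)) / c ^+ 2)) => // q.
rewrite -/v mulrAC ler_pdivlMr //.
have e : 'X - t0%:P = v by [].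
have -> : v ^+ j.+1.*2 * q ^+ 2 = (v ^+ j.+1 * q) ^+ 2 by rewrite exprMn -exprM muln2.
set V := v ^+ j.+1 * q; have hq := H q.
have h1 : Lam a b (g1 * v ^+ j * q) = c * Lam a b (v ^+ j * q) + Lam a b (B * V).
  by rewrite -LamZ -LamD; congr Lam; rewrite gE /V exprS -mul_polyC; ring.
have h2 := Lam_cauchy B V a0 b0.
have h3 := ler_wpM2l C0 (hH V).
rewrite {}h1 -/V in hq; move: hq h2 h3.
set x := Lam a b (v ^+ j * q); set y := Lam a b (B * V); set z := Lam a b (V ^+ 2).
set w := `|_|; set u := Lam a b (B ^+ 2) => hq h2 h3.
have h4 : (c * x) ^+ 2 <= 2 * (c * x + y) ^+ 2 + 2 * y ^+ 2.
  have := sqr_ge0 (c * x + 2 * y); nra.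
by move: h4 hq h2 h3; rewrite exprMn; nra.
Qed.
End Domination.

(** * Order of vanishing of the bordered Wronskians *)

Section BorderedOrder.
Variable R : archiRealFieldType.
Implicit Types (g h : R) (n i j k m : nat) (p q : {poly R}).

Lemma deriv_prod (I : finType) (F : I -> {poly R}) :
  (\prod_i F i)^`() = \sum_i \prod_j (if j == i then (F j)^`() else F j).
Proof.
suff H (r : seq I) : uniq r -> (\prod_(i <- r) F i)^`() =
    \sum_(i <- r) \prod_(j <- r) (if j == i then (F j)^`() else F j).
  by apply: H; apply: index_enum_uniq.
elim: r => [|x r IH] /=; first by rewrite !big_nil derivC.
case/andP=> xr ur; rewrite !big_cons derivM eqxx; congr (_ * _ + _).
  apply: eq_big_seq => j jr; case: eqP => // e.
  by rewrite -e jr in xr.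
rewrite IH // mulr_sumr; apply: eq_big_seq => i ir; rewrite big_cons.
by case: eqP => // e; rewrite e ir in xr.
Qed.

(* Differentiating the columns of a Wronskian makes all but the last one
   collide with their right neighbour. *)
Lemma th_det_wmx k (gam : nat -> R) (phi : nat -> {poly R}) :
  th (\sum_(i < k.+1) gam i) (\det (wmx k.+1 gam phi)) =
  \det (\matrix_(i < k.+1, j < k.+1) jet (gam i) (if j == ord_max then k.+1 else j) (phi i)).
Proof.
pose B (c : 'I_k.+1) : 'M[{poly R}]_k.+1 :=
  \matrix_(i, j) jet (gam i) (if j == c then j.+1 else j) (phi i).
transitivity (\sum_(c < k.+1) \det (B c)); last first.
  rewrite (bigD1 ord_max) //= big1 ?addr0 => [|c cm].
    by congr (\det _); apply/matrixP => i j; rewrite !mxE; case: eqP => // ->.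
  have lt : (c.+1 < k.+1)%N.
    by rewrite ltn_neqAle ltn_ord andbT; move: cm; rewrite -val_eqE /= eqSS.
  rewrite -det_tr; apply: (@determinant_alternate _ _ _ c (Ordinal lt)).
    by rewrite -val_eqE /= ltn_eqF.
  move=> i; rewrite !mxE eqxx -val_eqE /= gtn_eqF //.
rewrite /determinant exchange_big /= th_sum; apply: eq_bigr => t _.
rewrite -!mulr_sumr; set G := \sum_(i < _) gam i.
have thS (c : bool) p : th G ((-1) ^+ c * p) = (-1) ^+ c * th G p.
  by case: c; rewrite ?expr0 ?expr1 ?mul1r // !thE !mulN1r derivN; ring.
rewrite thS; congr (_ * _).
rewrite [RHS](reindex_inj (@perm_inj _ t)) /= thE deriv_prod /G rmorph_sum /= mulr_suml mulr_sumr.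
rewrite -sumrB; apply: eq_bigr => i _.
pose Z := \prod_(j < k.+1 | j != i) jet (gam j) (t j) (phi j).
transitivity ('X * ((jet (gam i) (t i) (phi i))^`() * Z) - (gam i)%:P * (jet (gam i) (t i) (phi i) * Z)).
  congr ('X * _ - _ * _).
    rewrite (bigD1 i) //= eqxx mxE; congr (_ * _); apply: eq_bigr => j ji.
    by rewrite (negbTE ji) mxE.
  by rewrite (bigD1 i) //= mxE; congr (_ * _); apply: eq_bigr => j ji; rewrite mxE.
rewrite [RHS](bigD1 i) //= mxE eqxx jetS thE; have -> : \prod_(j < k.+1 | j != i) B (t i) j (t j) = Z.
  by apply: eq_bigr => j ji; rewrite mxE (inj_eq perm_inj) (negbTE ji).
ring.
Qed.

Lemma jet0_Xn j i : jet 0 j ('X^i : {poly R}) = (i%:R ^+ j) *: 'X^i.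
Proof.
elim: j => [|j IH]; first by rewrite expr0 scale1r.
rewrite jetS IH thZ thE mul0r subr0 derivXn exprSr -scalerA; congr (_ *: _).
by case: i {IH} => [|i]; rewrite ?mulr0n ?mulr0 ?scale0r // mulrnAr -exprS scaler_nat.
Qed.

Section Expansion.
Variables (k : nat) (gam : nat -> R) (phi : nat -> {poly R}).

(** The cofactors of the border row; as that row is deleted, the entry 0 stands for any
    polynomial. *)
Definition bcof (j : 'I_k.+2) : {poly R} :=
  cofactor (wmx k.+2 (ext k.+1 gam 0) (ext k.+1 phi 0)) ord_max j.

Lemma bordered_expand p : bordered k gam phi p = \sum_(j < k.+2) jet 0 j p * bcof j.
Proof.
rewrite /bordered (expand_det_row _ ord_max); apply: eq_bigr => j _.
rewrite mxE !ext_last; congr (_ * _); rewrite /bcof /cofactor; congr (_ * \det _).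
by apply/matrixP => i l; rewrite !mxE !lift_max !ext_lt.
Qed.

Lemma borderedD p q : bordered k gam phi (p + q) = bordered k gam phi p + bordered k gam phi q.
Proof.
by rewrite !bordered_expand -big_split; apply: eq_bigr => j _; rewrite jetD mulrDl.
Qed.

Lemma borderedZ c p : bordered k gam phi (c *: p) = c *: bordered k gam phi p.
Proof.
by rewrite !bordered_expand scaler_sumr; apply: eq_bigr => j _; rewrite jetZ scalerAl.
Qed.

Lemma bordered_sum (I : Type) (r : seq I) (P : pred I) (F : I -> {poly R}) :
  bordered k gam phi (\sum_(i <- r | P i) F i) = \sum_(i <- r | P i) bordered k gam phi (F i).
Proof.
apply: (big_morph (bordered k gam phi)) => [p q|]; first exact: borderedD.
by have := borderedZ 0 0; rewrite !scale0r.
Qed.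

(** Deleting the penultimate column leaves the columns of orders 0, ..., k - 1, k + 1, the matrix of
    [th_det_wmx]. This derivative of W is the cofactor that vanishes to lower order than W. *)
Lemma bcof_penult : bcof (lift ord_max ord_max) =
  - th (\sum_(i < k.+1) gam i) (\det (wmx k.+1 gam phi)).
Proof.
rewrite th_det_wmx /bcof /cofactor.
have -> : (-1) ^+ (@ord_max k.+1 + lift (@ord_max k.+1) (@ord_max k))%N = -1 :> {poly R}.
  by rewrite lift_max -signr_odd oddD /= addNb addbb.
rewrite mulN1r; congr (- \det _); apply/matrixP => i j; rewrite !mxE lift_max !ext_lt //.
congr (jet _ _ _); rewrite /= /bump -val_eqE /=.
by have := ltn_ord j; rewrite ltnn add0n ltnS leq_eqVlt; case: (ltngtP j k) => // ->; rewrite add1n.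
Qed.

(** The monomial t^i has jets i^j t^i, so inverting a Vandermonde matrix isolates one cofactor; the
    powers of t equalise the monomials. *)
Lemma bordered_vandermonde : exists c : 'I_k.+2 -> R,
  \sum_(i < k.+2) c i *: ('X^(k.+1 - i) * bordered k gam phi 'X^i)
    = 'X^(k.+1) * bcof (lift ord_max ord_max).
Proof.
pose V : 'M[R]_k.+2 := Vandermonde k.+2 (\row_(i < k.+2) i%:R).
have uV : V \in unitmx.
  rewrite unitmxE unitfE det_Vandermonde; apply/prodf_neq0 => i _; apply/prodf_neq0 => j ij.
  by rewrite !mxE subr_eq0 eqr_nat gtn_eqF.
pose c := invmx V; exists (fun i : 'I_k.+2 => c i (lift ord_max ord_max)).
have cE (j : 'I_k.+2) : \sum_(i < k.+2) c i (lift ord_max ord_max) * i%:R ^+ j = (j == lift ord_max ord_max)%:R.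
  have /matrixP/(_ j (lift ord_max ord_max)) := mulmxV uV; rewrite !mxE => <-.
  by apply: eq_bigr => i _; rewrite !mxE mulrC.
transitivity (\sum_(j < k.+2) (\sum_(i < k.+2) c i (lift ord_max ord_max) * i%:R ^+ j) *: ('X^(k.+1) * bcof j)).
  under eq_bigr do rewrite bordered_expand mulr_sumr scaler_sumr.
  rewrite exchange_big /=; apply: eq_bigr => j _; rewrite scaler_suml; apply: eq_bigr => i _.
  rewrite jet0_Xn -scalerA; congr (_ *: _).
  by rewrite -scalerAl -scalerAr mulrA -exprD subnK // -ltnS.
rewrite (bigD1 (lift ord_max ord_max)) // cE eqxx scale1r big1 /= ?addr0 // => j jn.
by rewrite cE (negbTE jn) scale0r.
Qed.

(** Otherwise (t - t0)^m would divide the theta-derivative of W, whose order at t0 != 0 is m - 1. *)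
Lemma bordered_low_order (t0 : R) m w1 : t0 != 0 -> (0 < m)%N -> w1.[t0] != 0 ->
  \det (wmx k.+1 gam phi) = w1 * ('X - t0%:P) ^+ m ->
  exists i : nat, ~~ (('X - t0%:P) ^+ m %| bordered k gam phi 'X^i).
Proof.
move=> t00 m0 w10 hW; set v := 'X - t0%:P in hW *.
case: (boolP [forall i : 'I_k.+2, v ^+ m %| bordered k gam phi 'X^i]); last first.
  by rewrite negb_forall => /existsP[i hi]; exists i.
move/forallP => hall; have [c hc] := bordered_vandermonde.
have : v ^+ m %| 'X^(k.+1) * bcof (lift ord_max ord_max).
  rewrite -hc; apply: (big_ind (fun q : {poly R} => v ^+ m %| q)) => [|p q|i _].
  - exact: dvdp0.
  - exact: dvdp_add.
  rewrite -mul_polyC.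
  by do 2!apply: dvdp_mull.
rewrite bcof_penult mulrN dvdpNr thE mulrBr; set G := \sum_(i < _) _.
rewrite hW dvdp_subl; last by rewrite !mulrA dvdp_mulIr.
rewrite derivM mulrDr mulrDr deriv_exp -/v derivB derivX derivC subr0 mul1r.
rewrite dvdp_addr; last by rewrite !mulrA dvdp_mulIr.
case: m m0 {hall hW} => // m _; rewrite /= exprS -mulr_natr.
have -> : 'X^(k.+1) * ('X * (w1 * (v ^+ m * m.+1%:R))) = ('X^(k.+2) * w1 * m.+1%:R) * v ^+ m.
  by rewrite [in RHS]exprS; ring.
rewrite dvdp_mul2r ?expf_neq0 ?polyXsubC_eq0 // dvdp_XsubCl rootM rootM.
rewrite /root hornerXn expf_eq0 (negbTE t00) (negbTE w10) -polyC_natr hornerC.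
by rewrite pnatr_eq0.
Qed.
End Expansion.
End BorderedOrder.

(** * Nonvanishing at interior points *)

Section Interior.
Variable R : archiRealFieldType.
Implicit Types (g h : R) (n i j m : nat) (p q : {poly R}).

Lemma jac_eigen (a b : R) n : eigen (a + b) b 0 (jac_eig a b n) (jac a b n).
Proof.
have om := jac_ode a b n; rewrite -/(jac_eig a b n) in om.
move: om; set OM := (X in X = 0) => om; rewrite /eigen.
transitivity ('X * OM); last by rewrite om mulr0.
rewrite /OM !thE -!mul_polyC !(derivB, derivM, derivX, derivC) !(polyCD, polyCM, polyC1, polyC0).
ring.
Qed.

Lemma jac_basis_wide (a b : R) p N0 : nonpole (a + b + 1) -> (size p <= N0)%N ->
  exists c : nat -> R, (forall n, (N0 <= n)%N -> c n = 0) /\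
    forall N, (N0 <= N)%N -> p = \sum_(n < N) c n *: jac a b n.
Proof.
move=> h sp; have [c hc] := jac_basis h sp.
exists (fun n => if (n < N0)%N then c n else 0); split.
  by move=> n; rewrite leqNgt => /negbTE ->.
move=> N le; rewrite {1}hc (big_ord_widen N (fun n => c n *: jac a b n)) // big_mkcond /=.
by apply: eq_bigr => i _; case: ifP => // _; rewrite scale0r.
Qed.

Variables (a b : R) (k : nat) (gam lam : nat -> R) (phi : nat -> {poly R}).
Hypotheses (ha : nonpole (a + 1)) (hb : nonpole (b + 1)) (hs : nonpole (a + b + 1)).
Hypothesis hphi : forall i, (i < k.+1)%N -> eigen (a + b) b (gam i) (lam i) (phi i).
Hypothesis hgam : forall i, (i < k.+1)%N -> nonpole (gam i + 1).

Let tau n := \prod_(f < k.+1) (jac_eig a b n - lam f).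
Let W := \det (wmx k.+1 gam phi).

Variable eps : R.
Hypothesis eps0 : eps != 0.
Hypothesis hpos : forall n, 0 <= eps * (tau n * Lam a b (jac a b n ^+ 2)).

(** Cauchy-Schwarz for the weights w n, applied to the coefficients of r and of the p attached to q.
    The norm of r does not involve q, so C is uniform in q; the norm of p is evaluated by
    [bordered_self]. *)
Lemma bordered_dominated r : exists2 C : R, 0 <= C & forall q,
  Lam a b ((2%:P - 'X) * ('X - 2%:P) ^+ nu k.+2 * q * bordered k gam phi r) ^+ 2 <=
  C * `|Lam a b ((2%:P - 'X) * ('X - 2%:P) ^+ nu k.+2 * q *
          (q * 'X^(k.+1) * ('X - 2%:P) ^+ nu k * W ^+ 2))|.
Proof.
have hab : nonpole (a + b + 2) by have := nonpoleS hs; rewrite -addrA.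
have [d [d0 hd]] := jac_basis_wide hs (leqnn (size r)).
pose w n := eps * (tau n * Lam a b (jac a b n ^+ 2)).
pose D := \sum_(n < size r) w n * d n ^+ 2.
exists (D / `|eps|).
  by rewrite divr_ge0 // sumr_ge0 // => n _; rewrite mulr_ge0 ?sqr_ge0 ?hpos.
move=> q; set kap := _ * _ ^+ _.
pose Y := ymx k.+1 lam phi (fun i => th (gam i) (phi i)).
have [C hC] := fin_all_exists (fun f : 'I_k.+1 =>
  th_surj (hgam (ltn_ord f)) (q * 'X^(nu k.+2) * cofactor Y f ord_max)).
pose p := \sum_(f < k.+1) phi f * ('X * C f).
have [c [c0 hc]] := jac_basis_wide hs (leqnn (size p)).
pose N := maxn (size p) (size r).
have hcN := hc N (leq_maxl _ _); have hdN := hd N (leq_maxr _ _).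
have pair n : (n < N)%N -> w n * c n = eps * (-1) ^+ k * Lam a b (kap * q * bordered k gam phi (jac a b n)).
  move=> nN; rewrite -mulrA -(pairing_eigen hab hphi hC (jac_eigen a b n)) -/p hcN.
  by rewrite Lam_sum_jac // /w /tau; ring.
have form e s : s = \sum_(n < N) e n *: jac a b n ->
    \sum_(n < N) w n * c n * e n = eps * (-1) ^+ k * Lam a b (kap * q * bordered k gam phi s).
  move=> ->; rewrite bordered_sum [X in Lam _ _ X]mulr_sumr Lam_sum mulr_sumr.
  apply: eq_bigr => n _; rewrite pair // borderedZ -[in RHS]scalerAr LamZ.
  by rewrite [RHS]mulrCA mulrC.
have w0 (n : 'I_N) : 0 <= w n by apply: hpos.
have := @sum_cauchy R N (fun n : 'I_N => w n) (fun n : 'I_N => c n) (fun n : 'I_N => d n) w0.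
rewrite (form d r hdN) (eq_bigr (fun n : 'I_N => w n * c n * c n)); last by move=> n _; rewrite mulrA.
rewrite (form c p hcN) (bordered_self hphi hC).
have -> : \sum_(n < N) w n * d n ^+ 2 = D.
  rewrite /D [RHS](big_ord_widen N (fun n => w n * d n ^+ 2)) ?leq_maxr // [RHS]big_mkcond /=.
  by apply: eq_bigr => n _; case: ltnP => // le; rewrite d0 // expr0n mulr0.
rewrite -/W -/kap; set L1 := Lam a b (_ * bordered _ _ _ _); set L2 := Lam a b _ => h.
have D0 : 0 <= D by rewrite sumr_ge0 // => n _; rewrite mulr_ge0 ?sqr_ge0 ?hpos.
have e0 : 0 < `|eps| by rewrite normr_gt0.
rewrite -(ler_pM2l (exprn_gt0 2 e0)).
apply: le_trans (_ : (eps * (-1) ^+ k * L1) ^+ 2 <= _).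
  by rewrite !exprMn sqrr_sign mulr1 real_normK ?num_real.
apply: le_trans h _; apply: le_trans (_ : `|eps * (-1) ^+ k * L2| * D <= _).
  by rewrite ler_wpM2r // ler_norm.
rewrite !normrM normr_sign mulr1.
have -> // : `|eps| ^+ 2 * (D / `|eps| * `|L2|) = `|eps| * `|L2| * D.
by field; rewrite gt_eqF.
Qed.

Lemma beta_weight_neq0 l i : beta_weight a b l i != 0.
Proof.
have hab : nonpole (a + b + 2) by have := nonpoleS hs; rewrite -addrA.
by rewrite /beta_weight !mulf_neq0 ?invr_eq0 ?poch_neq0 // expf_neq0 // pnatr_eq0.
Qed.

Lemma wronskian_neq0_interior t0 : W != 0 -> 0 < t0 < 2 -> W.[t0] != 0.
Proof.
move=> W0 t02; have /andP[t00 _] := t02; apply/negP => Wt0.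
have hab : nonpole (a + b + 2) by have := nonpoleS hs; rewrite -addrA.
set v := 'X - t0%:P.
have [m [w1 w10 hW]] := multiplicity_XsubC W t0; rewrite W0 /= in w10; rewrite -/v in hW.
have m0 : (0 < m)%N.
  rewrite lt0n; apply: contraNneq w10 => m0.
  by move: Wt0; rewrite hW m0 expr0 mulr1.
have t0n : t0 != 0 by rewrite gt_eqF.
have [i hi] := bordered_low_order t0n m0 w10 hW.
set g := bordered k gam phi 'X^i in hi.
have g0 : g != 0 by apply: contraNneq hi => ->; rewrite dvdp0.
have [j [g1 g10 hg]] := multiplicity_XsubC g t0; rewrite g0 /= in g10; rewrite -/v in hg.
have jm : (j < m)%N.
  rewrite ltnNge; apply: contra hi => mj; rewrite hg -(subnK mj) exprD mulrA.
  exact: dvdp_mulIr.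
have [C C0 hC] := bordered_dominated 'X^i.
(* q carries t^m' (2 - t)^M to make both parameters nonnegative; E adds to M the [(nu k.+2).+1]
   factors 2 - t already present, up to sign, in front of q. *)
have [M [_ hM]] := nat_above (- a); have [m' [_ hm']] := nat_above (- b).
pose E := ((nu k.+2).+1 + M)%N.
pose a2 := a + E%:R; pose b2 := b + m'%:R.
have a20 : 0 <= a2.
  have : M%:R <= E%:R :> R by rewrite ler_nat leq_addl.
  by move: hM; rewrite /a2; lra.
have b20 : 0 <= b2 by move: hm'; rewrite /b2; lra.
pose bw := beta_weight a b m' E; have bw0 : bw != 0 by apply: beta_weight_neq0.
have bwn : 0 < `|bw| by rewrite normr_gt0.
pose s : {poly R} := (-1) ^+ nu k.+2.
(* Since j < m, W^2 yields (t - t0)^(2 (j + 1)) for the square and leaves the remaining powers in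
   H1. *)
pose H1 := s * ('X^(m' + k.+1) * (2%:P - 'X) ^+ M * ('X - 2%:P) ^+ nu k)
  * (w1 ^+ 2 * v ^+ (m - j.+1).*2).
apply: (@Lam_not_dominated R a2 b2 t0 j g1 H1 (C / `|bw|)) => // [|Q]; first by rewrite divr_ge0.
have kapE : (2%:P - 'X) * ('X - 2%:P) ^+ nu k.+2 = s * (2%:P - 'X) ^+ (nu k.+2).+1.
  have -> : 'X - 2%:P = -1 * (2%:P - 'X) :> {poly R} by ring.
  by rewrite exprMn -/s [_ ^+ (nu k.+2).+1]exprS; ring.
have := hC ('X^m' * (2%:P - 'X) ^+ M * Q); rewrite kapE -/g.
have -> : s * (2%:P - 'X) ^+ (nu k.+2).+1 * ('X^m' * (2%:P - 'X) ^+ M * Q) * g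
    = 'X^m' * (2%:P - 'X) ^+ E * ((-1) ^+ nu k.+2 *: (g1 * v ^+ j * Q)).
  rewrite hg -mul_polyC rmorph_sign -/s /E exprD; ring.
have -> : s * (2%:P - 'X) ^+ (nu k.+2).+1 * ('X^m' * (2%:P - 'X) ^+ M * Q)
    * ('X^m' * (2%:P - 'X) ^+ M * Q * 'X^(k.+1) * ('X - 2%:P) ^+ nu k * W ^+ 2)
    = 'X^m' * (2%:P - 'X) ^+ E * (H1 * (v ^+ j.+1 * Q) ^+ 2).
  have -> : W = w1 * (v ^+ (m - j.+1) * v ^+ j.+1) by rewrite -exprD subnK.
  by rewrite /H1 /E -muln2 exprM !exprD; ring.
rewrite !Lam_tilt // -/a2 -/b2 -/bw LamZ.
set L1 := Lam a2 b2 (g1 * _ * _); set L2 := Lam a2 b2 (H1 * _).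
rewrite normrM exprMn [(_ * L1) ^+ 2]exprMn sqrr_sign mul1r => h.
rewrite -(ler_pM2l (exprn_gt0 2 bwn)) real_normK ?num_real //.
apply: le_trans h _; rewrite -real_normK ?num_real //.
by rewrite le_eqVlt; apply/orP; left; apply/eqP; field; rewrite gt_eqF.
Qed.
End Interior.

(** * Endpoints *)

Section Endpoints.
Variable R : archiRealFieldType.
Implicit Types (g h : R) (n i j m : nat) (p q : {poly R}).

Lemma det_poly_eval n (x : 'I_n -> R) (Q : nat -> {poly R}) :
  (forall j, (j < n)%N -> size (Q j) = j.+1) -> injective x ->
  \det (\matrix_(i < n, j < n) (Q j).[x i]) != 0.
Proof.
move=> hQ hx.
pose T : 'M[R]_n := \matrix_(i < n, j < n) (Q j)`_i.
have -> : \matrix_(i < n, j < n) (Q j).[x i] = (Vandermonde n (\row_j x j))^T *m T.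
  apply/matrixP => i j; rewrite !mxE (horner_coef_wide _ (_ : size (Q j) <= n)%N).
    by apply: eq_bigr => l _; rewrite !mxE mulrC.
  by rewrite hQ.
rewrite det_mulmx mulf_neq0 //.
  rewrite det_tr det_Vandermonde; apply/prodf_neq0 => i _; apply/prodf_neq0 => j ij.
  by rewrite !mxE subr_eq0 (inj_eq hx) -val_eqE gtn_eqF.
rewrite -det_tr det_trig; last first.
  by apply/is_trig_mxP => i j ij; rewrite !mxE nth_default // hQ.
apply/prodf_neq0 => i _; rewrite !mxE; have sz := hQ i (ltn_ord i).
have : lead_coef (Q i) != 0 by rewrite lead_coef_eq0 -size_poly_eq0 sz.
by rewrite /lead_coef sz.
Qed.

(* [eigen] reads [\sum_i (ode_coef0 s b i + lam * ode_coef1 i) * jet g i p = 0]. *)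
Definition ode_coef0 (s b : R) (i : nat) : {poly R} :=
  if i is i'.+1 then if i' is i''.+1 then (if i'' is 0%N then 2%:P - 'X else 0)
    else (2 * b)%:P - (s + 1) *: 'X else 0.

Definition ode_coef1 (i : nat) : {poly R} := if i is 0%N then 'X else 0.

(** Coefficients of theta^m composed with \sum_i c i theta^i. *)
Let stepn m (c : nat -> {poly R}) := iter m (@op_th R 0) c.

Lemma stepnP m c N g p : (forall i, (N < i)%N -> c i = 0) ->
  (forall i, (m + N < i)%N -> stepn m c i = 0) /\
  jet g m (\sum_(i < N.+1) c i * jet g i p) = \sum_(i < (m + N).+1) stepn m c i * jet g i p.
Proof.
move=> hc; elim: m => [|m [IH1 IH2]] //; split.
  by move=> [|i] // lt; rewrite /= /op_th !IH1 ?th0 ?addr0 // ltnW.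
rewrite jetS IH2; have := op_thP 0 g p IH1; rewrite addr0 => ->.
by rewrite addSn.
Qed.

Lemma stepn_add m c d (l : R) i :
  stepn m (fun i => c i + l *: d i) i = stepn m c i + l *: stepn m d i.
Proof.
elim: m i => // m IH [|i]; rewrite /= /op_th -/(stepn _ _).
  by rewrite !addr0 -!/(stepn _ _ _) IH thD thZ.
by rewrite !IH thD thZ addrACA -scalerDr.
Qed.

Lemma stepn_top m c N : (forall i, (N < i)%N -> c i = 0) -> stepn m c (m + N) = c N.
Proof.
move=> hc; elim: m => // m IH; rewrite /= /op_th -/(stepn _ _).
by have [h _] := stepnP m 0 0 hc; rewrite addSn h // th0 add0r.
Qed.

(** The leading coefficient 2 - t vanishes at 2, but each theta applied to it contributes -2 to the
    next coefficient. For s = a + b the value is -2 (a + 1 + m). *)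
Lemma stepn_top1 m (s b : R) :
  (stepn m (ode_coef0 s b) m.+1).[2] = 2 * b - 2 * (s + 1) - 2 * m%:R.
Proof.
elim: m => [|m IH].
  by rewrite /= !hornerE; ring.
rewrite /= /op_th -!/(stepn _ _ _) hornerD IH.
have -> : stepn m (ode_coef0 s b) m.+2 = 2%:P - 'X.
  rewrite -addn2 stepn_top //; by case=> [|[|[|i]]].
rewrite thE !(derivB, derivX, derivC) !(hornerD, hornerN, hornerM, hornerC, hornerX) -natr1; ring.
Qed.

(** At the singular point t = 2 the differentiated equation expresses the jet of order n + 1 through
    lower ones, lam entering linearly; nonvanishing of a + 1 + n allows the division. *)
Lemma jet_at2 (a b : R) n : nonpole (a + 1) -> exists Q : nat -> {poly R},
  (forall j, (j <= n)%N -> size (Q j) = j.+1) /\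
  forall g lam p, eigen (a + b) b g lam p ->
    forall j, (j <= n)%N -> (jet g j p).[2] = p.[2] * (Q j).[lam].
Proof.
move=> ha; elim: n => [|n [Q [sQ hQ]]].
  exists (fun _ => 1); split; first by case=> // _; rewrite size_poly1.
  by move=> g lam p _ [|j] // _; rewrite hornerC mulr1.
pose s := a + b; pose u := stepn n (ode_coef0 s b); pose v := stepn n ode_coef1.
pose c := 2 * (a + 1 + n%:R); have c0 : c != 0 by rewrite mulf_neq0 ?pnatr_eq0.
pose Qn := c^-1 *: \sum_(i < n.+1) ((u i).[2]%:P + (v i).[2] *: 'X) * Q i.
have u_gt i : (2 < i)%N -> ode_coef0 s b i = 0 by case: i => [|[|[|i]]].
have v_gt i : (0 < i)%N -> ode_coef1 i = 0 by case: i.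
have vn : v n = 'X by rewrite /v -[X in stepn _ _ X]addn0 stepn_top.
exists (fun j => if (j <= n)%N then Q j else Qn); split.
  move=> j; rewrite leq_eqVlt => /predU1P[->|]; last by rewrite ltnS => jn; rewrite jn sQ.
  rewrite ltnn /Qn size_scale ?invr_eq0 // big_ord_recr /= vn hornerX addrC.
  have e : (u n).[2]%:P + 2 *: 'X = 2 *: ('X - (- ((u n).[2] / 2))%:P) :> {poly R}.
    rewrite polyCN opprK scalerDr addrC; congr (_ + _).
    by rewrite -mul_polyC -polyCM mulrC divfK ?pnatr_eq0.
  have top : size (((u n).[2]%:P + 2 *: 'X) * Q n) = n.+2.
    rewrite e -scalerAl size_scale ?pnatr_eq0 // mulrC size_Mmonic ?monicXsubC //.
      by rewrite size_XsubC sQ // addn2.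
    by rewrite -size_poly_eq0 sQ.
  rewrite size_polyDl top // ltnS; apply: (big_ind (fun q : {poly R} => size q <= n.+1)%N).
  - by rewrite size_poly0.
  - by move=> q1 q2 h1 h2; rewrite (leq_trans (size_polyD _ _)) // geq_max h1.
  move=> i _; apply: leq_trans (size_polyMleq _ _) _; rewrite sQ ?(ltnW (ltn_ord i)) //.
  rewrite addnS /=; apply: leq_trans (_ : 2 + i <= _)%N; last by rewrite add2n !ltnS.
  rewrite leq_add2r (leq_trans (size_polyD _ _)) // geq_max.
  rewrite (leq_trans (size_polyC_leq1 _)) // (leq_trans (size_scale_leq _ _)) //.
  by rewrite size_polyX.
move=> g lam p he j; rewrite leq_eqVlt => /predU1P[->|]; last first.
  by rewrite ltnS => jn; rewrite jn (hQ _ _ _ he).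
rewrite ltnn.
have hN i : (2 < i)%N -> ode_coef0 s b i + lam *: ode_coef1 i = 0.
  by case: i => [|[|[|i]]] //= _; rewrite scaler0 addr0.
have e0 : \sum_(i < 3) (ode_coef0 s b i + lam *: ode_coef1 i) * jet g i p = 0.
  rewrite !big_ord_recl big_ord0 /= add0r !scaler0 !addr0 -[RHS]he /eigen -/s.
  by rewrite -scalerAl; ring.
have [_] := stepnP n g p hN; rewrite e0.
have -> : jet g n 0 = 0 by have := jetZ g n 0 0; rewrite !scale0r.
move/(congr1 (fun q : {poly R} => q.[2])); rewrite horner0 horner_sum addn2.
rewrite big_ord_recr big_ord_recr /=.
have us i : stepn n (fun i => ode_coef0 s b i + lam *: ode_coef1 i) i = u i + lam *: v i.
  exact: stepn_add.
have [vz _] := stepnP n 0 0 v_gt.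
rewrite !us /v vz ?addn0 // vz ?addn0 // !scaler0 !addr0.
have -> : u n.+2 = 2%:P - 'X by rewrite /u -addn2 stepn_top.
have z2 : (2%:P - 'X).[2] = 0 :> R by rewrite hornerD hornerN hornerC hornerX subrr.
rewrite !hornerM z2 mul0r addr0 /u stepn_top1 => hS.
have {}hS : c * (jet g n.+1 p).[2] =
    \sum_(i < n.+1) (stepn n (fun i => ode_coef0 s b i + lam *: ode_coef1 i) i * jet g i p).[2].
  by apply/eqP; rewrite -subr_eq0 -oppr_eq0 opprB [X in _ == X]hS /c /s; apply/eqP; rewrite jetS; ring.
apply: (mulfI c0); rewrite {}hS /Qn hornerZ [RHS]mulrCA mulVKf // [RHS]mulrC.
rewrite horner_sum mulr_suml; apply: eq_bigr => i _.
rewrite us !hornerM (hQ _ _ _ he) ?(leq_ord i) //.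
rewrite !(hornerD, hornerZ, hornerC, hornerX); ring.
Qed.

Lemma horner_det n (A : 'M[{poly R}]_n) x :
  (\det A).[x] = \det (\matrix_(i < n, j < n) (A i j).[x]).
Proof.
rewrite -horner_evalE -det_map_mx; congr (\det _).
by apply/matrixP => i j; rewrite !mxE.
Qed.

Lemma wronskian_at2 (a b : R) n gam lam phi : nonpole (a + 1) ->
  (forall i, (i < n)%N -> eigen (a + b) b (gam i) (lam i) (phi i)) ->
  (forall i, (i < n)%N -> (phi i).[2] != 0) ->
  (forall i j, (i < n)%N -> (j < n)%N -> lam i = lam j -> i = j) ->
  (\det (wmx n gam phi)).[2] != 0.
Proof.
move=> ha he hp hl; have [Q [sQ hQ]] := jet_at2 b n ha.
pose D : 'M[R]_n := diag_mx (\row_(i < n) (phi i).[2]).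
rewrite horner_det.
have -> : \matrix_(i < n, j < n) (wmx n gam phi i j).[2]
    = D *m \matrix_(i < n, j < n) (Q j).[lam i].
  by apply/matrixP => i j; rewrite mul_diag_mx !mxE (hQ _ _ _ (he i (ltn_ord i))) // ltnW.
rewrite det_mulmx mulf_neq0 //.
  by rewrite det_diag; apply/prodf_neq0 => i _; rewrite mxE hp.
apply: det_poly_eval => [j jn|i j e]; first by rewrite sQ // ltnW.
by apply: val_inj; apply: hl e.
Qed.

Lemma jetX g (m : nat) j p : jet (g + m%:R) j ('X^m * p) = 'X^m * jet g j p.
Proof. by elim: j => // j IH; rewrite !jetS IH thX. Qed.

Lemma jet_at0 g j p : (jet g j p).[0] = (- g) ^+ j * p.[0].
Proof.
elim: j => [|j IH]; first by rewrite mul1r.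
by rewrite jetS thE hornerD hornerN !hornerM hornerX mul0r add0r hornerC IH exprS; ring.
Qed.

Lemma coef_th g p m : (th g p)`_m = (m%:R - g) * p`_m.
Proof.
rewrite /th coefB coefZ coefXM coef_deriv mulrBl; congr (_ - _).
by case: m => [|m]; rewrite ?mul0r //= mulr_natl.
Qed.

Lemma eigen_coefS (s b g lam : R) p m : eigen s b g lam p ->
  2 * (m.+1%:R - g) * (m.+1%:R - g + b) * p`_m.+1 =
  ((m%:R - g) * (m%:R - g + s + 1) - lam) * p`_m.
Proof.
move=> /(congr1 (fun q : {poly R} => q`_m.+1)).
rewrite coef0 !coefD !mulrBl !coefB !coefZ mul_polyC !coefZ -scalerAl.
rewrite mul_polyC !coefZ !coefXM /= !coef_th -!natr1 => /eqP; rewrite -subr_eq0 => /eqP h.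
by apply/eqP; rewrite -subr_eq0; apply/eqP; rewrite -[RHS]h; ring.
Qed.

(** The Frobenius recurrence at t = 0; the hypothesis excludes a resonance below n. Each step raises
    the degree in lam by one. *)
Lemma eigen_coef (s b g : R) n :
  (forall m, (m.+1 < n)%N -> (m.+1%:R - g) * (m.+1%:R - g + b) != 0) ->
  exists Q : nat -> {poly R}, (forall j, (j < n)%N -> size (Q j) = j.+1) /\
  forall lam p, eigen s b g lam p -> forall j, (j < n)%N -> p`_j = p`_0 * (Q j).[lam].
Proof.
pose d (m : nat) := 2 * (m.+1%:R - g) * (m.+1%:R - g + b) : R.
pose Q := fix Q (j : nat) : {poly R} := if j is m.+1 then
   (- (d m)^-1) *: (Q m * ('X - ((m%:R - g) * (m%:R - g + s + 1))%:P)) else 1.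
move=> hd; exists Q; split.
  elim=> [|j IH] jn; first by rewrite size_poly1.
  have sj := IH (ltnW jn).
  rewrite /= size_scale; last by rewrite oppr_eq0 invr_eq0 /d -mulrA mulf_neq0 ?pnatr_eq0 // hd.
  by rewrite size_Mmonic ?monicXsubC // -?size_poly_eq0 sj // size_XsubC addn2.
move=> lam p he; elim=> [|j IH] jn; first by rewrite hornerC mulr1.
have dj : d j != 0 by rewrite /d -mulrA mulf_neq0 ?pnatr_eq0 // hd.
apply: (mulfI dj); rewrite /d (eigen_coefS j he) -/(d j) IH ?(ltnW jn) //=.
by rewrite hornerZ hornerM hornerXsubC; field.
Qed.

Section AtZero.
Variables (s b : R) (k1 k2 : nat) (gam lam : nat -> R) (phi : nat -> {poly R}).
Hypothesis gam1 : forall i, (i < k1)%N -> gam i = 0.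
Hypothesis gam2 : forall i, gam (k1 + i)%N = b.
Hypothesis hphi : forall i, (i < k1 + k2)%N -> eigen s b (gam i) (lam i) (phi i).
Hypothesis phi0 : forall i, (i < k1 + k2)%N -> (phi i)`_0 != 0.
Hypothesis lam1 : forall i j, (i < k1)%N -> (j < k1)%N -> lam i = lam j -> i = j.
Hypothesis lam2 : forall i j, (i < k2)%N -> (j < k2)%N ->
  lam (k1 + i)%N = lam (k1 + j)%N -> i = j.
Hypothesis hb1 : nonpole (b + 1).
Hypothesis hb2 : forall m, (m < k2)%N -> m%:R - b != 0.

Lemma coef_block_unit (o n : nat) (g : R) : (o + n <= k1 + k2)%N ->
  (forall i, (i < n)%N -> gam (o + i)%N = g) ->
  (forall i j, (i < n)%N -> (j < n)%N -> lam (o + i)%N = lam (o + j)%N -> i = j) ->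
  (forall m, (m.+1 < n)%N -> (m.+1%:R - g) * (m.+1%:R - g + b) != 0) ->
  (\matrix_(i < n, j < n) (phi (o + i))`_j) \in unitmx.
Proof.
move=> on hg hl hd; have [Q [sQ hQ]] := eigen_coef s hd.
have lt (i : 'I_n) : (o + i < k1 + k2)%N by apply: leq_trans on; rewrite ltn_add2l.
have -> : \matrix_(i < n, j < n) (phi (o + i))`_j =
   diag_mx (\row_(i < n) (phi (o + i))`_0) *m \matrix_(i < n, j < n) (Q j).[lam (o + i)%N].
  apply/matrixP => i j; rewrite mul_diag_mx !mxE -hQ //.
  by rewrite -(hg i) //; apply: hphi.
rewrite unitmxE unitfE det_mulmx mulf_neq0 //.
  by rewrite det_diag; apply/prodf_neq0 => i _; rewrite mxE phi0.
apply: det_poly_eval => // i j e; apply: val_inj; exact: hl e.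
Qed.

(** Exponents x and y - b of different blocks coincide only if b is an integer below k2; [hb1]
    excludes the negative ones, [hb2] the others. *)
Lemma exponents_inj (i j : 'I_(k1 + k2)) :
  (if (i < k1)%N then i%:R else (i - k1)%:R - b) = (if (j < k1)%N then j%:R else (j - k1)%:R - b) :> R ->
  i = j.
Proof.
have mixed (x y : nat) : (y < k2)%N -> x%:R = y%:R - b :> R -> False.
  move=> yk e; have [le|lt] := leqP y x.
    have e' : b + (x - y)%:R = 0 by rewrite natrB // e; ring.
    case: (x - y)%N e' => [|d] e'.
      have := @hb2 0%N (leq_ltn_trans (leq0n y) yk); rewrite sub0r oppr_eq0.
      by move: e'; rewrite addr0 => ->; rewrite eqxx.
    by have := hb1 d; rewrite -addrA nat1r e' eqxx.
  have := @hb2 (y - x)%N (leq_ltn_trans (leq_subr x y) yk).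
  by rewrite natrB ?(ltnW lt) // e opprB addrCA subrr addr0 subrr eqxx.
have sub (l : 'I_(k1 + k2)) : (k1 <= l)%N -> (l - k1 < k2)%N.
  by move=> le; rewrite ltn_subLR // ltn_ord.
case: ltnP => hi; case: ltnP => hj e; apply: val_inj => /=.
- by apply/eqP; rewrite -(eqr_nat R) e.
- by case: (mixed _ _ (sub j hj) e).
- by case: (mixed _ _ (sub i hi) (esym e)).
by move/addIr/eqP: e; rewrite eqr_nat => /eqP e; rewrite -(subnK hi) e subnK.
Qed.

(* Constant row operations inside each block bring the rows to leading
   exponents 0, 1, 2, ... at [t = 0], shifted by [-b] in the second block. *)
Lemma wronskian_at0 : exists2 Q : {poly R}, Q.[0] != 0 &
  \det (wmx (k1 + k2) gam phi) = 'X^(\sum_(i < k1) i + \sum_(i < k2) i) * Q.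
Proof.
pose A1 : 'M[R]_k1 := \matrix_(i < k1, j < k1) (phi (0 + i)%N)`_j.
pose A2 : 'M[R]_k2 := \matrix_(i < k2, j < k2) (phi (k1 + i)%N)`_j.
have u1 : A1 \in unitmx.
  apply: (@coef_block_unit 0 k1 0); rewrite ?leq_addr // => m _.
  by rewrite subr0 mulf_neq0 ?pnatr_eq0 // -natr1 addrAC addrC addrA addrAC; have := hb1 m; rewrite addrAC addrC addrA.
have u2 : A2 \in unitmx.
  apply: (@coef_block_unit k1 k2 b) => // m lt.
  by rewrite subrK mulf_neq0 ?hb2 ?pnatr_eq0.
pose B : 'M[R]_(k1 + k2) := block_mx (invmx A1) 0 0 (invmx A2).
have dB : \det B != 0 by rewrite det_ublock mulf_neq0 // -unitfE -unitmxE unitmx_inv.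
pose psi (i : 'I_(k1 + k2)) := \sum_(l < k1 + k2) B i l *: phi l.
have gB (i l : 'I_(k1 + k2)) : B i l != 0 -> gam l = gam i.
  rewrite /B; case: (split_ordP i) => i' ->; case: (split_ordP l) => l' ->.
  - by move=> _; rewrite /= !gam1.
  - by rewrite block_mxEur mxE eqxx.
  - by rewrite block_mxEdl mxE eqxx.
  by move=> _; rewrite /= !gam2.
pose ex (i : nat) := if (i < k1)%N then i else (i - k1)%N.
have psi_coef (i : 'I_(k1 + k2)) (m : nat) : (m <= ex i)%N -> (psi i)`_m = (m == ex i)%:R.
  rewrite /ex /psi coef_sum; under eq_bigr do rewrite coefZ.
  rewrite big_split_ord /=; case: (split_ordP i) => i' ->.
    move=> le; have lt := leq_ltn_trans le (ltn_ord i').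
    rewrite [X in _ + X]big1 ?addr0; last by move=> l _; rewrite block_mxEur mxE mul0r.
    have /matrixP/(_ i' (Ordinal lt)) := mulVmx u1; rewrite !mxE -val_eqE /= eq_sym => <-.
    by apply: eq_bigr => l _; rewrite block_mxEul mxE.
  rewrite /= addKn => le; have lt := leq_ltn_trans le (ltn_ord i').
  rewrite [X in X + _]big1 ?add0r; last by move=> l _; rewrite block_mxEdl mxE mul0r.
  have /matrixP/(_ i' (Ordinal lt)) := mulVmx u2; rewrite !mxE -val_eqE /= eq_sym => <-.
  by apply: eq_bigr => l _; rewrite block_mxEdr mxE.
have psiE (i : 'I_(k1 + k2)) : psi i = 'X^(ex i) * drop_poly (ex i) (psi i).
  rewrite -{1}(poly_take_drop (ex i) (psi i)) mulrC.
  suff -> : take_poly (ex i) (psi i) = 0 by rewrite add0r.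
  apply/polyP => m; rewrite coef_take_poly coef0; case: ltnP => // lt.
  by rewrite psi_coef ?(ltnW lt) // ltn_eqF.
pose C : 'M[{poly R}]_(k1 + k2) :=
  \matrix_(i, j) jet (gam i - (ex i)%:R) j (drop_poly (ex i) (psi i)).
have key : map_mx polyC B *m wmx (k1 + k2) gam phi = diag_mx (\row_i 'X^(ex i)) *m C.
  apply/matrixP => i j; rewrite mul_diag_mx !mxE -jetX subrK -psiE jet_sum.
  apply: eq_bigr => l _; rewrite [map_mx _ _ _ _]mxE [wmx _ _ _ _ _]mxE jetZ -mul_polyC.
  by have [->|/gB ->] := eqVneq (B i l) 0; rewrite ?mul0r.
have C0 : (\det C).[0] != 0.
  rewrite horner_det; pose x (i : 'I_(k1 + k2)) : R := (ex i)%:R - gam i.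
  have -> : \matrix_(i < k1 + k2, j < k1 + k2) (C i j).[0] = \matrix_(i, j) ('X^j).[x i].
    apply/matrixP => i j; rewrite !mxE jet_at0 hornerXn opprB.
    by rewrite horner_coef0 coef_drop_poly add0n psi_coef // eqxx mulr1.
  apply: det_poly_eval => [j _|i j]; first by rewrite size_polyXn.
  move=> e; apply: exponents_inj; move: e; rewrite /x /ex.
  have gE (l : 'I_(k1 + k2)) : gam l = if (l < k1)%N then 0 else b.
    by case: ltnP => h; [rewrite gam1|rewrite -(subnKC h) gam2].
  by rewrite !gE; do 2!case: ifP => _; rewrite ?subr0.
exists ((\det B)^-1 *: \det C); first by rewrite hornerZ mulf_neq0 ?invr_eq0.
have := congr1 determinant key; rewrite !det_mulmx det_map_mx /= det_diag.
have -> : \prod_(i < k1 + k2) (\row_i 'X^(ex i)) 0 i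
    = 'X^(\sum_(i < k1) i + \sum_(i < k2) i) :> {poly R}.
  rewrite big_split_ord exprD !expr_sum; congr (_ * _); apply: eq_bigr => i _; rewrite mxE /ex /=.
    by rewrite ltn_ord.
  by rewrite ltnNge leq_addr /= addKn.
rewrite mul_polyC => e; rewrite -scalerAr -e scalerA mulVf ?scale1r //.
Qed.
End AtZero.
End Endpoints.

(** * Bounds on the exponents *)

Section ExponentBound.
Variable R : archiRealFieldType.
Implicit Types (n i j m : nat).

Definition tends0 (z : nat -> R) :=
  forall e, 0 < e -> exists N1, forall N, (N1 <= N)%N -> `|z N| <= e.

Lemma tends0_cst0 : tends0 (fun => 0).
Proof. by move=> e e0; exists 0%N => N _; rewrite normr0 ltW. Qed.

Lemma tends0D y z : tends0 y -> tends0 z -> tends0 (fun N => y N + z N).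
Proof.
move=> hy hz e e0; have e2 : 0 < e / 2 by rewrite divr_gt0.
have [N1 h1] := hy _ e2; have [N2 h2] := hz _ e2.
exists (maxn N1 N2) => N; rewrite geq_max => /andP[l1 l2].
apply: le_trans (ler_normD _ _) _; have := h1 _ l1; have := h2 _ l2; lra.
Qed.

Lemma tends0Z c z : tends0 z -> tends0 (fun N => c * z N).
Proof.
move=> hz e e0; have c0 : 0 < `|c| + 1 by rewrite ltr_wpDl.
have [N1 h1] := hz _ (divr_gt0 e0 c0); exists N1 => N /h1 h.
rewrite normrM; apply: le_trans (_ : (`|c| + 1) * `|z N| <= _).
  by rewrite ler_wpM2r // lerDl.
by rewrite mulrC -ler_pdivlMr.
Qed.

Lemma tends0_sum k (z : nat -> nat -> R) : (forall j, (j < k)%N -> tends0 (z j)) ->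
  tends0 (fun N => \sum_(j < k) z j N).
Proof.
elim: k => [|k IH] hz e e0.
  by have [N1 h] := tends0_cst0 e0; exists N1 => N /h; rewrite big_ord0.
have [N1 h] := tends0D (IH (fun j jk => hz j (ltnW jk))) (hz k (ltnSn k)) e0.
by exists N1 => N /h; rewrite big_ord_recr.
Qed.

(* With [m * d >= 1], [`|z N|^m * (N + 1)] is nonincreasing. *)
Lemma tends0_ratio (z : nat -> R) (d : R) N0 : 0 < d -> d <= N0.+1%:R ->
  (forall N, (N0 <= N)%N -> `|z N.+1| <= (1 - d / N.+1%:R) * `|z N|) -> tends0 z.
Proof.
move=> d0 dN0 hz; have [m [m0 hm]] := nat_above d^-1.
have md : 1 <= m%:R * d by rewrite -ler_pdivrMr // div1r ltW.
pose C := `|z N0| ^+ m * N0.+1%:R.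
have mono N : (N0 <= N)%N -> `|z N| ^+ m * N.+1%:R <= C.
  move=> /subnK <-; elim: (N - N0)%N => [|l IH] //; apply: le_trans IH.
  rewrite addSn; set M := (l + N0)%N.
  have M1 : 0 < M.+1%:R :> R by rewrite ltr0n.
  have [x xE] : exists x, x = d / M.+1%:R by exists (d / M.+1%:R).
  have x0 : 0 <= x by rewrite xE divr_ge0 ?ltW.
  have x1 : 0 <= 1 - x.
    rewrite subr_ge0 xE ler_pdivrMr // mul1r; apply: le_trans dN0 _.
    by rewrite ler_nat ltnS leq_addl.
  have bern : 1 + m%:R * x <= (1 + x) ^+ m.
    elim: (m) => [|l' IHl]; first by rewrite mul0r addr0.
    rewrite exprS -natr1; apply: le_trans (_ : (1 + x) * (1 + l'%:R * x) <= _); last first.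
      by rewrite ler_wpM2l // addr_ge0.
    have -> : (1 + x) * (1 + l'%:R * x) = 1 + (l'%:R + 1) * x + l'%:R * (x * x) by ring.
    by rewrite lerDl !mulr_ge0.
  have h1 : (1 - x) ^+ m * M.+2%:R <= M.+1%:R.
    have c1 : (1 - x) ^+ m * (1 + m%:R * x) <= 1.
      apply: le_trans (ler_wpM2l (exprn_ge0 m x1) bern) _.
      rewrite -exprMn exprn_ile1 //.
        by rewrite mulr_ge0 // addr_ge0.
      by have := sqr_ge0 x; rewrite expr2; lra.
    have c2 : M.+2%:R <= M.+1%:R * (1 + m%:R * x).
      rewrite -[M.+2%:R]natr1 mulrDr mulr1 lerD2l xE mulrCA.
      by rewrite [M.+1%:R * _]mulrC divfK ?gt_eqF.
    apply: le_trans (ler_wpM2l (exprn_ge0 m x1) c2) _.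
    by rewrite mulrCA -[leRHS]mulr1 ler_pM2l.
  apply: le_trans (_ : ((1 - x) * `|z M|) ^+ m * M.+2%:R <= _).
    rewrite ler_wpM2r // lerXn2r ?nnegrE ?mulr_ge0 // xE.
    exact: hz (leq_addl _ _).
  by rewrite exprMn mulrAC mulrC ler_wpM2l // exprn_ge0.
move=> e e0; have em : 0 < e ^+ m by rewrite exprn_gt0.
have [N1 [_ hN1]] := nat_above (C / e ^+ m).
exists (maxn N0 N1) => N; rewrite geq_max => /andP[l0 l1].
rewrite leNgt; apply/negP => ez.
have : e ^+ m * N.+1%:R <= C.
  apply: le_trans (mono N l0); rewrite ler_pM2r ?ltr0n //.
  by have := ltW ez; have := ltW e0 => h1 h2; rewrite lerXn2r ?nnegrE.
move: hN1; rewrite ltr_pdivrMr // => hN1; apply/negP; rewrite -ltNge.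
apply: lt_le_trans hN1 _; rewrite mulrC ler_pM2l // ler_nat.
by rewrite (leq_trans l1).
Qed.

(** Newton form at the nodes -ka i, which rewrites a product over arbitrary eigenvalues in the
    products whose weighted sums telescope. *)
Lemma newton_expand (ka : nat -> R) (cs : seq R) : exists d : nat -> R, forall x : R,
  \prod_(c <- cs) (x - c) = \sum_(j < (size cs).+1) d j * \prod_(i < j) (x + ka i).
Proof.
elim: cs => [|c cs [d hd]].
  by exists (fun _ => 1) => x; rewrite big_nil big_ord1 big_ord0 mulr1.
pose d' j := (if j is j'.+1 then d j' else 0)
             - (if (j <= size cs)%N then d j * (ka j + c) else 0).
exists d' => x; rewrite big_cons hd mulr_sumr /d'.
under [RHS]eq_bigr do rewrite mulrBl.
rewrite sumrB [X in _ = X - _]big_ord_recl mul0r add0r.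
rewrite [X in _ = _ - X]big_ord_recr /= ltnn mul0r addr0 -sumrB; apply: eq_bigr => j _.
by rewrite add0n leq_ord big_ord_recr /=; ring.
Qed.

Variables (a b : R).
Hypotheses (ha : nonpole (a + 1)) (hb : nonpole (b + 1)) (hs : nonpole (a + b + 1)).

(** The admissibility weight times a square over n!, so it keeps the sign and has closed partial
    sums. *)
Let wt n : R := poch (a + b + 1) n * poch (a + 1) n * (n%:R *+ 2 + a + b + 1)
  / (n`!%:R * poch (b + 1) n).

Let newt j n : R := \prod_(i < j) (n%:R + b - i%:R).

(** The closed form of those sums, of order N^(2 (a + 1 + j)). *)
Let Z j N : R := poch (a + b + 1) N.+1 * poch (a + 1) (N + j).+1 * newt j N
  / (N`!%:R * (a + 1 + j%:R) * poch (b + 1) N).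

Lemma newtS j n : newt j n * (n%:R + 1 + b) = newt j n.+1 * (n%:R + 1 + b - j%:R).
Proof.
rewrite /newt; elim: j => [|j IH]; first by rewrite !big_ord0 subr0.
rewrite !big_ord_recr /= mulrAC IH -!natr1; ring.
Qed.

Lemma ZS j N : Z j N.+1 * (N.+1%:R * (N%:R + 1 + b - j%:R)) =
  Z j N * ((N%:R + a + b + 2) * (N%:R + a + j%:R + 2)).
Proof.
rewrite /Z addSn [poch _ N.+2]pochS [poch _ (N + j).+2]pochS factS natrM [poch (b + 1) N.+1]pochS.
have h1 := fact_neq0 R N; have h2 := ha j; have h3 := poch_neq0 N hb.
have h4 := hb N; have h5 : N.+1%:R != 0 :> R by rewrite pnatr_eq0.
have e := newtS j N.
set P := poch _ N.+1; set Q := poch _ (N + j).+1.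
rewrite -!natr1 in h5 *; rewrite natrD.
have -> : newt j N = newt j N.+1 * (N%:R + 1 + b - j%:R) / (b + 1 + N%:R).
  have -> : b + 1 + N%:R = N%:R + 1 + b by ring.
  rewrite -e mulfK //; by have -> : N%:R + 1 + b = b + 1 + N%:R by ring.
by field; rewrite h1 h2 h3 h4 h5.
Qed.

(* [jac_eig a b n + (a+1+i) (b-i) = (n+a+1+i) (n+b-i)], so the products over
   [i] shift the parameters of [wt] and each sum telescopes. *)
Lemma sum_wt_newton j N :
  \sum_(n < N.+1) wt n * \prod_(i < j) (jac_eig a b n + (a + 1 + i%:R) * (b - i%:R)) = Z j N.
Proof.
have prodE n : poch (a + 1) n * \prod_(i < j) (jac_eig a b n + (a + 1 + i%:R) * (b - i%:R))
    = poch (a + 1) (n + j) * newt j n.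
  rewrite poch_add -mulrA; congr (_ * _); rewrite /newt /poch -big_split.
  by apply: eq_bigr => i _; rewrite /jac_eig /=; ring.
have wtE n : wt n * \prod_(i < j) (jac_eig a b n + (a + 1 + i%:R) * (b - i%:R)) =
    poch (a + b + 1) n * (n%:R *+ 2 + a + b + 1) * poch (a + 1) (n + j) * newt j n
    / (n`!%:R * poch (b + 1) n).
  by rewrite -[_ * _ * newt j n]mulrA -prodE /wt; ring.
have hj := ha j.
elim: N => [|N IH].
  rewrite big_ord1 wtE /Z !add0n fact0 !poch0 pochS [poch _ j.+1]pochS poch0.
  by rewrite addr0 mul0rn add0r; field; rewrite hj.
rewrite big_ord_recr /= IH wtE.
have h4 := hb N; have h5 : N.+1%:R != 0 :> R by rewrite pnatr_eq0.
have h1 := fact_neq0 R N; have h3 := poch_neq0 N hb.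
have e := newtS j N.
rewrite /Z addSn [poch _ N.+2]pochS [poch _ (N + j).+2]pochS factS natrM [poch (b + 1) N.+1]pochS.
set P := poch _ N.+1; set Q := poch _ (N + j).+1.
rewrite -!natr1 in h5 *; rewrite natrD.
have -> : newt j N = newt j N.+1 * (N%:R + 1 + b - j%:R) / (b + 1 + N%:R).
  have -> : b + 1 + N%:R = N%:R + 1 + b by ring.
  rewrite -e mulfK //; by have -> : N%:R + 1 + b = b + 1 + N%:R by ring.
by field; rewrite h1 h3 h4 h5 hj.
Qed.

Lemma Z_tends0 j : a + j%:R < -1 -> tends0 (Z j).
Proof.
(* d is half the decay exponent: the other half is a margin d N in [key] that absorbs the constant
   terms. *)
move=> aj; pose d := - (a + j%:R + 1); have d0 : 0 < d by rewrite /d; lra.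
pose S := a + b + 2; pose A := a + j%:R + 2; pose B := b + 1 - j%:R.
have [N0 [_ hN0]] := nat_above (`|S| + `|A| + `|B| + d + `|(1 - d) * B - S * A| / d).
apply: (@tends0_ratio _ d N0 d0) => [|N le].
  apply: ltW; apply: lt_trans (_ : N0%:R < _); last by rewrite ltr_nat.
  apply: le_lt_trans hN0; have := normr_ge0 S; have := normr_ge0 A; have := normr_ge0 B.
  have : 0 <= `|(1 - d) * B - S * A| / d by rewrite divr_ge0 // ltW.
  lra.
have hN : `|S| + `|A| + `|B| + d + `|(1 - d) * B - S * A| / d < N%:R.
  by apply: lt_le_trans hN0 _; rewrite ler_nat.
have q0 : 0 <= `|(1 - d) * B - S * A| / d by rewrite divr_ge0 // ltW.
have nS := normr_ge0 S; have nA := normr_ge0 A; have nB := normr_ge0 B.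
have [lS lA lB] : [/\ - `|S| <= S, - `|A| <= A & - `|B| <= B].
  by split; rewrite lerNl -normrN ler_norm.
have pS : 0 < N%:R + S by lra.
have pA : 0 < N%:R + A by lra.
have pB : 0 < N%:R + B by lra.
have N1 : 0 < N.+1%:R :> R by rewrite ltr0n.
have key : (N%:R + S) * (N%:R + A) <= (N%:R + 1 - d) * (N%:R + B).
  have h1 : `|(1 - d) * B - S * A| <= d * N%:R.
    rewrite -ler_pdivrMl // mulrC; lra.
  have h2 := ler_norm (- ((1 - d) * B - S * A)); rewrite normrN in h2.
  rewrite -subr_ge0.
  have -> : (N%:R + 1 - d) * (N%:R + B) - (N%:R + S) * (N%:R + A)
    = d * N%:R + ((1 - d) * B - S * A) by rewrite /S /A /B /d; ring.
  lra.
have := congr1 (fun x => `|x|) (ZS j N).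
rewrite (normrM (Z j N.+1)) (normrM (Z j N)) (normrM N.+1%:R) (normrM (N%:R + a + b + 2)).
have -> : N%:R + 1 + b - j%:R = N%:R + B by rewrite /B; ring.
have -> : N%:R + a + b + 2 = N%:R + S by rewrite /S; ring.
have -> : N%:R + a + j%:R + 2 = N%:R + A by rewrite /A; ring.
rewrite !(gtr0_norm pS, gtr0_norm pA, gtr0_norm pB, gtr0_norm N1) => e.
rewrite -(ler_pM2r (mulr_gt0 N1 pB)) e.
apply: le_trans (ler_wpM2l (normr_ge0 _) key) _.
rewrite [leRHS](_ : _ = `|Z j N| * ((N%:R + 1 - d) * (N%:R + B))) //.
by rewrite -natr1 in N1 *; field; rewrite gt_eqF.
Qed.

(** Otherwise the partial sums of nonnegative terms tend to 0, so every term vanishes, whereas the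
    product over [cs] is nonzero for large n. *)
Lemma endpoint_exponent (cs : seq R) (eps : R) : eps != 0 ->
  (forall n, 0 <= eps * (poch (a + 1) n * poch (b + 1) n
     / ((n%:R *+ 2 + a + b + 1) * poch (a + b + 1) n) * \prod_(c <- cs) (jac_eig a b n - c))) ->
  -1 <= a + (size cs)%:R.
Proof.
move=> eps0 hpos; rewrite leNgt; apply/negP => ak.
have n2 n : n%:R *+ 2 + a + b + 1 != 0.
  by have -> : n%:R *+ 2 + a + b + 1 = a + b + 1 + (n + n)%:R by rewrite natrD; ring.
pose P n := \prod_(c <- cs) (jac_eig a b n - c).
have wpos n : 0 <= eps * (wt n * P n).
  have h1 := poch_neq0 n hs; have h3 := poch_neq0 n hb; have h4 := n2 n; have h5 := fact_neq0 R n.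
  have -> : eps * (wt n * P n) = eps * (poch (a + 1) n * poch (b + 1) n
     / ((n%:R *+ 2 + a + b + 1) * poch (a + b + 1) n) * P n)
     * ((poch (a + b + 1) n * (n%:R *+ 2 + a + b + 1) / poch (b + 1) n) ^+ 2 / n`!%:R).
    rewrite /wt; move: h4; set D := n%:R *+ 2 + a + b + 1; clearbody D => h4.
    by field; rewrite h1 h3 h4 h5.
  by rewrite mulr_ge0 ?hpos // divr_ge0 ?sqr_ge0.
have [d hd] := newton_expand (fun i => (a + 1 + i%:R) * (b - i%:R)) cs.
pose S N := \sum_(n < N.+1) eps * (wt n * P n).
have SE N : S N = \sum_(j < (size cs).+1) (eps * d j) * Z j N.
  rewrite /S; under eq_bigr do rewrite /P hd !mulr_sumr.
  rewrite exchange_big; apply: eq_bigr => j _; rewrite -sum_wt_newton mulr_sumr.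
  by apply: eq_bigr => n _; ring.
have S0 : tends0 S.
  have h : tends0 (fun N => \sum_(j < (size cs).+1) (eps * d j) * Z j N).
    apply: (@tends0_sum (size cs).+1 (fun j N => (eps * d j) * Z j N)) => j jk.
    apply: tends0Z; apply: Z_tends0; apply: le_lt_trans ak.
    by rewrite lerD2l ler_nat -ltnS.
  by move=> e e0; have [N1 h1] := h e e0; exists N1 => N /h1; rewrite SE.
have Smono n N : (n <= N)%N -> eps * (wt n * P n) <= S N.
  move=> le; rewrite /S (bigD1 (Ordinal (le : n < N.+1)%N)) //= lerDl.
  by apply: sumr_ge0 => i _; apply: wpos.
have wz n : wt n * P n = 0.
  apply/eqP; rewrite -(mulrI_eq0 _ (mulfI eps0)); apply/eqP/le_anti; rewrite wpos andbT.
  rewrite leNgt; apply/negP => h; have h2 : 0 < eps * (wt n * P n) / 2 by rewrite divr_gt0.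
  have [N1 hN1] := S0 _ h2; have := hN1 (maxn n N1) (leq_maxr _ _).
  have := Smono n (maxn n N1) (leq_maxl _ _); have := ler_norm (S (maxn n N1)); lra.
(* For this n the eigenvalue is at least n and so exceeds every element of [cs]. *)
have [n [n0 hn]] := nat_above (`|a + b + 1| + 1 + \sum_(c <- cs) `|c|).
have := wz n; apply/eqP; rewrite mulf_neq0 //.
  rewrite /wt !mulf_neq0 ?invr_eq0 ?mulf_neq0 ?poch_neq0 ?n2 //; exact: fact_neq0.
rewrite /P prodf_seq_neq0; apply/allP => c cc /=; rewrite subr_eq0 gt_eqF //.
have sc : 0 <= \sum_(c <- cs) `|c| by rewrite sumr_ge0.
have hc : `|c| <= \sum_(c <- cs) `|c|.
  by rewrite (big_rem c) //= lerDl sumr_ge0.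
have h1 := ler_norm c; have h2 := ler_norm (- (a + b + 1)); rewrite normrN in h2.
have nn : 0 < n%:R :> R by rewrite ltr0n.
have hl : n%:R <= jac_eig a b n.
  rewrite /jac_eig -{1}[n%:R]mulr1 ler_pM2l //.
  have := normr_ge0 (a + b + 1); lra.
apply: lt_le_trans hl; have := normr_ge0 (a + b + 1); lra.
Qed.
End ExponentBound.

(** * The determinant Omega *)

Section EulerForm.
Variable R : archiRealFieldType.
Implicit Types (g : R) (n i j m : nat) (p q : {poly R}).

(* [t^j D^j = theta (theta - 1) ... (theta - j + 1)]. *)
Fixpoint ffact g j p : {poly R} := if j is j'.+1 then th (g + j'%:R) (ffact g j' p) else p.

Lemma ffact_jet j : exists c : nat -> R, c j = 1 /\
  forall g p, ffact g j p = \sum_(i < j.+1) c i *: jet g i p.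
Proof.
elim: j => [|j [c [cj hc]]].
  by exists (fun=> 1); split=> // g p; rewrite big_ord1 scale1r.
exists (fun i => (if i is i'.+1 then c i' else 0) - (if (i <= j)%N then j%:R * c i else 0)).
split; first by rewrite ltnn subr0.
move=> g p; rewrite /= hc th_sum.
have step (i : nat) : th (g + j%:R) (c i *: jet g i p) = c i *: jet g i.+1 p - (j%:R * c i) *: jet g i p.
  by rewrite thZ jetS !thE -!mul_polyC !(polyCD, polyCM); ring.
rewrite (eq_bigr _ (fun (i : 'I_j.+1) _ => step i)).
under [RHS]eq_bigr do rewrite scalerBl.
rewrite !sumrB; congr (_ - _).
  by rewrite [RHS]big_ord_recl scale0r add0r.
rewrite [RHS]big_ord_recr /= ltnn scale0r addr0; apply: eq_bigr => i _.
by rewrite leq_ord.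
Qed.

Lemma det_ffact n (gam : nat -> R) (phi : nat -> {poly R}) :
  \det (\matrix_(i < n, j < n) ffact (gam i) j (phi i)) = \det (wmx n gam phi) :> {poly R}.
Proof.
have [c hc] := fin_all_exists (fun j : 'I_n => ffact_jet j).
pose C : 'M[{poly R}]_n := \matrix_(i < n, j < n) (if (i <= j)%N then (c j i)%:P else 0).
have -> : \matrix_(i < n, j < n) ffact (gam i) j (phi i) = wmx n gam phi *m C.
  apply/matrixP => i j; rewrite !mxE (hc j).2.
  rewrite (big_ord_widen n (fun l => c j l *: jet (gam i) l (phi i))) // big_mkcond /=.
  apply: eq_bigr => l _; rewrite !mxE ltnS; case: ifP => _; rewrite ?mulr0 //.
  by rewrite -mul_polyC mulrC.
rewrite det_mulmx -[\det C]det_tr [\det C^T]det_trig; last first.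
  by apply/is_trig_mxP => i j ij; rewrite !mxE leqNgt ij.
rewrite big1 ?mulr1 // => i _.
by rewrite !mxE leqnn (hc i).1.
Qed.

Lemma ffact_derivn j p : ffact 0 j p = 'X^j * p^`(j).
Proof.
elim: j => [|j IH]; first by rewrite expr0 mul1r.
rewrite [LHS]/= IH add0r derivnS thE derivM derivXn.
move: p^`(j) (p^`(j)^`()) => q q'.
have -> : 'X * ('X^(j.-1) *+ j * q + 'X^j * q') =
    ('X * 'X^(j.-1) *+ j) * q + 'X^(j.+1) * q' :> {poly R}.
  by rewrite mulrDr mulrA -mulrnAr mulrA exprS.
have -> : 'X * 'X^(j.-1) *+ j = j%:R%:P * 'X^j :> {poly R}.
  by case: j {IH} => [|j]; rewrite ?mulr0n ?polyC0 ?mul0r // -exprS polyC_natr mulr_natl.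
by rewrite mulrA addrC addKr.
Qed.

(** Each factor of [ffact] is one use of [jac_raise] at the shifted parameters, contributing f - b -
    j; the signs turn these into the Pochhammer symbol of the matrix. *)
Lemma ffact_jac (a b : R) (f j : nat) :
  (-1) ^+ j *: ffact b j (jac a (- b) f) =
  poch (b - f%:R) j *: jac (a + j%:R) (- b - j%:R) f.
Proof.
elim: j => [|j IH]; first by rewrite expr0 poch0 /= addr0 subr0.
rewrite /= exprS mulN1r scaleNr -thZ IH thZ pochS.
have := jac_raise (a + j%:R) (- b - j%:R) f.
have -> : - b - j%:R - 1 = - b - j.+1%:R :> R by rewrite -natr1; ring.
have -> : a + j%:R + 1 = a + j.+1%:R by rewrite -natr1; ring.
rewrite /th; have -> : (- b - j%:R) *: jac (a + j%:R) (- b - j%:R) f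
   = - ((b + j%:R) *: jac (a + j%:R) (- b - j%:R) f) by rewrite -scaleNr; congr (_ *: _); ring.
move=> ->; rewrite scalerA -scaleNr; congr (_ *: _); ring.
Qed.

Lemma derivn_comp_shift (c : R) p j : (p \Po ('X - c%:P))^`(j) = p^`(j) \Po ('X - c%:P).
Proof.
elim: j => [|j IH] //; rewrite !derivnS IH deriv_comp derivB derivX derivC.
by rewrite subr0 mulr1.
Qed.

Section Families.
Variables (a b : R) (F1 F2 : seq nat).
Let k1 := size F1.
Let k2 := size F2.

(** Seeds of F2 stand for the functions t^(-beta) P_f^(alpha,-beta), the other family of
    eigenfunctions of the same operator. *)
Definition seed_gam (i : nat) : R := if (i < size F1)%N then 0 else b.
Definition seed_phi (i : nat) : {poly R} :=
  if (i < size F1)%N then jac a b (nth 0%N F1 i) else jac a (- b) (nth 0%N F2 (i - size F1)).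
Definition seed_lam (i : nat) : R :=
  if (i < size F1)%N then jac_eig a b (nth 0%N F1 i)
  else - ((b - (nth 0%N F2 (i - size F1))%:R) * ((nth 0%N F2 (i - size F1))%:R + a + 1)).

Lemma seed_eigen i : eigen (a + b) b (seed_gam i) (seed_lam i) (seed_phi i).
Proof.
rewrite /seed_gam /seed_lam /seed_phi; case: ifP => _; first exact: jac_eigen.
set f := nth _ _ _; have om := jac_ode a (- b) f.
move: om; set OM := (X in X = 0) => om; rewrite /eigen.
transitivity ('X * OM); last by rewrite om mulr0.
rewrite /OM !thE -!mul_polyC !(derivB, derivM, derivX, derivC).
by rewrite !(polyCN, polyCD, polyCM, polyC1, polyC0); ring.
Qed.

(** Scaling column j by t^j and each row of F2 by t^(n-1) yields the matrix of [ffact]. By the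
    binomial identities [e1] and [e2] the surplus power of t is the denominator of [Omega]. *)
Lemma det_Wmat_shift (Q : {poly R}) :
  \det (wmx (k1 + k2) seed_gam seed_phi) = 'X^(\sum_(i < k1) i + \sum_(i < k2) i) * Q ->
  exists c : R, c != 0 /\
    \det (Wmat a b F1 F2) = ('X + 1) ^+ (k2 * k2.-1) * (c *: (Q \Po ('X + 1))).
Proof.
move=> hQ; pose n := (k1 + k2)%N; pose sh := comp_poly ('X - 1 : {poly R}).
have XX' : ('X - 1 : {poly R}) \Po ('X + 1) = 'X.
  by rewrite comp_polyB comp_polyX comp_polyC addrK.
pose r (i : 'I_n) : {poly R} := if (i < k1)%N then 1 else 'X^(n - 1).
have key : map_mx sh (Wmat a b F1 F2) *m diag_mx (\row_(j < n) 'X^j)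
   = diag_mx (\row_i r i) *m ((\matrix_(i < n, j < n) ffact (seed_gam i) j (seed_phi i))
       *m diag_mx (\row_(j < n) (-1) ^+ j)).
  apply/matrixP => i j; rewrite mul_mx_diag mul_diag_mx mul_mx_diag !mxE /r /seed_gam /seed_phi.
  case: ifP => hi.
    rewrite /sh comp_polyZ mul1r ffact_derivn /jac -polyC1 derivn_comp_shift.
    by rewrite -mul_polyC rmorph_sign; ring.
  set f := nth _ _ _.
  have fj := ffact_jac a b f j.
  rewrite -!mul_polyC rmorph_sign in fj.
  rewrite mulrCA [RHS](_ : _ = 'X^(n - 1) * ((-1) ^+ j * ffact b j (jac a (- b) f))); last by ring.
  rewrite fj /sh !rmorphM /= comp_polyC rmorphXn /= comp_polyD comp_polyX comp_polyC.
  rewrite polyC1 subrK -/(jac _ _ _).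
  have -> : 'X^(n - 1) = 'X^(n - 1 - j) * 'X^j :> {poly R}.
    by rewrite -exprD subnK // -ltnS subn1 prednK // (leq_ltn_trans _ (ltn_ord j)).
  by rewrite -/n; ring.
have := congr1 determinant key; rewrite !det_mulmx !det_diag det_map_mx det_ffact -/n hQ.
have -> : \prod_(i < n) (\row_(j < n) 'X^j : 'rV[{poly R}]_n) 0 i = 'X^(\sum_(i < n) i).
  by rewrite expr_sum; apply: eq_bigr => i _; rewrite mxE.
have -> : \prod_(i < n) (\row_i0 r i0) 0 i = 'X^((n - 1) * k2).
  rewrite big_split_ord /= big1 ?mul1r => [|i _]; last by rewrite mxE /r /= ltn_ord.
  rewrite (eq_bigr (fun=> 'X^(n - 1))) => [|i _].
    by rewrite prodr_const card_ord exprM.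
  by rewrite mxE /r /= ltnNge leq_addr.
have -> : \prod_(i < n) (\row_(j < n) (-1) ^+ j : 'rV[{poly R}]_n) 0 i = ((-1) ^+ (\sum_(i < n) i))%:P.
  by rewrite rmorph_sign expr_sum; apply: eq_bigr => i _; rewrite mxE.
set c := (-1) ^+ _ => eqd; exists c; split; first by rewrite signr_eq0.
have tri m : (\sum_(i < m) i = 'C(m, 2))%N by rewrite -(big_mkord xpredT id) bin2_sum.
have e1 : (\sum_(i < n) i = \sum_(i < k1) i + \sum_(i < k2) i + k1 * k2)%N.
  rewrite /n big_split_ord /= -addnA; congr (_ + _)%N.
  by rewrite big_split /= sum_nat_const card_ord addnC mulnC.
have e2 : ((n - 1) * k2 = k1 * k2 + k2 * k2.-1)%N.
  by rewrite /n; case: (k2) => [|m]; rewrite ?muln0 // addnS subn1 /= mulnDl [(m.+1 * m)%N]mulnC.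
move: eqd; rewrite e2 {1}e1 exprD => eqd.
have : sh (\det (Wmat a b F1 F2)) = 'X^(k2 * k2.-1) * (c *: Q).
  apply: (@mulIf _ ('X^(\sum_(i < k1) i + \sum_(i < k2) i) * 'X^(k1 * k2))).
    by rewrite mulf_neq0 // -size_poly_eq0 size_polyXn.
  by rewrite eqd exprD -mul_polyC; ring.
move=> /(congr1 (comp_poly ('X + 1))); rewrite /sh -comp_polyA XX'.
rewrite comp_polyXr => ->.
by rewrite comp_polyM comp_polyZ rmorphXn /= comp_polyX.
Qed.
End Families.
End EulerForm.

(** * Admissibility without Gamma, and the bounds on alpha and beta *)

Section Admissible.
Variable R : archiRealFieldType.

Lemma nonpole_S (c : R) : not_negint c -> nonpole (c + 1).
Proof.
move=> h n; apply/negP => /eqP e; apply: (h n).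
by apply/eqP; rewrite -addr_eq0 -nat1r addrA e.
Qed.

Lemma sorted_le_last (F : seq nat) f : sorted ltn F -> f \in F -> (f <= last 0 F)%N.
Proof.
move=> sF fF; rewrite -nth_last -{1}(nth_index 0%N fF).
have i_lt : (index f F < size F)%N by rewrite index_mem.
apply: (sorted_leq_nth leq_trans leqnn); rewrite ?inE //.
- by apply: sub_sorted sF => x y; apply: ltnW.
- by case: (size F) i_lt.
- by rewrite -ltnS (leq_trans i_lt) // leqSpred.
Qed.

Lemma posset_size_le_last (F : seq nat) : posset F -> (size F <= last 0 F)%N.
Proof.
move=> /andP[sF /allP pF]; rewrite -[leqRHS](size_iota 1).
apply: uniq_leq_size; first exact: (sorted_uniq ltn_trans ltnn sF).
by move=> f fF; rewrite mem_iota pF //= add1n ltnS sorted_le_last.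
Qed.

Lemma gbinom_neq0 (c : R) n : (forall i, (i < n)%N -> c - i%:R != 0) -> gbinom c n != 0.
Proof.
move=> h; rewrite /gbinom mulf_neq0 ?invr_neq0 ?fact_neq0 //.
by apply/prodf_neq0 => i _; apply: h.
Qed.

Section Gamma.
Variable Gamma : R -> R.
Hypothesis HGpos : forall t : R, 0 < t -> 0 < Gamma t.
Hypothesis HGrec : forall t : R, t <> 0 -> not_negint t -> Gamma (t + 1) = t * Gamma t.

Lemma Gamma_poch c n : nonpole c -> Gamma (c + n%:R) = poch c n * Gamma c.
Proof.
move=> hc; elim: n => [|n IH]; first by rewrite addr0 poch0 mul1r.
rewrite -natr1 addrA HGrec ?IH ?pochS; first by ring.
  by apply/eqP.
by move=> m /eqP; rewrite -addr_eq0 -addrA -natrD; apply/negP.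
Qed.

Lemma Gamma_neq0 c : nonpole c -> Gamma c != 0.
Proof.
move=> hc; have [n [_ hn]] := nat_above (- c).
have : Gamma (c + n%:R) != 0 by rewrite gt_eqF // HGpos // -ltrBlDl sub0r.
by rewrite Gamma_poch //; apply: contraNneq => ->; rewrite mulr0.
Qed.

Variables (a b : R) (F1 F2 : seq nat).
Hypotheses (ha : nonpole (a + 1)) (hb : nonpole (b + 1)) (hs : nonpole (a + b + 1)).

Definition seed_eig2 (f : nat) : R := - ((b - f%:R) * (f%:R + a + 1)).
Definition seeds : seq R := map (jac_eig a b) F1 ++ map seed_eig2 F2.
Definition Gamma_ratio := Gamma (a + 1) * Gamma (b + 1) / Gamma (a + b + 1).

(** The Gamma quotient splits into Pochhammer symbols and a factor independent of n. That factor may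
    be negative, which is why later statements carry a nonzero [eps]. *)
Lemma Hfun_norm (n : nat) : Hfun Gamma a b F1 F2 n = Gamma_ratio *
  (poch (a + 1) n * poch (b + 1) n / ((n%:R *+ 2 + a + b + 1) * poch (a + b + 1) n)
   * \prod_(c <- seeds) (jac_eig a b n - c)).
Proof.
rewrite /Hfun /seeds big_cat !big_map /=.
have -> : \prod_(f <- F1) ((n%:R - f%:R) * (n%:R + f%:R + a + b + 1)) =
    \prod_(f <- F1) (jac_eig a b n - jac_eig a b f).
  by apply: eq_bigr => f _; rewrite /jac_eig; ring.
have -> : \prod_(f <- F2) ((n%:R + b - f%:R) * (n%:R + f%:R + a + 1)) =
    \prod_(f <- F2) (jac_eig a b n - seed_eig2 f).
  by apply: eq_bigr => f _; rewrite /jac_eig /seed_eig2; ring.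
have -> : n%:R + a + 1 = a + 1 + n%:R by ring.
have -> : n%:R + b + 1 = b + 1 + n%:R by ring.
have -> : n%:R + a + b + 1 = a + b + 1 + n%:R by ring.
rewrite !Gamma_poch // /Gamma_ratio.
have h2 : n%:R *+ 2 + a + b + 1 != 0.
  have -> : n%:R *+ 2 + a + b + 1 = a + b + 1 + (n + n)%:R by rewrite natrD; ring.
  exact: hs.
have hp := poch_neq0 n hs; have hg := Gamma_neq0 hs.
move: h2; rewrite -mulr_natl => h2.
move: (\prod_(_ <- _) _) (\prod_(_ <- F2) _) (Gamma _) (Gamma _) (Gamma _) hg (poch _ n) (poch _ n) (poch _ n) hp.
by move=> p q G1 G2 G3 hg p1 p2 p3 hp; field; rewrite hp h2 hg.
Qed.

Lemma Gamma_ratio_neq0 : Gamma_ratio != 0.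
Proof. by rewrite /Gamma_ratio !mulf_neq0 ?invr_neq0 ?Gamma_neq0. Qed.

End Gamma.

Section Exponents.
Variables (a b : R) (F1 F2 : seq nat).
Hypotheses (ha : nonpole (a + 1)) (hb : nonpole (b + 1)) (hs : nonpole (a + b + 1)).
Variable eps : R.
Hypothesis eps0 : eps != 0.
Hypothesis hpos : forall n, 0 <= eps *
  (poch (a + 1) n * poch (b + 1) n / ((n%:R *+ 2 + a + b + 1) * poch (a + b + 1) n)
   * \prod_(c <- seeds a b F1 F2) (jac_eig a b n - c)).

Lemma exponent_a : -1 < a + (size F1 + size F2)%:R.
Proof.
have := endpoint_exponent ha hb hs eps0 hpos.
rewrite /seeds size_cat !size_map le_eqVlt => /orP[/eqP e|//].
by have := ha (size F1 + size F2)%N; rewrite addrAC -e addNr eqxx.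
Qed.

(* The complementary family: replacing [beta] by [beta - m] and [F2] by its
   complement in [0, m) only changes the weights by squares. *)
Lemma exponent_b m : nonpole (b - m%:R + 1) -> uniq F2 -> {in F2, forall f, (f < m)%N} ->
  -1 <= b - m%:R + (size F1 + (m - size F2))%:R.
Proof.
move=> hm uF2 F2m; pose F2c := [seq g <- iota 0 m | g \notin F2].
have F2p : perm_eq (F2 ++ F2c) (iota 0 m).
  apply: uniq_perm; rewrite ?iota_uniq //.
    rewrite cat_uniq uF2 filter_uniq ?iota_uniq // andbT /=.
    by apply/hasPn => g; rewrite mem_filter => /andP[].
  move=> g; rewrite mem_cat mem_filter mem_iota /= add0n.
  by case: (boolP (g \in F2)) => // /F2m ->.
have sF2c : size F2c = (m - size F2)%N.
  by rewrite -(size_iota 0 m) -(perm_size F2p) size_cat addKn.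
have bg n g : (g < m)%N -> b + n%:R - g%:R != 0.
  move=> gm; have := hm (n + (m - g.+1))%N; rewrite natrD natrB // -natr1.
  by congr (_ != _); ring.
pose D n g := (n%:R + b - g%:R) * (n%:R + g%:R + a + 1).
have DE n (s : seq nat) : \prod_(c <- map (seed_eig2 a b) s) (jac_eig a b n - c) = \prod_(g <- s) D n g.
  by rewrite big_map; apply: eq_bigr => g _; rewrite /jac_eig /seed_eig2 /D; ring.
(* Over all of [0, m) the factors form two Pochhammer symbols, so the product over the complement is
   these divided by the product over F2. *)
have Dall n : (\prod_(g <- F2) D n g) * (\prod_(g <- F2c) D n g) =
    poch (b - m%:R + 1 + n%:R) m * poch (a + 1 + n%:R) m.
  rewrite -big_cat (perm_big _ F2p) -(subn0 m) -/(index_iota 0 m) big_mkord subn0 big_split /=.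
  rewrite (reindex_inj rev_ord_inj) /poch /=; congr (_ * _); apply: eq_bigr => g _; last by ring.
  by rewrite natrB // -natr1; ring.
have D0 n : \prod_(g <- F2) D n g != 0.
  rewrite prodf_seq_neq0; apply/allP => g gF2; rewrite /D mulf_neq0 //.
    by rewrite [n%:R + b]addrC bg // F2m.
  by have := ha (n + g)%N; rewrite natrD; congr (_ != _); ring.
have hm2 : nonpole (a + m%:R + 1) by rewrite addrAC; apply: nonpole_addn.
have hs2 : nonpole (b - m%:R + (a + m%:R) + 1).
  by have -> : b - m%:R + (a + m%:R) + 1 = a + b + 1 by ring.
have ratio0 : poch (a + 1) m / poch (b - m%:R + 1) m != 0.
  by rewrite mulf_neq0 ?invr_neq0 ?poch_neq0.
(* The two endpoints are exchanged: beta - m plays the part of a, and alpha + m that of b. *)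
have := endpoint_exponent hm hm2 hs2 (cs := seeds a b F1 F2c) (mulf_neq0 eps0 ratio0).
rewrite /seeds size_cat !size_map sF2c; apply => n.
have -> : jac_eig (b - m%:R) (a + m%:R) n = jac_eig a b n by rewrite /jac_eig; ring.
have := mulr_ge0 (hpos n) (sqr_ge0 (poch (a + 1 + n%:R) m / \prod_(g <- F2) D n g)).
rewrite /seeds !big_cat /= !DE; congr (_ <= _).
have {}Dall := Dall n; have {}D0 := D0 n.
have pa := poch_add (a + 1) m n; have pa' := poch_add (a + 1) n m.
have pb := poch_add (b - m%:R + 1) m n; have pb' := poch_add (b - m%:R + 1) n m.
have v0 := poch_neq0 m (nonpole_addn n ha); have u0 := poch_neq0 m (nonpole_addn n hm).
rewrite addnC in pa'; rewrite pa' in pa; rewrite addnC in pb'; rewrite pb' in pb.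
have e1 : n%:R *+ 2 + (b - m%:R) + (a + m%:R) + 1 = n%:R *+ 2 + a + b + 1 by ring.
have e2 : b - m%:R + (a + m%:R) + 1 = a + b + 1 by ring.
have e3 : a + m%:R + 1 = a + 1 + m%:R by ring.
have e4 : b - m%:R + 1 + m%:R = b + 1 by ring.
rewrite e1 e2 e3; rewrite e4 in pb.
have am0 := poch_neq0 m ha; have bm0 := poch_neq0 m hm.
have -> : \prod_(g <- F2c) D n g = poch (b - m%:R + 1 + n%:R) m * poch (a + 1 + n%:R) m / \prod_(g <- F2) D n g.
  by rewrite -Dall mulrAC mulfV // mul1r.
have -> : poch (a + 1 + m%:R) n = poch (a + 1) n * poch (a + 1 + n%:R) m / poch (a + 1) m.
  by rewrite pa mulrAC mulfV // mul1r.
have -> : poch (b - m%:R + 1) n = poch (b - m%:R + 1) m * poch (b + 1) n / poch (b - m%:R + 1 + n%:R) m.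
  by rewrite -pb mulfK.
move: (\prod_(g <- F2) D n g) D0 => d D0.
move: (poch (b - m%:R + 1) m) (poch (b - m%:R + 1 + n%:R) m) bm0 u0 => bm u bm0 u0.
move: (poch (a + 1) m) (poch (a + 1 + n%:R) m) am0 v0 => am v am0 v0.
move: ((n%:R *+ 2 + a + b + 1) * poch (a + b + 1) n)^-1 => w.
move: (poch (a + 1) n) (poch (b + 1) n) (\prod_(_ <- _) _) => pa1 pb1 f1.
by clear -D0 bm0 u0 am0 v0; field; rewrite D0 bm0 u0 am0.
Qed.
End Exponents.
End Admissible.

Section Nonvanishing.
Variable R : archiRealFieldType.
Variables (a b : R) (F1 F2 : seq nat).
Hypotheses (ha : nonpole (a + 1)) (hb : nonpole (b + 1)) (hs : nonpole (a + b + 1)).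
Hypotheses (hF1 : posset F1) (hF2 : posset F2).
Hypothesis hab : F2 != [::] -> nonpole (a - b + 1).
Hypothesis hbF2 : F2 != [::] -> nonpole (b - (last 0%N F2)%:R).

Lemma beta_seed_neq0 n m : F2 != [::] -> (m <= last 0 F2)%N -> b + n%:R - m%:R != 0.
Proof.
move=> ne le; have := hbF2 ne (n + (last 0 F2 - m))%N.
by rewrite natrD natrB //; congr (_ != _); ring.
Qed.

Lemma mem_neq_nil (f : nat) : f \in F2 -> F2 != [::].
Proof. by case: F2. Qed.

Lemma mem_le_last f : f \in F2 -> (f <= last 0 F2)%N.
Proof. by apply: sorted_le_last; case/andP: hF2. Qed.

(** Every difference of two eigenvalues factors into linear terms: (A1) handles two elements of F1,
    the condition on alpha - beta two elements of F2, and the mixed case needs alpha together with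
    the condition on beta and the last element of F2. *)
Lemma uniq_seeds : uniq (seeds a b F1 F2).
Proof.
have uF (F : seq nat) : posset F -> uniq F by move=> /andP[sF _]; exact: (sorted_uniq ltn_trans ltnn sF).
rewrite /seeds cat_uniq !map_inj_in_uniq ?uF ?andbT //=.
- apply/hasPn => c /mapP[g gF2 ->]; apply/negP => /mapP[f _ /eqP].
  rewrite -subr_eq0; have ne := mem_neq_nil gF2.
  have -> : seed_eig2 a b g - jac_eig a b f = - ((b + f%:R - g%:R) * (a + 1 + (f + g)%:R)).
    by rewrite /seed_eig2 /jac_eig natrD; ring.
  by rewrite oppr_eq0 mulf_eq0 (negbTE (beta_seed_neq0 _ ne (mem_le_last gF2))) (negbTE (ha _)).
- move=> f g fF2 gF2 /eqP; rewrite -subr_eq0.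
  have -> : seed_eig2 a b f - seed_eig2 a b g = (f%:R - g%:R) * (a - b + 1 + (f + g)%:R).
    by rewrite /seed_eig2 natrD; ring.
  by rewrite mulf_eq0 (negbTE (hab (mem_neq_nil fF2) _)) orbF subr_eq0 eqr_nat => /eqP.
- by move=> f g _ _ e; apply/eqP/negPn/negP => /(jac_eig_inj hs); rewrite e eqxx.
Qed.

Lemma size_seeds : size (seeds a b F1 F2) = (size F1 + size F2)%N.
Proof. by rewrite size_cat !size_map. Qed.

Lemma seed_lamE i : (i < size F1 + size F2)%N ->
  seed_lam a b F1 F2 i = nth 0 (seeds a b F1 F2) i.
Proof.
move=> lt; rewrite /seed_lam nth_cat size_map; case: ltnP => h; first by rewrite (nth_map 0%N).
by rewrite (nth_map 0%N) // ltn_subLR.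
Qed.

Lemma seed_lam_inj i j : (i < size F1 + size F2)%N -> (j < size F1 + size F2)%N ->
  seed_lam a b F1 F2 i = seed_lam a b F1 F2 j -> i = j.
Proof.
move=> hi hj; rewrite !seed_lamE // => /eqP.
by rewrite nth_uniq ?uniq_seeds ?size_seeds // => /eqP.
Qed.

Lemma nth_F2 i : (size F1 <= i)%N -> (i < size F1 + size F2)%N -> nth 0%N F2 (i - size F1) \in F2.
Proof. by move=> h lt; rewrite mem_nth // ltn_subLR. Qed.

Lemma seed_phi_at2 i : (i < size F1 + size F2)%N -> (seed_phi a b F1 F2 i).[2] != 0.
Proof.
have an f : gbinom (f%:R + a) f != 0.
  apply: gbinom_neq0 => j jf; have := ha (f - j.+1)%N.
  by rewrite natrB // -natr1; congr (_ != _); ring.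
by rewrite /seed_phi; case: ifP => _ _; rewrite jac_at2.
Qed.

Lemma seed_phi_at0 i : (i < size F1 + size F2)%N -> (seed_phi a b F1 F2 i)`_0 != 0.
Proof.
move=> lt; rewrite -horner_coef0 /seed_phi; case: ltnP => h; rewrite jac_at0 mulf_neq0 ?signr_eq0 //;
  apply: gbinom_neq0 => j; set f := nth _ _ _ => jf.
  have := hb (f - j.+1)%N.
  by rewrite natrB // -natr1; congr (_ != _); ring.
have fF2 : f \in F2 by apply: nth_F2.
have := beta_seed_neq0 0 (mem_neq_nil fF2) (leq_trans (leq_subr j f) (mem_le_last fF2)).
by rewrite addr0 -oppr_eq0 natrB ?(ltnW jf) //; congr (_ != _); ring.
Qed.

Lemma seed_gam_nonpole i : nonpole (seed_gam b F1 i + 1).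
Proof. by rewrite /seed_gam; case: ifP => _ //; rewrite add0r; apply: gt0_nonpole. Qed.

Variable eps : R.
Hypothesis eps0 : eps != 0.
Hypothesis hpos : forall n, 0 <= eps *
  (poch (a + 1) n * poch (b + 1) n / ((n%:R *+ 2 + a + b + 1) * poch (a + b + 1) n)
   * \prod_(c <- seeds a b F1 F2) (jac_eig a b n - c)).
Hypothesis F12 : F1 ++ F2 != [::].

Lemma Omega_neq0 x : -1 <= x <= 1 -> (Omega a b F1 F2).[x] != 0.
Proof.
move=> /andP[x1 x2].
set k1 := size F1; set k2 := size F2.
have [Q Q0 hQ] : exists2 Q : {poly R}, Q.[0] != 0 & \det (wmx (k1 + k2) (seed_gam b F1) (seed_phi a b F1 F2))
    = 'X^(\sum_(i < k1) i + \sum_(i < k2) i) * Q.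
  apply: (@wronskian_at0 R (a + b) b k1 k2 (seed_gam b F1) (seed_lam a b F1 F2)) => //.
  - by move=> i lt; rewrite /seed_gam lt.
  - by move=> i; rewrite /seed_gam ltnNge leq_addr.
  - by move=> i _; apply: seed_eigen.
  - exact: seed_phi_at0.
  - by move=> i j lti ltj; apply: seed_lam_inj; apply: (leq_trans _ (leq_addr _ _)).
  - by move=> i j lti ltj /seed_lam_inj; rewrite !ltn_add2l => /(_ lti ltj) /addnI.
  - move=> m lt; have ne : F2 != [::] by move: lt; rewrite /k2; case: F2.
    have := beta_seed_neq0 0 ne (leq_trans (ltnW lt) (posset_size_le_last hF2)).
    by rewrite addr0 -oppr_eq0 opprB.
have [c [c0 ->]] : exists c : R, c != 0 /\ Omega a b F1 F2 = c *: (Q \Po ('X + 1)).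
  have [c [c0 hc]] := det_Wmat_shift hQ; exists c; split=> //.
  by rewrite /Omega hc mulKp // expf_neq0 // -polyC1 -size_poly_eq0 size_XaddC.
rewrite hornerZ horner_comp hornerD hornerX hornerC mulf_neq0 //.
have W0 : \det (wmx (k1 + k2) (seed_gam b F1) (seed_phi a b F1 F2)) != 0.
  rewrite hQ mulf_neq0 // ?expf_neq0 ?polyX_eq0 //.
  by apply: contraNneq Q0 => ->; rewrite horner0.
(* At x = -1 the value is Q at 0; elsewhere Q and the Wronskian differ by a nonzero power of t. *)
suff : x + 1 != 0 -> (\det (wmx (k1 + k2) (seed_gam b F1) (seed_phi a b F1 F2))).[x + 1] != 0.
  have [->|x0 /(_ isT)] := eqVneq (x + 1) 0; first by [].
  by rewrite hQ hornerM mulf_eq0 negb_or => /andP[].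
move=> x0; have [x11|x11] := eqVneq x 1.
  rewrite x11; apply: (@wronskian_at2 _ a b _ _ (seed_lam a b F1 F2)) => //.
  - by move=> i _; apply: seed_eigen.
  - exact: seed_phi_at2.
  - exact: seed_lam_inj.
have : (0 < k1 + k2)%N by rewrite -size_cat lt0n size_eq0.
case E : (k1 + k2)%N => [//|K] _; rewrite E in W0.
(* The norm of the Jacobi polynomial contains the factor a + b + 1, which the constant
   [eps / (a + b + 1)] cancels. *)
apply: (@wronskian_neq0_interior R a b K _ (seed_lam a b F1 F2) _ ha hb hs _ _ (eps / (a + b + 1))) => //.
- by move=> i _; apply: seed_eigen.
- by move=> i _; apply: seed_gam_nonpole.
- by rewrite mulf_neq0 ?invr_neq0 //; have := hs 0; rewrite addr0.
- move=> n; have s0 : a + b + 1 != 0 by have := hs 0; rewrite addr0.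
  have -> : \prod_(f < K.+1) (jac_eig a b n - seed_lam a b F1 F2 f) = \prod_(c <- seeds a b F1 F2) (jac_eig a b n - c).
    rewrite [RHS](big_nth 0) size_seeds E [RHS]big_mkord; apply: eq_bigr => i _.
    by rewrite seed_lamE // E.
  have := divr_ge0 (hpos n) (ler0n R n`!); congr (_ <= _).
  rewrite jac_sqnorm //.
  move: (n`!%:R) (n%:R *+ 2 + a + b + 1) (poch (a + b + 1) n) => f l p3.
  move: (\prod_(_ <- _) _) (poch _ n) (poch _ n) => f1 p1 p2.
  by rewrite !invfM; move: f^-1 l^-1 p3^-1 => f' l' p3'; field.
- apply/andP; split; first by rewrite lt0r x0 -lerBlDr sub0r.
  by rewrite -ltrBrDr (_ : 2 - 1 = 1) ?lt_neqAle ?x11 //; ring.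
Qed.

End Nonvanishing.

Theorem theorem6p4 (R : archiRealFieldType) (Gamma : R -> R)
  (* Gamma is the Gamma function: positive on (0,oo) and Gamma(t+1) = t Gamma(t)
     away from the poles; these determine all values used below up to the
     positive factors irrelevant to the sign condition. *)
  (HGpos : forall t : R, 0 < t -> 0 < Gamma t)
  (HGrec : forall t : R, t <> 0 -> not_negint t -> Gamma (t + 1) = t * Gamma t)
  (F1 F2 : seq nat) (alpha beta : R) :
  posset F1 -> posset F2 -> (F1 ++ F2 != [::]) ->
  (* (A1) *)
  not_negint alpha -> not_negint beta -> not_negint (alpha + beta) ->
  (* (A2) *)
  (F2 != [::] ->
     not_negint (alpha - beta) /\ not_negint (beta - (last 0%N F2)%:R - 1)) ->
  jacobi_admissible Gamma alpha beta F1 F2 ->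
  ((-1 < alpha + (size F1 + size F2)%:R) /\
   (-1 < beta + (size F1)%:R - (size F2)%:R)) /\
  (0 < alpha + beta + (sF F1)%:R + 1 ->
   forall x : R, -1 <= x <= 1 -> (Omega alpha beta F1 F2).[x] != 0).
Proof.
move=> hF1 hF2 F12 /nonpole_S ha /nonpole_S hb /nonpole_S hs A2 adm.
have hab : F2 != [::] -> nonpole (alpha - beta + 1) by move=> /A2[/nonpole_S].
have hbF2 : F2 != [::] -> nonpole (beta - (last 0%N F2)%:R).
  by move=> /A2[_ /nonpole_S]; rewrite subrK.
have eps0 := Gamma_ratio_neq0 HGpos HGrec ha hb hs.
have hpos n : 0 <= Gamma_ratio Gamma alpha beta * (poch (alpha + 1) n * poch (beta + 1) n
    / ((n%:R *+ 2 + alpha + beta + 1) * poch (alpha + beta + 1) n)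
    * \prod_(c <- seeds alpha beta F1 F2) (jac_eig alpha beta n - c)).
  by rewrite -(Hfun_norm HGpos HGrec) //; apply: adm.
split; last by move=> _ x hx; apply: Omega_neq0 hpos _ _ hx.
split; first exact: (exponent_a ha hb hs eps0 hpos).
have uF2 : uniq F2 by case/andP: hF2 => sF _; exact: (sorted_uniq ltn_trans ltnn sF).
have beta_neq : beta + (size F1)%:R - (size F2)%:R != -1.
  rewrite -addr_eq0; have [e|ne] := eqVneq F2 [::].
    by have := hb (size F1); rewrite e subr0; congr (_ != _); ring.
  have := hbF2 ne ((size F1).+1 + (last 0%N F2 - size F2))%N.
  rewrite natrD natrB ?posset_size_le_last // -natr1.
  by congr (_ != _); ring.
rewrite lt_neqAle eq_sym beta_neq /=.
(* The least m with F2 inside [0, m); then beta - m + 1 is beta minus the last element of F2, or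
   beta + 1 if F2 is empty, and (A2) or (A1) applies. *)
pose m := if F2 == [::] then 0%N else (last 0%N F2).+1.
have hm : nonpole (beta - m%:R + 1).
  rewrite /m; case: ifP => [_|/negbT /hbF2]; first by rewrite subr0.
  by rewrite -natr1 opprD addrA subrK.
have F2m : {in F2, forall f, (f < m)%N}.
  move=> f fF2; have -> : m = (last 0%N F2).+1 by rewrite /m; case: (F2) fF2.
  by rewrite ltnS sorted_le_last //; case/andP: hF2.
have le_m : (size F2 <= m)%N.
  rewrite /m; case: eqP => [->//|_]; exact: leqW (posset_size_le_last hF2).
have := exponent_b ha hs eps0 hpos hm uF2 F2m.
by rewrite natrD natrB //; congr (_ <= _); ring.
Qed.
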